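(* Let $5_1$ and $8_2$ be the knots of those names in the standard (Rolfsen) knot table, with mirror images chosen so that the connected sum $K_5=5_1\#8_2$ has signature $\sigma(K_5)=0$. Then $u(5_1)=2$, $u(8_2)=2$, and $u(5_1\#8_2)\le 3$.
   Context: Knots are smooth (tame) knots in $S^3$ up to isotopy. The unknotting number $u(K)$ of a knot $K$ is the minimum number of crossing changes, interspersed with isotopy, required to transform a diagram of $K$ into a diagram of the unknot. $K_1\#K_2$ denotes the connected sum, and $\sigma$ denotes the (Murasugi/Trotter) knot signature, which is additive under connected sum and changes sign under mirror image. Knot names are from the standard Rolfsen table: $5_1$ is the $(2,5)$ torus knot (up to mirror image); $8_2$ is, up to mirror image, the 2-bridge knot with fraction $17/3=5+\cfrac{1}{1+\cfrac12}$ (Conway notation $5\,1\,2$). Each of $5_1$ and $8_2$ has signature $\pm4$, the sign depending on the choice of mirror image, so the condition $\sigma(K_5)=0$ says that the mirror images are chosen so that the two signatures have opposite signs. *)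

(* Defs.v *)
From mathcomp Require Import all_boot all_order all_algebra.
From Stdlib Require Import Relation_Operators.

Set Implicit Arguments.
Unset Strict Implicit.
Unset Printing Implicit Defensive.

Import GRing.Theory Num.Theory.

(* Oriented knot diagrams on S^2 are encoded by signed Gauss codes:
   walk once along the knot from a base point that is not a crossing and record
   at each passage the crossing met, whether it is passed on the over-strand,
   and the sign of the crossing.  A signed Gauss code of genus 0 determines the
   diagram up to orientation-preserving homeomorphism of S^2.  The empty code is
   the diagram without crossings. *)

Definition passage : Type := (nat * bool * bool)%type.
Definition crossing_of (l : passage) : nat := l.1.1.
Definition over (l : passage) : bool := l.1.2.
Definition positive (l : passage) : bool := l.2.

Definition other_passage (l : passage) : passage :=
  (crossing_of l, ~~ over l, positive l).

Definition gauss_code : Type := seq passage.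

Definition well_formed (w : gauss_code) : bool :=
  uniq [seq l.1 | l <- w] && all (fun l => other_passage l \in w) w.

(* Faces of the diagram.  The pair (i, d) with i < size w is the side of an edge
   that lies on the left of a traveller who arrives at the i-th passage along the
   knot's orientation if d = true, against it if d = false.  Turning left at the
   crossing leads to the next side of the same face; a face is represented by the
   first of its sides in the list of all sides. *)
Section Faces.

Variable w : gauss_code.

Definition letter (i : nat) : passage := nth (0, false, false) w i.

Definition twin (i : nat) : nat := index (other_passage (letter i)) w.

Definition next_position (i : nat) : nat := i.+1 %% size w.
Definition prev_position (i : nat) : nat := (i + size w).-1 %% size w.

(* With both strands of a crossing pointing upwards, the passage of the strand
   that runs from the bottom left to the top right. *)
Definition rightward (i : nat) : bool := over (letter i) == positive (letter i).

Definition turn_left (x : nat * bool) : nat * bool :=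
  if x.2 == rightward x.1 then (next_position (twin x.1), true)
  else (prev_position (twin x.1), false).

Definition sides : seq (nat * bool) :=
  [seq (i, d) | i <- iota 0 (size w), d <- [:: true; false]].

Definition face_of (x : nat * bool) : nat * bool :=
  let face := traject turn_left x (size sides) in
  head x [seq y <- sides | y \in face].

Definition faces : seq (nat * bool) := [seq x <- sides | face_of x == x].

End Faces.

(* Euler's formula: n crossings, 2n edges, n + 2 faces. *)
Definition planar (w : gauss_code) : bool :=
  (w == [::]) || (size (faces w) == (size w)./2 + 2).

Definition knot_diagram (w : gauss_code) : bool := well_formed w && planar w.

Definition unknot : gauss_code := [::].

Definition rename (f : nat -> nat) (w : gauss_code) : gauss_code :=
  [seq (f (crossing_of l), over l, positive l) | l <- w].

Definition in_order (s : bool) (x y : passage) : gauss_code :=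
  if s then [:: x; y] else [:: y; x].

(* In R2, opposite signs say that the two edges joining the crossings bound a
   face.  In R3, a is the crossing of the top strand with the middle one, b of
   the top strand with the bottom one, c of the middle strand with the bottom
   one; sT, sM, sB say in which order the two crossings on each strand are met.
   The two equations between orders and signs say that the three edges bound a
   face: if t, m, b are the directions of the strands, the signs are those of
   t x m, t x b, m x b, and the oriented edges of a triangle satisfy
   (+-) m = (+-) t + (+-) b up to positive factors. *)
Inductive move : gauss_code -> gauss_code -> Prop :=
| move_base_point (i : nat) w : move w (rot i w)
| move_rename f w : injective f -> move w (rename f w)
| move_R1 (a : nat) (o e : bool) w :
    move [:: (a, o, e), (a, ~~ o, e) & w] w
| move_R2 (a b : nat) (e s : bool) w1 w2 :
    move ([:: (a, true, e); (b, true, ~~ e)] ++ w1 ++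
          in_order s (a, false, e) (b, false, ~~ e) ++ w2)
         (w1 ++ w2)
| move_R3_top_middle_bottom (a b c : nat) (ea eb ec sT sM sB : bool) w1 w2 w3 :
    (sM == ea) = (sB == eb) -> (sM == ec) = (sT == eb) ->
    move (in_order sT (a, true, ea) (b, true, eb) ++ w1 ++
          in_order sM (a, false, ea) (c, true, ec) ++ w2 ++
          in_order sB (b, false, eb) (c, false, ec) ++ w3)
         (in_order (~~ sT) (a, true, ea) (b, true, eb) ++ w1 ++
          in_order (~~ sM) (a, false, ea) (c, true, ec) ++ w2 ++
          in_order (~~ sB) (b, false, eb) (c, false, ec) ++ w3)
| move_R3_top_bottom_middle (a b c : nat) (ea eb ec sT sM sB : bool) w1 w2 w3 :
    (sM == ea) = (sB == eb) -> (sM == ec) = (sT == eb) ->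
    move (in_order sT (a, true, ea) (b, true, eb) ++ w1 ++
          in_order sB (b, false, eb) (c, false, ec) ++ w2 ++
          in_order sM (a, false, ea) (c, true, ec) ++ w3)
         (in_order (~~ sT) (a, true, ea) (b, true, eb) ++ w1 ++
          in_order (~~ sB) (b, false, eb) (c, false, ec) ++ w2 ++
          in_order (~~ sM) (a, false, ea) (c, true, ec) ++ w3).

(* Requiring both ends to be knot diagrams keeps all moves on the sphere: an R2
   move read from right to left is only possible between two edges of a face. *)
Definition diagram_move (w w' : gauss_code) : Prop :=
  [/\ knot_diagram w, knot_diagram w' & move w w'].

Definition isotopic : gauss_code -> gauss_code -> Prop :=
  clos_refl_sym_trans gauss_code diagram_move.

Definition change_crossing (a : nat) (w : gauss_code) : gauss_code :=
  [seq if crossing_of l == a then (a, ~~ over l, ~~ positive l) else l | l <- w].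

Definition crossing_change (w w' : gauss_code) : Prop :=
  knot_diagram w /\
  exists2 a, a \in [seq crossing_of l | l <- w] & w' = change_crossing a w.

Inductive unknots_with : nat -> gauss_code -> Prop :=
| unknots_with0 w : isotopic w unknot -> unknots_with 0 w
| unknots_withS k w w1 w2 :
    isotopic w w1 -> crossing_change w1 w2 -> unknots_with k w2 ->
    unknots_with k.+1 w.

Definition unknotting_number (w : gauss_code) (k : nat) : Prop :=
  unknots_with k w /\ forall m, unknots_with m w -> k <= m.

Definition mirror (w : gauss_code) : gauss_code :=
  [seq (crossing_of l, ~~ over l, ~~ positive l) | l <- w].

(* The connected sum at the base points of the two codes; rotating the codes
   gives the other choices of arcs. *)
Definition connected_sum (w1 w2 : gauss_code) : gauss_code :=
  rename (fun a => a.*2) w1 ++ rename (fun a => a.*2.+1) w2.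

Section Seifert.

Local Open Scope ring_scope.

Variable w : gauss_code.

(* Let F be the surface of Seifert's algorithm, its disks pushed to the upper
   side of S^2.  H_1(F) is generated by the cycles of F that run
   counterclockwise around the faces of the diagram, and seifert_matrix is the
   Gram matrix on these generators of the Seifert pairing
   (x, y) |-> lk(x, y^+), so its symmetrization has the signature of the form on
   H_1(F).  It is a sum over the crossings, one rightward passage i for each.
   With both strands pointing upwards, let T, B, L be the faces at the top, at
   the bottom and on the left of the crossing, of sign e.  The cycles of T and B
   run through the half-twisted band in opposite directions, which gives
     (T,T), (B,B) |-> - e/2,  (T,B) |-> (e + 1)/2,  (B,T) |-> (e - 1)/2;
   in the disk on the left of the band they meet the cycle of L, which gives
     (T,L) |-> -1,  (B,L) |-> 1. *)
Definition seifert_pairing (x y : nat * bool) : rat :=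
  \sum_(0 <= i < size w | rightward w i)
    let e : rat := if positive (letter w i) then 1 else -1 in
    let T := face_of w (next_position w i, true) in
    let B := face_of w (twin w i, true) in
    let L := face_of w (i, true) in
    (- (e / 2) * ((T == x) && (T == y))%:R
     - e / 2 * ((B == x) && (B == y))%:R
     + (e + 1) / 2 * ((T == x) && (B == y))%:R
     + (e - 1) / 2 * ((B == x) && (T == y))%:R
     - ((T == x) && (L == y))%:R
     + ((B == x) && (L == y))%:R).

Definition seifert_matrix : 'M[rat]_(size (faces w)) :=
  \matrix_(i, j) seifert_pairing (nth (0%N, true) (faces w) i)
                                 (nth (0%N, true) (faces w) j).

End Seifert.

Definition has_signature (n : nat) (M : 'M[rat]_n) (s : int) : Prop :=
  exists (P : 'M[rat]_n) (d : 'rV[rat]_n),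
    [/\ P \in unitmx, (P *m M *m P^T = diag_mx d)%R
      & s = (\sum_(i < n) sgz (d ord0 i))%R].

Definition knot_signature (w : gauss_code) (s : int) : Prop :=
  has_signature (seifert_matrix w + (seifert_matrix w)^T)%R s.

(* The closure of the 2-braid with five positive crossings 1, ..., 5. *)
Definition knot_5_1 : gauss_code :=
  [:: (1, true, true); (2, false, true); (3, true, true); (4, false, true);
      (5, true, true); (1, false, true); (2, true, true); (3, false, true);
      (4, true, true); (5, false, true)].

(* The alternating diagram of Conway notation 5 1 2: the rows of 5, 1 and 2
   half-twists are formed by the crossings 1, ..., 5, by 6, and by 7, 8. *)
Definition knot_8_2 : gauss_code :=
  [:: (1, false, false); (2, true, false); (3, false, false); (4, true, false);
      (5, false, false); (7, true, true); (8, false, true); (1, true, false);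
      (2, false, false); (3, true, false); (4, false, false); (5, true, false);
      (6, false, false); (8, true, true); (7, false, true); (6, true, false)].

(* Main.v *)
From mathcomp Require Import all_boot all_order all_algebra.
From mathcomp Require Import ring zify ssrZ.
From Stdlib Require Import Relation_Operators Classical.
Require Import Defs.

(* Lower bounds.  Label the edges of a diagram so that at each crossing the two
   over-edges and the two under-edges have the same sum.  If the label does not
   jump along the over-strands, this is a Fox coloring; integer labels whose
   over-jumps are divisible by p represent p-torsion of the homology of the
   double branched cover, and W = sum over the crossings of sign * over-jump *
   under-jump gives its linking form W / p modulo p.  This is well defined and
   invariant because on a planar diagram every such labelling is a sum of values
   of a function of the two faces at the edge.  As in Lickorish's criterion, if one
   crossing change gives the unknot, the labels that violate the coloring
   condition only at that crossing show that the linking form takes a value of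
   the form +-square; for p = 5 and p = 17, where -1 is a square, the nonresidue
   values of 5_1 and 8_2 exclude this.

   Upper bounds.  An explicit sequence of Reidemeister moves and crossing changes
   is checked by computation.  Sliding the summand 5_1 along 8_2, and the symmetry
   of 5_1, reach all choices of base points.

   Signature.  If the two signatures have equal signs, Gaussian elimination finds
   coordinates, more than half of the faces, on which the symmetrized Seifert form
   is definite, so the signature is not 0 by Sylvester's law of inertia. *)

Set Implicit Arguments.
Unset Strict Implicit.
Unset Printing Implicit Defensive.

Import Order.TTheory GRing.Theory Num.Theory.

Local Open Scope ring_scope.

(** * Labelled diagrams *)

(** The homology group is never constructed: a statement about it is read as one about colorings
    with values in all commutative rings, among them the integers and their quotients. The hard move
    is the removal of a bigon. An integer labelling with over-jumps divisible by [p] need not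
    restrict to the smaller diagram; its reduction modulo [p] does, and then has to be lifted again.
    Lifting edge labels one by one breaks the crossing equations, while lifting face values
    preserves them, so the argument rests on the existence of face values, that is, on planarity.
    This needs no topology: the maps from faces to edges and from edges to crossing equations
    compose to zero, and Euler's formula makes the dimensions match. The same count bounds the
    number of faces from above, which makes planarity cheap to certify. The primes 5 and 17 are the
    determinants of the two knots. The signature hypothesis enters by forcing the two mirror choices
    to agree; the two pairs of mirror images that remain are treated separately. *)

Definition crossings (w : gauss_code) : seq nat := [seq crossing_of l | l <- w].

Lemma crossings_cat w1 w2 : crossings (w1 ++ w2) = crossings w1 ++ crossings w2.
Proof. exact: map_cat. Qed.

Lemma mem_crossings l w : l \in w -> crossing_of l \in crossings w.
Proof. exact: map_f. Qed.

Section Colorings.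

Variables (A : comNzRingType) (S : A -> Prop).
Hypotheses (S0 : S 0) (SB : forall x y, S x -> S y -> S (x - y)).
Implicit Types (c : nat * bool -> A * A) (x y z : A) (w : gauss_code).

(* [c (a, o)] is the pair of the labels before and after the over-passage (if [o]) or
   the under-passage of the crossing [a]; [x] labels the edge of the base point. *)
Fixpoint chain c x w y : Prop :=
  if w is l :: w' then (c l.1).1 = x /\ chain c (c l.1).2 w' y else x = y.

Lemma chain_cat c x w1 w2 y :
  chain c x (w1 ++ w2) y <-> exists2 z, chain c x w1 z & chain c z w2 y.
Proof.
elim: w1 x => [|l w1 IH] x /=; first by split=> [h|[z <-]] //; exists x.
split=> [[<- /IH[z h1 h2]]|[z [<- h1] h2]]; first by exists z.
by split=> //; apply/IH; exists z.
Qed.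

(* [S] restricts the jump of the label on the over-strand; [S z := z = 0] gives Fox
   colorings. *)
Definition strands_ok (o u : A * A) : Prop :=
  o.1 + o.2 = u.1 + u.2 /\ S (o.2 - o.1).

Definition coloring c x w : Prop :=
  chain c x w x /\
  {in crossings w, forall a, strands_ok (c (a, true)) (c (a, false))}.

Definition strands_weight (e : bool) (o u : A * A) : A :=
  (if e then 1 else -1) * ((o.2 - o.1) * (u.2 - u.1)).

Definition weight c w : A :=
  \sum_(l <- w | over l)
    strands_weight (positive l) (c (crossing_of l, true)) (c (crossing_of l, false)).

(** Expresses that [m] kills the class of the coloring modulo constant colorings. *)
Definition labels_agree (m : nat) c x w : Prop :=
  {in w, forall l, (c l.1).1 *+ m = x *+ m /\ (c l.1).2 *+ m = x *+ m}.

Lemma weight_cat c w1 w2 : weight c (w1 ++ w2) = weight c w1 + weight c w2.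
Proof. exact: big_cat. Qed.

Lemma weight_cons c l w :
  weight c (l :: w) =
  (if over l then strands_weight (positive l) (c (crossing_of l, true))
                    (c (crossing_of l, false)) else 0) + weight c w.
Proof. by rewrite /weight big_cons; case: ifP; rewrite ?add0r. Qed.

Lemma weight_nil c : weight c [::] = 0.
Proof. exact: big_nil. Qed.

Definition same_labels c c' w : Prop :=
  {in crossings w, forall a b, c' (a, b) = c (a, b)}.

Lemma same_labels_at c c' w l : same_labels c c' w -> l \in w -> c' l.1 = c l.1.
Proof. by move=> h /mem_crossings/h; case: l => [[a o] e]; apply. Qed.

Lemma chain_same c c' x w y : same_labels c c' w -> chain c x w y -> chain c' x w y.
Proof.
elim: w x => //= l w IH x e [<- h]; rewrite (same_labels_at e) ?mem_head //.
by split=> //; apply: IH h => a aw; apply: e; rewrite inE aw orbT.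
Qed.

Lemma ok_same c c' w : same_labels c c' w ->
  {in crossings w, forall a, strands_ok (c (a, true)) (c (a, false))} ->
  {in crossings w, forall a, strands_ok (c' (a, true)) (c' (a, false))}.
Proof. by move=> e h a aw; rewrite !e //; apply: h. Qed.

Lemma weight_same c c' w : same_labels c c' w -> weight c' w = weight c w.
Proof.
move=> e; rewrite /weight big_seq_cond [RHS]big_seq_cond.
by apply: eq_bigr => l /andP[lw _]; rewrite !e ?mem_crossings.
Qed.

Definition upd c (a : nat) (o u : A * A) : nat * bool -> A * A :=
  fun k => if k.1 == a then (if k.2 then o else u) else c k.

Lemma upd_same c a o u w : a \notin crossings w -> same_labels c (upd c a o u) w.
Proof.
move=> aw b bw d; rewrite /upd /=; case: eqP => // e.
by rewrite -e bw in aw.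
Qed.

Lemma upd_self c a o u d : upd c a o u (a, d) = if d then o else u.
Proof. by rewrite /upd /= eqxx. Qed.

Lemma upd_other c a o u b d : b != a -> upd c a o u (b, d) = c (b, d).
Proof. by rewrite /upd /= => /negPf->. Qed.

Lemma same_labels_trans c1 c2 c3 w :
  same_labels c1 c2 w -> same_labels c2 c3 w -> same_labels c1 c3 w.
Proof. by move=> h1 h2 a aw b; rewrite h2 // h1. Qed.

(** * Labelled diagrams under Reidemeister moves *)

Lemma coloring_R1_add (a : nat) (o e : bool) w c x :
  a \notin crossings w -> coloring c x w ->
  let w' := [:: (a, o, e), (a, ~~ o, e) & w] in
  exists2 c', coloring c' x w' /\ weight c' w' = weight c w & same_labels c c' w.
Proof.
move=> aw [ch ok] w'; exists (upd c a (x, x) (x, x)); last exact: upd_same.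
have s := upd_same c (x, x) (x, x) aw.
split; [split|].
- rewrite /= !upd_self; split; first by case: o @w'.
  split; first by case: o @w'.
  by have := chain_same s ch; case: o @w'.
- move=> b; rewrite !inE /= orbA orbb => /orP[/eqP->|bw].
    by rewrite !upd_self; split=> //=; rewrite subrr.
  exact: (ok_same s ok).
- rewrite /w' !weight_cons (weight_same s) /crossing_of /= !upd_self.
  by rewrite /strands_weight /= subrr mul0r mulr0 !if_same !add0r.
Qed.

(** The crossing equation cancels the label of the loop, so the label after the kink is again [x].
    Over- and under-jump of the kink are opposite, whence the change of the weight by plus or minus
    a square [d ^+ 2]; if [S] consists of the multiples of [p], this is a multiple of the square of
    [p]. *)
Lemma coloring_R1_del (a : nat) (o e : bool) w c x :
  let w' := [:: (a, o, e), (a, ~~ o, e) & w] in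
  coloring c x w' ->
  coloring c x w /\
  exists2 d, S d & [/\ (c (a, o)).2 = x - d \/ (c (a, o)).2 = x + d &
    (weight c w' = weight c w + d ^+ 2) \/ (weight c w' = weight c w - d ^+ 2)].
Proof.
move=> w' [/=[e1 [e2 ch]] ok].
have [E /= Sd] := ok a (mem_head _ _).
have ex : (c (a, ~~ o)).2 = x.
  by case: o @w' e1 e2 ch ok => w' e1 e2 ch ok; move: E; rewrite e1 e2 => /= E;
     [apply: (addrI (c (a, true)).2); rewrite -E addrC
     |apply: (addIr (c (a, false)).2); rewrite -E addrC].
rewrite ex in ch; split.
  by split=> // b bw; apply: ok; rewrite /= !inE bw !orbT.
exists ((c (a, true)).2 - (c (a, true)).1) => //.
split.
  case: o @w' e1 e2 ex ch ok => w' e1 e2 ex ch ok.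
    by right; rewrite -e1; ring.
  by left; rewrite /= in ex e2; rewrite -ex e2; ring.
rewrite /w' !weight_cons /over /crossing_of /positive /strands_weight /=.
case: o @w' e1 e2 ex ch ok => w' /= e1 e2 ex ch ok; rewrite ex -?e1 ?e2;
  case: e @w' ok => w' ok; [right|left|right|left]; rewrite ?e1 ?e2 ?ex; ring.
Qed.

Lemma in_order_crossings s (l1 l2 : passage) a :
  (a \in crossings (in_order s l1 l2)) = (a == crossing_of l1) || (a == crossing_of l2).
Proof. by case: s; rewrite /= !inE // orbC. Qed.

Lemma weight_in_order c s (l1 l2 : passage) :
  weight c (in_order s l1 l2) = weight c [:: l1] + weight c [:: l2].
Proof. by case: s; rewrite /in_order -cat1s weight_cat // addrC. Qed.

Lemma weight1 c (a : nat) (o e : bool) :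
  weight c [:: (a, o, e)] =
  if o then strands_weight e (c (a, true)) (c (a, false)) else 0.
Proof. by rewrite weight_cons weight_nil addr0. Qed.

Lemma coloring_R2_add (a b : nat) (e s : bool) w1 w2 c x :
  a != b -> a \notin crossings (w1 ++ w2) -> b \notin crossings (w1 ++ w2) ->
  coloring c x (w1 ++ w2) ->
  let w' := [:: (a, true, e); (b, true, ~~ e)] ++ w1 ++
            in_order s (a, false, e) (b, false, ~~ e) ++ w2 in
  exists2 c', coloring c' x w' /\ weight c' w' = weight c (w1 ++ w2)
            & same_labels c c' (w1 ++ w2).
Proof.
move=> ab aw bw [/chain_cat[y ch1 ch2] ok] w'.
have ba : b != a by rewrite eq_sym.
(* The under-edge inside the bigon gets the reflection of [y] in [x]; the over-strand stays
   constant, so neither new crossing has weight. *)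
pose z := x + x - y.
pose c1 := upd c a (x, x) (if s then (y, z) else (z, y)).
pose c' := upd c1 b (x, x) (if s then (z, y) else (y, z)).
have sm : same_labels c c' (w1 ++ w2).
  by apply: (same_labels_trans (c2 := c1)); apply: upd_same.
have Ea d : c' (a, d) = if d then (x, x) else if s then (y, z) else (z, y).
  by rewrite /c' upd_other // /c1 upd_self.
have Eb d : c' (b, d) = if d then (x, x) else if s then (z, y) else (y, z).
  by rewrite /c' upd_self.
have sm1 : same_labels c c' w1 by move=> k kw; apply: sm; rewrite crossings_cat mem_cat kw.
have sm2 : same_labels c c' w2 by move=> k kw; apply: sm; rewrite crossings_cat mem_cat kw orbT.
exists c' => //; split; [split|].
- rewrite /= Ea Eb /=; do 2!split=> //.
  apply/chain_cat; exists y; first exact: chain_same ch1.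
  apply/chain_cat; exists y; last exact: chain_same ch2.
  by rewrite /in_order /=; case: s @c1 @c' Ea Eb sm sm1 sm2 @w' => ? ? Ea Eb ? ? ? ? /=; rewrite
    Ea Eb.
- move=> k; rewrite !crossings_cat !mem_cat in_order_crossings /= !inE /crossing_of /=.
  have oka : strands_ok (c' (a, true)) (c' (a, false)).
    rewrite !Ea /strands_ok /= subrr; split=> //.
    by rewrite /z; case: (s) => /=; ring.
  have okb : strands_ok (c' (b, true)) (c' (b, false)).
    rewrite !Eb /strands_ok /= subrr; split=> //.
    by rewrite /z; case: (s) => /=; ring.
  have okw : k \in crossings (w1 ++ w2) -> strands_ok (c' (k, true)) (c' (k, false)).
    by move=> kw; apply: (ok_same sm ok).
  rewrite crossings_cat mem_cat in okw.
  do ![case/orP] => [/eqP->|/eqP->|kw|/eqP->|/eqP->|kw] //.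
    by apply: okw; rewrite kw.
  by apply: okw; rewrite kw orbT.
- rewrite /w' !weight_cat weight_in_order !weight1 (weight_same sm1) (weight_same sm2).
  rewrite !weight_cons weight_nil /over /crossing_of /strands_weight /= !Ea !Eb /=.
  by rewrite subrr; ring.
Qed.

(** Restricted to Fox colorings: over-jumps [d1], [d2] at the two crossings shift the over-strand by
    [d1 + d2] and the under-strand by plus or minus the same, so the labels would not close up after
    the deletion. *)
Lemma coloring_R2_del (a b : nat) (e s : bool) w1 w2 c x :
  (forall z, S z -> z = 0) ->
  let w' := [:: (a, true, e); (b, true, ~~ e)] ++ w1 ++
            in_order s (a, false, e) (b, false, ~~ e) ++ w2 in
  coloring c x w' -> coloring c x (w1 ++ w2).
Proof.
move=> Sz w' [/=[e1 [e2 /chain_cat[y ch1 /chain_cat[y' ch ch2]]]] ok].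
have [Ea /Sz /eqP] : strands_ok (c (a, true)) (c (a, false)).
  by apply: ok; rewrite /= mem_head.
rewrite subr_eq0 => /eqP Ta.
have [Eb /Sz /eqP] : strands_ok (c (b, true)) (c (b, false)).
  by apply: ok; rewrite /= !inE eqxx orbT.
rewrite subr_eq0 => /eqP Tb.
have ex : (c (b, true)).2 = x by rewrite Tb e2 Ta.
have ey : y' = y.
  rewrite Ta e1 in Ea; rewrite Tb e2 Ta e1 in Eb.
  case: s @w' ok ch => w' ok /= [f1 [f2 f3]].
    rewrite -f3 -f1; apply: (addrI (c (b, false)).1).
    by rewrite -Eb Ea f2 addrC.
  rewrite -f3 -f1; apply: (addrI (c (a, false)).1).
  by rewrite -Ea Eb f2 addrC.
rewrite ex in ch1; rewrite ey in ch2.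
split; first by apply/chain_cat; exists y.
move=> k; rewrite crossings_cat mem_cat => kw; apply: ok.
rewrite !inE !crossings_cat !mem_cat.
by case/orP: kw => ->; rewrite ?orbT.
Qed.

Definition first_or_second (s : bool) (x0 x1 x2 : A) : A * A :=
  if s then (x0, x1) else (x1, x2).

Lemma R3_labels (ea eb ec sT sM sB : bool) (t0 t1 t2 m0 m1 m2 b0 b1 b2 : A) :
  (sM == ea) = (sB == eb) -> (sM == ec) = (sT == eb) ->
  let seg := first_or_second in
  strands_ok (seg sT t0 t1 t2) (seg sM m0 m1 m2) ->
  strands_ok (seg (~~ sT) t0 t1 t2) (seg sB b0 b1 b2) ->
  strands_ok (seg (~~ sM) m0 m1 m2) (seg (~~ sB) b0 b1 b2) ->
  exists t m b,
    [/\ strands_ok (seg (~~ sT) t0 t t2) (seg (~~ sM) m0 m m2),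
        strands_ok (seg sT t0 t t2) (seg (~~ sB) b0 b b2),
        strands_ok (seg sM m0 m m2) (seg sB b0 b b2) &
        strands_weight ea (seg sT t0 t1 t2) (seg sM m0 m1 m2) +
        strands_weight eb (seg (~~ sT) t0 t1 t2) (seg sB b0 b1 b2) +
        strands_weight ec (seg (~~ sM) m0 m1 m2) (seg (~~ sB) b0 b1 b2) =
        strands_weight ea (seg (~~ sT) t0 t t2) (seg (~~ sM) m0 m m2) +
        strands_weight eb (seg sT t0 t t2) (seg (~~ sB) b0 b b2) +
        strands_weight ec (seg sM m0 m m2) (seg sB b0 b b2)].
Proof.
move=> h1 h2 seg [Ea Sa] [Eb Sb] [Ec Sc].
(* The crossing equations determine [m] and [b] from [t] and leave [t] free, since the value on the
   central triangle is free. This [t] negates the over-jump at the crossing of the top and the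
   middle strand, which keeps the over-jumps in [S] and the total weight unchanged. *)
pose t := if sT then t1 + t2 - t0 else t1 + t0 - t2.
pose m := (if sT then t + t2 else t0 + t) - (if sM then m2 else m0).
pose b := (if sT then t0 + t else t + t2) - (if sB then b2 else b0).
exists t, m, b.
have SN z : S z -> S (- z) by move=> Sz; rewrite -sub0r; apply: SB.
have SD u v : S u -> S v -> S (u + v).
  by move=> Su Sv; rewrite -[v]opprK; apply: SB => //; apply: SN.
(* The over-jumps after the move take one of these six forms in the jumps [p], [q] of the top strand
   and the over-jump [g] at the third crossing. *)
have SL p q g z : S p -> S q -> S g ->
    [\/ z = - p, z = - q | z = q + p + p] \/
    [\/ z = p + q + q, z = p + q + (p + q) - g | z = - (p + q + (p + q)) - g] -> S z.
  move=> Sp Sq Sg; have S2 := SD _ _ (SD _ _ Sp Sq) (SD _ _ Sp Sq).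
  case=> [[->|->|->]|[->|->|->]].
  - exact: SN.
  - exact: SN.
  - exact: (SD _ _ (SD _ _ Sq Sp) Sp).
  - exact: (SD _ _ (SD _ _ Sp Sq) Sq).
  - exact: SB.
  - by apply: SB => //; apply: SN.
have solveL (u v r : A) : r = u + v -> u = r - v by move->; ring.
have solveR (u v r : A) : r = u + v -> v = r - u by move->; ring.
have SX z : [\/ z = - (t1 - t0), z = - (t2 - t1) | z = t2 - t1 + (t1 - t0) + (t1 - t0)] \/
    [\/ z = t1 - t0 + (t2 - t1) + (t2 - t1),
        z = t1 - t0 + (t2 - t1) + (t1 - t0 + (t2 - t1)) - (if sM then m2 - m1 else m1 - m0)
      | z = - (t1 - t0 + (t2 - t1) + (t1 - t0 + (t2 - t1))) - (if sM then m2 - m1 else m1 - m0)]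
    -> S z.
  apply: SL.
  - by move: Sa Sb; rewrite /seg; case: (sT).
  - by move: Sa Sb; rewrite /seg; case: (sT).
  - by move: Sc; rewrite /seg; case: (sM).
clear SL SN SD Sa Sb Sc.
rewrite {}/b {}/m {}/t.
rewrite {}/seg /strands_ok /strands_weight /first_or_second in Ea Eb Ec SX *.
case: sT h2 Ea Eb => h2 /= Ea Eb;
(case: sM h1 h2 Ea Ec SX => h1 h2 /= Ea Ec SX;
 [have {}Ea := solveL _ _ _ Ea; subst m0 | have {}Ea := solveR _ _ _ Ea; subst m2]);
(case: sB h1 Eb Ec => h1 /= Eb Ec;
 [have {}Eb := solveL _ _ _ Eb; have {}Ec := solveR _ _ _ Ec; subst b0 b2
 |have {}Eb := solveR _ _ _ Eb; have {}Ec := solveL _ _ _ Ec; subst b0 b2]);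
(split; [split; [ring|apply: SX]|split; [ring|apply: SX]|split; [ring|apply: SX]|]).
all: try by first [left; constructor 1; ring | left; constructor 2; ring | left; constructor 3; ring
  | right; constructor 1; ring | right; constructor 2; ring | right; constructor 3; ring].
(* What is left is the weight identity, where the relations between orders and signs come in. *)
all: case: ea h1 => h1; case: eb h1 h2 => h1 h2; case: ec h2 => h2; try discriminate; ring.
Qed.

Lemma chain_in_order c x s (l1 l2 : passage) z :
  chain c x (in_order s l1 l2) z <->
  exists2 y, c l1.1 = first_or_second s x y z & c l2.1 = first_or_second (~~ s) x y z.
Proof.
rewrite /first_or_second; case: s => /=; split.
- move=> [<- [h <-]]; exists (c l1.1).2; first by case: (c l1.1).
  by rewrite -h; case: (c l2.1).
- by move=> [y -> ->].
- move=> [<- [h <-]]; exists (c l2.1).2; last by case: (c l2.1).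
  by rewrite -h; case: (c l1.1).
- by move=> [y -> ->].
Qed.

(** [q] tells whether the middle strand is met before the bottom one, so that one word serves both
    forms of R3. *)
Definition R3_word (q : bool) (a b k : nat) (ea eb ec sT sM sB : bool) w1 w2 w3 : gauss_code :=
  let M := in_order sM (a, false, ea) (k, true, ec) in
  let B := in_order sB (b, false, eb) (k, false, ec) in
  in_order sT (a, true, ea) (b, true, eb) ++ w1 ++ (if q then M else B) ++
  w2 ++ (if q then B else M) ++ w3.

Lemma R3_word_chain q a b k ea eb ec sT sM sB w1 w2 w3 c x :
  chain c x (R3_word q a b k ea eb ec sT sM sB w1 w2 w3) x <->
  exists t m0 m2 b0 b2,
  [/\ chain c x (in_order sT (a, true, ea) (b, true, eb)) t,
      chain c m0 (in_order sM (a, false, ea) (k, true, ec)) m2,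
      chain c b0 (in_order sB (b, false, eb) (k, false, ec)) b2 &
      [/\ chain c t w1 (if q then m0 else b0),
          chain c (if q then m2 else b2) w2 (if q then b0 else m0) &
          chain c (if q then b2 else m2) w3 x]].
Proof.
rewrite /R3_word; split.
  move=> /chain_cat[t h1 /chain_cat[p0 h2 /chain_cat[p2 h3 /chain_cat[q0 h4 /chain_cat[q2 h5
    h6]]]]].
  by case: q h3 h5 => h3 h5; [exists t, p0, p2, q0, q2 | exists t, q0, q2, p0, p2].
move=> [t [m0 [m2 [b0 [b2 [h1 h2 h3 [h4 h5 h6]]]]]]].
apply/chain_cat; exists t => //; apply/chain_cat; exists (if q then m0 else b0) => //.
apply/chain_cat; exists (if q then m2 else b2); first by case: (q).
apply/chain_cat; exists (if q then b0 else m0) => //.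
by apply/chain_cat; exists (if q then b2 else m2) => //; case: (q).
Qed.

Lemma mem_R3_crossings q a b k ea eb ec sT sM sB w1 w2 w3 d :
  (d \in crossings (R3_word q a b k ea eb ec sT sM sB w1 w2 w3)) =
  [|| d == a, d == b, d == k | d \in crossings (w1 ++ w2 ++ w3)].
Proof.
rewrite /R3_word !crossings_cat !mem_cat in_order_crossings.
by case: q; rewrite !in_order_crossings /crossing_of /=;
  case: (d == a); case: (d == b); case: (d == k); rewrite ?orbT ?orbF //=.
Qed.

Lemma weight_R3 q a b k ea eb ec sT sM sB w1 w2 w3 c :
  weight c (R3_word q a b k ea eb ec sT sM sB w1 w2 w3) =
  strands_weight ea (c (a, true)) (c (a, false)) +
  strands_weight eb (c (b, true)) (c (b, false)) +
  strands_weight ec (c (k, true)) (c (k, false)) + weight c (w1 ++ w2 ++ w3).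
Proof.
rewrite /R3_word !weight_cat weight_in_order !weight1.
by case: q; rewrite !weight_in_order !weight1 /=; ring.
Qed.

Lemma mem_R3 q a b k ea eb ec sT sM sB w1 w2 w3 (l : passage) :
  (l \in R3_word q a b k ea eb ec sT sM sB w1 w2 w3) =
  (l \in [:: (a, true, ea); (b, true, eb); (a, false, ea); (k, true, ec);
             (b, false, eb); (k, false, ec)]) || (l \in w1 ++ w2 ++ w3).
Proof.
have E s (p r : passage) : (l \in in_order s p r) = (l == p) || (l == r).
  by case: s; rewrite !inE // orbC.
rewrite /R3_word !mem_cat E !inE.
by case: q; rewrite !E; do 6?[case: (l == _)]; rewrite ?orbT ?orbF //=;
  case: (l \in w1); case: (l \in w2); case: (l \in w3).
Qed.

Lemma coloring_R3 q a b k ea eb ec sT sM sB w1 w2 w3 c x :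
  (sM == ea) = (sB == eb) -> (sM == ec) = (sT == eb) ->
  uniq [:: a; b; k] ->
  {in [:: a; b; k], forall d, d \notin crossings (w1 ++ w2 ++ w3)} ->
  let w := R3_word q a b k ea eb ec sT sM sB w1 w2 w3 in
  let w' := R3_word q a b k ea eb ec (~~ sT) (~~ sM) (~~ sB) w1 w2 w3 in
  coloring c x w ->
  exists2 c', coloring c' x w' /\ weight c' w' = weight c w &
    (forall z, S z -> z = 0) -> forall m, labels_agree m c' x w' -> labels_agree m c x w.
Proof.
move=> h1 h2 U fr w w' [/R3_word_chain[t2 [m0 [m2 [b0 [b2 [cT cM cB [ch1 ch2 ch3]]]]]]] ok].
have [t1 Ta Tb] := (chain_in_order _ _ _ _ _ _).1 cT.
have [m1 Ma Mk] := (chain_in_order _ _ _ _ _ _).1 cM.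
have [b1 Bb Bk] := (chain_in_order _ _ _ _ _ _).1 cB.
rewrite /= in Ta Tb Ma Mk Bb Bk.
have oka : strands_ok (c (a, true)) (c (a, false)) by apply: ok; rewrite mem_R3_crossings eqxx.
have okb : strands_ok (c (b, true)) (c (b, false)).
  by apply: ok; rewrite mem_R3_crossings eqxx orbT.
have okk : strands_ok (c (k, true)) (c (k, false)).
  by apply: ok; rewrite mem_R3_crossings eqxx !orbT.
rewrite Ta Ma in oka; rewrite Tb Bb in okb; rewrite Mk Bk in okk.
have [t [m [b' [oka' okb' okk' ew]]]] := R3_labels h1 h2 oka okb okk.
pose seg := first_or_second.
pose c1 := upd c a (seg (~~ sT) x t t2) (seg (~~ sM) m0 m m2).
pose c2 := upd c1 b (seg sT x t t2) (seg (~~ sB) b0 b' b2).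
pose c' := upd c2 k (seg sM m0 m m2) (seg sB b0 b' b2).
move: U; rewrite /= !inE negb_or andbT => /andP[/andP[ab ak] bk].
have ba : b != a by rewrite eq_sym.
have ka : k != a by rewrite eq_sym.
have kb : k != b by rewrite eq_sym.
have Ea d : c' (a, d) = if d then seg (~~ sT) x t t2 else seg (~~ sM) m0 m m2.
  by rewrite /c' upd_other // /c2 upd_other // /c1 upd_self.
have Eb d : c' (b, d) = if d then seg sT x t t2 else seg (~~ sB) b0 b' b2.
  by rewrite /c' upd_other // /c2 upd_self.
have Ek d : c' (k, d) = if d then seg sM m0 m m2 else seg sB b0 b' b2.
  by rewrite /c' upd_self.
have sm : same_labels c c' (w1 ++ w2 ++ w3).
  apply: (same_labels_trans (c2 := c2)); last by apply: upd_same; apply: fr; rewrite !inE eqxx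
    !orbT.
  apply: (same_labels_trans (c2 := c1)); apply: upd_same; apply: fr; rewrite !inE eqxx ?orbT //.
have sub v : {subset crossings v <= crossings (w1 ++ w2 ++ w3)} -> same_labels c c' v.
  by move=> sv d dv; apply: sm; apply: sv.
have sm1 : same_labels c c' w1 by apply: sub => d; rewrite !crossings_cat !mem_cat => ->.
have sm2 : same_labels c c' w2 by apply: sub => d; rewrite !crossings_cat !mem_cat => ->; rewrite
  orbT.
have sm3 : same_labels c c' w3 by apply: sub => d; rewrite !crossings_cat !mem_cat => ->; rewrite
  !orbT.
exists c'; [split; [split|]|].
- apply/R3_word_chain; exists t2, m0, m2, b0, b2; split.
  + by apply/chain_in_order; exists t; rewrite /= ?Ea ?Eb ?negbK.
  + by apply/chain_in_order; exists m; rewrite /= ?Ea ?Ek ?negbK.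
  + by apply/chain_in_order; exists b'; rewrite /= ?Eb ?Ek ?negbK.
  + by split; apply: chain_same; eassumption.
- move=> d; rewrite mem_R3_crossings => /or4P[/eqP->|/eqP->|/eqP->|dw].
  + by rewrite !Ea.
  + by rewrite !Eb.
  + by rewrite !Ek.
  + apply: (ok_same sm) dw => d' dw'; apply: ok.
    by rewrite mem_R3_crossings dw' !orbT.
- by rewrite !weight_R3 (weight_same sm) !Ea !Eb !Ek Ta Tb Ma Mk Bb Bk ew.
move=> Sz n lab.
pose L y := y *+ n = x *+ n.
have Lx : L x by [].
have key l : l \in w' -> L (c' l.1).1 /\ L (c' l.1).2 by move=> /lab.
have [Lt2 Lm0 Lm2 [Lb0 Lb2]] : [/\ L t2, L m0, L m2 & L b0 /\ L b2].
  have [] := key (a, true, ea); first by rewrite mem_R3 !inE eqxx ?orbT.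
  have [] := key (b, true, eb); first by rewrite mem_R3 !inE eqxx ?orbT.
  have [] := key (a, false, ea); first by rewrite mem_R3 !inE eqxx ?orbT.
  have [] := key (b, false, eb); first by rewrite mem_R3 !inE eqxx ?orbT.
  have [] := key (k, true, ec); first by rewrite mem_R3 !inE eqxx ?orbT.
  have [] := key (k, false, ec); first by rewrite mem_R3 !inE eqxx ?orbT.
  rewrite /= !Ea !Eb !Ek /seg /first_or_second.
  by case: (sT); case: (sM); case: (sB).
(* In a Fox coloring the inner labels of the top and the middle strand equal outer ones; the inner
   label of the bottom strand then follows from a crossing equation. *)
have Lt1 : L t1.
  case: oka => _ /Sz/eqP; rewrite subr_eq0 /first_or_second; case: (sT) => /= /eqP E.
    by rewrite E.
  by rewrite -E.
have Lm1 : L m1.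
  case: okk => _ /Sz/eqP; rewrite subr_eq0 /first_or_second; case: (sM) => /= /eqP E.
    by rewrite -E.
  by rewrite E.
have Lb1 : L b1.
  have Le u v r s : u + v = r + s -> L u -> L v -> L r -> L s.
    rewrite /L => E Lu Lv Lr; apply: (addrI (r *+ n)).
    by rewrite -mulrnDl -E mulrnDl Lu Lv Lr.
  case: okb; rewrite /first_or_second; case: (sT); case: (sB) => /= E _.
  - exact: (Le _ _ _ _ E).
  - by rewrite [RHS]addrC in E; exact: (Le _ _ _ _ E).
  - exact: (Le _ _ _ _ E).
  - by rewrite [RHS]addrC in E; exact: (Le _ _ _ _ E).
move=> l; rewrite mem_R3 => /orP[|lw].
  rewrite !inE => /or4P[/eqP->|/eqP->|/eqP->|/or3P[/eqP->|/eqP->|/eqP->]] /=;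
  rewrite ?Ta ?Tb ?Ma ?Mk ?Bb ?Bk /first_or_second;
  by case: (sT); case: (sM); case: (sB).
have [] := lab l; first by rewrite mem_R3 lw orbT.
by rewrite (same_labels_at sm lw).
Qed.

End Colorings.

(** * Faces and potentials *)

Lemma other_passageK : involutive other_passage.
Proof. by case=> [[a o] e]; rewrite /other_passage /crossing_of /over /positive /= negbK. Qed.

Section Positions.

Variable w : gauss_code.
Hypothesis wf : well_formed w.

Lemma uniq_code : uniq w.
Proof. by case/andP: wf => /map_uniq. Qed.

Lemma letter_in i : (i < size w)%N -> letter w i \in w.
Proof. exact: mem_nth. Qed.

Lemma twin_lt i : (i < size w)%N -> (twin w i < size w)%N.
Proof.
move=> /letter_in li; rewrite /twin index_mem.
by case/andP: wf => _ /allP/(_ _ li).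
Qed.

Lemma letter_twin i : (i < size w)%N -> letter w (twin w i) = other_passage (letter w i).
Proof. by move=> /twin_lt; rewrite /letter /twin index_mem => /nth_index->. Qed.

Definition tw (i : 'I_(size w)) : 'I_(size w) := Ordinal (twin_lt (ltn_ord i)).

Lemma twK : involutive tw.
Proof.
move=> i; apply: val_inj => /=.
rewrite {1}/twin letter_twin // other_passageK.
by rewrite /letter index_uniq // uniq_code.
Qed.

Definition isover (i : 'I_(size w)) : bool := over (letter w i).

Lemma isover_tw i : isover (tw i) = ~~ isover i.
Proof. by rewrite /isover /= letter_twin. Qed.

Lemma rightward_tw (i : 'I_(size w)) : rightward w (tw i) = ~~ rightward w i.
Proof.
rewrite /rightward /= letter_twin // /other_passage /over /positive /=.
by case: (letter w i).1.2; case: (letter w i).2.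
Qed.

Lemma double_card_isover : #|[pred i | isover i]|.*2 = size w.
Proof.
rewrite -addnn -[RHS](card_ord (size w)) -(cardC [pred i | isover i]); congr addn.
rewrite -(card_imset _ (inv_inj twK)); apply: eq_card => i.
rewrite !inE; apply/imsetP/idP => [[j]|h]; first by rewrite inE => h ->; rewrite isover_tw h.
by exists (tw i); rewrite ?twK // inE isover_tw.
Qed.

Lemma card_isover : #|[pred i | isover i]| = (size w)./2.
Proof. by rewrite -(doubleK #|_|) double_card_isover. Qed.

Lemma size_code : size w = (size w)./2.*2.
Proof. by apply: etrans (esym double_card_isover) _; rewrite card_isover. Qed.

Definition side : finType := ('I_(size w) * bool)%type.

Definition side_val (s : side) : nat * bool := (val s.1, s.2).

Lemma side_val_inj : injective side_val.
Proof. by move=> [i d] [j d'] [/val_inj-> ->]. Qed.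

(** [turn_left] as a permutation of a finite type; its orbits are the faces. *)
Definition tl (s : side) : side :=
  if s.2 == rightward w s.1 then (ordS (tw s.1), true) else (ord_pred (tw s.1), false).

Lemma turn_left_val s : turn_left w (side_val s) = side_val (tl s).
Proof. by rewrite /turn_left /tl /side_val /=; case: ifP. Qed.

Lemma tl_inj : injective tl.
Proof.
move=> [i d] [j d']; rewrite /tl /=.
case: ifPn => /eqP h; case: ifPn => /eqP h' // /(congr1 fst) /=.
  by move/(can_inj (@ordSK _))/(inv_inj twK) => e; subst j; rewrite h h'.
move/(can_inj (@ord_predK _))/(inv_inj twK) => e; subst j.
by congr pair; move/eqP: h; move/eqP: h'; case: d; case: d'; case: (rightward w i).
Qed.

Lemma mem_sides y : (y \in sides w) = (y.1 < size w)%N.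
Proof.
case: y => i d; apply/allpairsP/idP => /= [[[j d'] /= []]|lt].
  by rewrite mem_iota /= add0n => lt _ [-> _].
by exists (i, d); rewrite mem_iota /=; split=> //; case: d.
Qed.

Lemma side_valP y : y \in sides w -> exists s, y = side_val s.
Proof. by rewrite mem_sides => lt; exists (Ordinal lt, y.2); case: y lt. Qed.

Lemma side_val_in s : side_val s \in sides w.
Proof. by rewrite mem_sides /=. Qed.

Lemma uniq_sides : uniq (sides w).
Proof. by rewrite /sides allpairs_uniq ?iota_uniq // => -[i d] [j d']. Qed.

Lemma size_sides : size (sides w) = #|side|.
Proof. by rewrite /sides size_allpairs size_iota /= card_prod card_ord card_bool. Qed.

Lemma mem_face s s' :
  (side_val s' \in traject (turn_left w) (side_val s) (size (sides w))) = fconnect tl s s'.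
Proof.
have E k : iter k (turn_left w) (side_val s) = side_val (iter k tl s).
  by elim: k => //= k ->; rewrite turn_left_val.
apply/trajectP/idP => [[k _]|c].
  by rewrite E => /side_val_inj->; apply: fconnect_iter.
exists (findex tl s s'); last by rewrite E iter_findex.
rewrite size_sides; apply: leq_trans (findex_max c) _; exact: max_card.
Qed.

Lemma face_ofE s x :
  face_of w (side_val s) = head x [seq y <- sides w | y \in
    traject (turn_left w) (side_val s) (size (sides w))].
Proof.
rewrite /face_of; set F := [seq _ <- _ | _].
suff : side_val s \in F by case: F.
by rewrite mem_filter mem_face connect0 side_val_in.
Qed.

Lemma face_of_connect s s' : fconnect tl s s' -> face_of w (side_val s) = face_of w (side_val s').
Proof.
move=> c; rewrite (face_ofE s (0%N, true)) (face_ofE s' (0%N, true)).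
congr head; apply: eq_in_filter => y /side_valP[r ->]; rewrite !mem_face.
exact: (same_connect (fconnect_sym tl_inj) c).
Qed.

Lemma face_of_tl s : face_of w (side_val (tl s)) = face_of w (side_val s).
Proof. by apply/esym/face_of_connect; apply: fconnect1. Qed.

Lemma face_of_rep s : exists2 s', face_of w (side_val s) = side_val s' & fconnect tl s s'.
Proof.
have : face_of w (side_val s) \in
    [seq y <- sides w | y \in traject (turn_left w) (side_val s) (size (sides w))].
  rewrite /face_of; set F := [seq _ <- _ | _].
  suff : side_val s \in F by case: F => //= z F _; rewrite mem_head.
  by rewrite mem_filter mem_face connect0 side_val_in.
by rewrite mem_filter => /andP[h /side_valP[s' E]]; exists s' => //; rewrite E mem_face in h.
Qed.

Lemma face_of_id s : face_of w (face_of w (side_val s)) = face_of w (side_val s).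
Proof. by have [s' e c] := face_of_rep s; rewrite {1}e (face_of_connect c). Qed.

Lemma face_of_in s : face_of w (side_val s) \in faces w.
Proof.
rewrite mem_filter face_of_id eqxx /=.
by have [s' -> _] := face_of_rep s; rewrite side_val_in.
Qed.

Lemma facesP y : y \in faces w -> exists2 s, y = side_val s & face_of w y = y.
Proof. by rewrite mem_filter => /andP[/eqP e /side_valP[s es]]; exists s. Qed.

Lemma uniq_faces : uniq (faces w).
Proof. exact: filter_uniq uniq_sides. Qed.

(** * Face values and a dimension count *)

Section Potentials.

Variable F : fieldType.

(** Used for kernels whose elements are determined by one value, because the equations propagate it
    along the knot. *)
Lemma rank_le1 (n k : nat) (U : 'M[F]_(n, k)) (z : 'cV[F]_k) :
  (forall v : 'rV_k, (v <= U)%MS -> v *m z = 0 -> v = 0) -> (\rank U <= 1)%N.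
Proof.
move=> h; rewrite -(mxrank_mul_ker U z).
have -> : (U :&: kermx z)%MS = 0.
  apply/eqP; rewrite -submx0; apply/row_subP => i.
  have := submx_refl (U :&: kermx z)%MS => /row_subP/(_ i).
  rewrite sub_capmx => /andP[rU /sub_kermxP rz].
  by rewrite (h _ rU rz) sub0mx.
by rewrite mxrank0 addn0; apply: leq_trans (rank_leq_col _) _.
Qed.

Let nf := size (faces w).
Let ns := #|side|.

Definition face_mx : 'M[F]_(nf, ns) :=
  \matrix_(k, s) (face_of w (side_val (enum_val s)) == nth (0%N, true) (faces w) k)%:R.

(** The edge that arrives at position [i] has [(i, true)] on its left. Travelled backwards it
    arrives at [ord_pred i], so its right side is [(ord_pred i, false)]. *)
Definition edge_mx : 'M[F]_(ns, size w) :=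
  \matrix_(s, i) ((enum_val s == (i, true))%:R + (enum_val s == (ord_pred i, false))%:R).

Definition at_side (h : 'rV[F]_ns) (s : side) : F := h 0 (enum_rank s).

Lemma sum_delta (T : finType) (g : T -> F) (x : T) : \sum_y g y * (y == x)%:R = g x.
Proof.
rewrite (bigD1 x) //= eqxx mulr1 big1 ?addr0 // => y /negPf->.
by rewrite mulr0.
Qed.

Lemma enum_val_eq (T : finType) (j : 'I_#|T|) (x : T) :
  (enum_val j == x) = (j == enum_rank x).
Proof. by rewrite -(inj_eq enum_rank_inj) enum_valK. Qed.

Lemma edge_mxE h i : (h *m edge_mx) 0 i = at_side h (i, true) + at_side h (ord_pred i, false).
Proof.
rewrite mxE /at_side -!(sum_delta (h 0)) -big_split; apply: eq_bigr => s _.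
by rewrite mxE mulrDr !enum_val_eq.
Qed.

Lemma face_mx_free : row_free face_mx.
Proof.
apply/row_freeP.
exists (\matrix_(s, k) (side_val (enum_val s) == nth (0%N, true) (faces w) k)%:R).
apply/matrixP => k k'; rewrite !mxE.
have /facesP[s es fs] : nth (0%N, true) (faces w) k' \in faces w by rewrite mem_nth.
under eq_bigr => j _ do rewrite !mxE es (inj_eq side_val_inj) enum_val_eq.
rewrite (sum_delta (fun j => (face_of w (side_val (enum_val j)) == _)%:R)) enum_rankK.
by rewrite -es fs nth_uniq ?uniq_faces // eq_sym.
Qed.

Lemma face_mx_invariant (v : 'rV[F]_nf) s : at_side (v *m face_mx) (tl s) = at_side (v *m face_mx)
  s.
Proof.
rewrite /at_side !mxE; apply: eq_bigr => k _.
by rewrite !mxE !enum_rankK face_of_tl.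
Qed.

Lemma ord_cycle_ind n (P : 'I_n -> Prop) (i0 : 'I_n) :
  val i0 = 0%N -> P i0 -> (forall i, P i -> P (ordS i)) -> forall i, P i.
Proof.
move=> e0 P0 PS [k lt]; elim: k lt => [|k IH] lt.
  by rewrite (_ : Ordinal lt = i0) //; apply: val_inj; rewrite /= e0.
rewrite (_ : Ordinal lt = ordS (Ordinal (ltnW lt))); first exact: PS.
by apply: val_inj; rewrite /= modn_small.
Qed.

Section Nonempty.

Variable i0 : 'I_(size w).
Hypothesis i0E : val i0 = 0%N.

(** With both strands pointing upwards, these are the faces on the left, on the right, at the bottom
    and at the top of the crossing, each seen from two edges. *)
Lemma tl_cases (h : side -> F) : (forall s, h (tl s) = h s) ->
  forall i : 'I_(size w), rightward w i ->
  [/\ h (i, true) = h (ordS (tw i), true),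
      h (i, false) = h (ord_pred (tw i), false),
      h (tw i, true) = h (ord_pred i, false) &
      h (tw i, false) = h (ordS i, true)].
Proof.
move=> inv i r.
have r' := rightward_tw i; rewrite r in r'.
rewrite -(inv (i, true)) -(inv (i, false)) -(inv (tw i, true)) -(inv (tw i, false)).
by rewrite /tl /= r r' /= twK.
Qed.

(** Crossing an edge negates the value. The left sides of two consecutive edges of the knot are
    separated by one edge of the other strand, so the values alternate along the knot. *)
Lemma potential_unique (h : side -> F) : (forall s, h (tl s) = h s) ->
  (forall i, h (i, true) + h (ord_pred i, false) = 0) -> h (i0, true) = 0 -> forall s, h s = 0.
Proof.
move=> inv e h0.
have r i : h (ord_pred i, false) = - h (i, true).
  by apply/eqP; rewrite -addr_eq0 addrC e.
have step i : h (ordS i, true) = - h (i, true).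
  wlog ri : i / rightward w i.
    move=> H; case: (boolP (rightward w i)) => ri; first exact: H.
    have rt : rightward w (tw i) by rewrite rightward_tw.
    have [L _ B _] := tl_cases inv rt; rewrite twK in L B.
    by rewrite -L B r opprK.
  have [_ _ B _] := tl_cases inv ri; have [_ R _ _] := tl_cases inv ri.
  have := r (ordS i); rewrite ordSK R r B r => /eqP.
  by rewrite opprK => /eqP->; rewrite opprK.
have ht : forall i, h (i, true) = 0.
  by apply: (ord_cycle_ind i0E) => // i hi; rewrite step hi oppr0.
by case=> i [] //; rewrite -[i]ordSK r ht oppr0.
Qed.

Lemma rank_face_edge : (nf <= (\rank (face_mx *m edge_mx)).+1)%N.
Proof.
have := mxrank_ker (face_mx *m edge_mx).
suff : (\rank (kermx (face_mx *m edge_mx)) <= 1)%N.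
  have := rank_leq_row (face_mx *m edge_mx); rewrite -/nf; lia.
apply: (rank_le1 (z := face_mx *m delta_mx (enum_rank (i0, true)) 0)) => v.
move/sub_kermxP; rewrite !mulmxA => vE vz.
apply: (row_free_inj face_mx_free); rewrite mul0mx; apply/rowP => s.
rewrite [RHS]mxE -(enum_valK s) -/(at_side _ _).
apply: potential_unique => [s'|i|]; first exact: face_mx_invariant.
  by rewrite -edge_mxE vE mxE.
have /matrixP/(_ 0 0) := vz; rewrite [RHS]mxE => <-.
rewrite /at_side [RHS]mxE (bigD1 (enum_rank (i0, true))) //= [X in _ = _ * X + _]mxE !eqxx mulr1.
by rewrite big1 ?addr0 // => j /negPf nj; rewrite [X in _ * X]mxE nj mulr0.
Qed.

Let no := #|[pred i | isover i]|.

Definition over_position (j : 'I_no) : 'I_(size w) := enum_val j.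

Lemma over_positionP j : isover (over_position j).
Proof. exact: (enum_valP j). Qed.

Lemma over_position_inj : injective over_position.
Proof. exact: enum_val_inj. Qed.

Lemma over_position_onto i : isover i -> exists j, i = over_position j.
Proof. by move=> oi; exists (enum_rank_in oi i); rewrite /over_position enum_rankK_in. Qed.

Definition kirchhoff_mx : 'M[F]_(size w, no) :=
  \matrix_(k, j) (let i := over_position j in
    (k == i)%:R + (k == ordS i)%:R - ((k == tw i)%:R + (k == ordS (tw i))%:R)).

Lemma kirchhoffE (f : 'rV[F]_(size w)) j : let i := over_position j in
  (f *m kirchhoff_mx) 0 j = f 0 i + f 0 (ordS i) - (f 0 (tw i) + f 0 (ordS (tw i))).
Proof.
move=> i; rewrite mxE -!(sum_delta (f 0)) -!big_split -sumrB /=; apply: eq_bigr => k _.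
by rewrite mxE /= mulrBr !mulrDr.
Qed.

(** A linear relation [v] between the crossing equations gives [a v], the coefficient of the
    crossing at each position with a sign for over or under. The relation says that [a v] alternates
    along the knot, so one value determines it. *)
Lemma rank_kirchhoff : (no <= (\rank kirchhoff_mx).+1)%N.
Proof.
have := mxrank_ker kirchhoff_mx^T; rewrite mxrank_tr.
suff : (\rank (kermx kirchhoff_mx^T) <= 1)%N.
  have := rank_leq_col kirchhoff_mx; rewrite -/no; lia.
pose a (v : 'rV[F]_no) (i : 'I_(size w)) : F := \sum_j v 0 j * ((i == over_position j)%:R - (i ==
  tw (over_position j))%:R).
apply: (rank_le1 (z := \col_j ((i0 == over_position j)%:R - (i0 == tw (over_position j))%:R))) => v.
move/sub_kermxP => vk vz.
have a0 : a v i0 = 0.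
  have /matrixP/(_ 0 0) := vz; rewrite [RHS]mxE => <-.
  by rewrite mxE; apply: eq_bigr => j _; rewrite mxE.
have step k : a v (ordS k) = - a v k.
  apply/eqP; rewrite -addr_eq0; apply/eqP.
  have /matrixP/(_ 0 (ordS k)) := vk; rewrite !mxE => <-.
  rewrite -big_split; apply: eq_bigr => j _ /=.
  rewrite !mxE /= -mulrDr !(inj_eq (can_inj (@ordSK _))).
  by congr (_ * _); ring.
have aE : forall i, a v i = 0.
  by apply: (ord_cycle_ind i0E) => // i ai; rewrite step ai oppr0.
apply/rowP => j; rewrite mxE -(aE (over_position j)) /a.
rewrite (bigD1 j) //= eqxx big1 ?addr0.
  have /negPf-> : over_position j != tw (over_position j).
    apply/eqP => /(congr1 isover); rewrite isover_tw.
    by case: isover.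
  by rewrite subr0 mulr1.
move=> j' /negPf nj; rewrite (inj_eq over_position_inj) eq_sym nj.
have /negPf-> : over_position j != tw (over_position j').
  by apply/eqP => /(congr1 isover); rewrite isover_tw !over_positionP.
by rewrite subrr mulr0.
Qed.

(** The two edges of either strand at a crossing together touch each of the four surrounding faces
    once, so both strands give the same sum. *)
Lemma face_edge_kirchhoff : face_mx *m edge_mx *m kirchhoff_mx = 0.
Proof.
apply/row_matrixP => k; rewrite row0 !rowE !mulmxA; apply/rowP => j.
set v := delta_mx _ _; rewrite kirchhoffE !edge_mxE mxE /= !ordSK.
have inv := face_mx_invariant v.
set i := over_position j.
case: (boolP (rightward w i)) => ri.
  have [L R B T] := tl_cases inv ri; rewrite L R -B -T; ring.
have rt : rightward w (tw i) by rewrite rightward_tw.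
have [L R B T] := tl_cases inv rt; rewrite twK in L R B T; rewrite L R -B -T; ring.
Qed.

Lemma rank_face_edge_le : (\rank (face_mx *m edge_mx) <= \rank (kermx kirchhoff_mx))%N.
Proof. by apply: mxrankS; apply/sub_kermxP; apply: face_edge_kirchhoff. Qed.

(** With [n] crossings, the image of the faces has dimension at least the number of faces minus 1
    and lies in the space of solutions of the crossing equations, of dimension at most
    [2n - (n - 1)]. *)
Lemma euler_bound : (size (faces w) <= (size w)./2 + 2)%N.
Proof.
have := rank_face_edge_le; rewrite mxrank_ker.
have := rank_kirchhoff; have := rank_face_edge; have : no = (size w)./2 := card_isover; have : nf
  = size (faces w) by [].
have := size_code; lia.
Qed.

Hypothesis euler : size (faces w) = ((size w)./2 + 2)%N.

Lemma rank_kirchhoff_planar : (\rank kirchhoff_mx < no)%N.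
Proof.
have := rank_face_edge_le; rewrite mxrank_ker.
have := rank_kirchhoff; have := rank_face_edge; have : no = (size w)./2 := card_isover; have : nf
  = size (faces w) by [].
have := size_code; lia.
Qed.

(** Euler's formula makes the count in [euler_bound] tight, so the image of the face functions is
    the whole space of solutions. *)
Lemma potential_exists (f : 'I_(size w) -> F) :
  (forall i, isover i -> f i + f (ordS i) = f (tw i) + f (ordS (tw i))) ->
  exists2 h : side -> F, (forall s, h (tl s) = h s) &
    forall i, f i = h (i, true) + h (ord_pred i, false).
Proof.
move=> fk; pose fv := \row_i f i.
have /sub_kermxP fker : fv *m kirchhoff_mx = 0.
  apply/rowP => j; rewrite kirchhoffE /fv !mxE fk ?subrr //; exact: over_positionP.
have sub : (face_mx *m edge_mx <= kermx kirchhoff_mx)%MS.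
  by apply/sub_kermxP; apply: face_edge_kirchhoff.
have : (kermx kirchhoff_mx <= face_mx *m edge_mx)%MS.
  rewrite -(geq_leqif (mxrank_leqif_sup sub)) mxrank_ker.
  have := rank_kirchhoff; have := rank_face_edge; have : no = (size w)./2 := card_isover; have :
    nf = size (faces w) by [].
  have := size_code; lia.
move/(submx_trans fker)/submxP => [v ev].
exists (at_side (v *m face_mx)); first exact: face_mx_invariant.
by move=> i; rewrite -edge_mxE -mulmxA -ev mxE.
Qed.

End Nonempty.

End Potentials.

End Positions.

(** * The linking form *)

Section ChainPositions.

Variables (A : comNzRingType) (S : A -> Prop).
Implicit Types (c : nat * bool -> A * A) (w : gauss_code).

Lemma chainE c x w y :
  chain c x w y <-> rcons [seq (c l.1).1 | l <- w] y = x :: [seq (c l.1).2 | l <- w].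
Proof.
elim: w x => [|l w IH] x /=; first by split=> [->|[->]].
by split=> [[-> /IH->]|[-> /IH]].
Qed.

Lemma chain_ordS c x w (i : 'I_(size w)) : chain c x w x ->
  (c (letter w i).1).2 = (c (letter w (ordS i)).1).1.
Proof.
move=> /chainE E; have lt := ltn_ord i.
have /(congr1 (fun s => nth x s i.+1)) := E.
rewrite /= (nth_map (0%N, false, false)) // nth_rcons size_map => <-.
case: ltnP => [h|h]; first by rewrite (nth_map (0%N, false, false)) // modn_small.
have e : i.+1 = size w by apply/eqP; rewrite eqn_leq lt h.
rewrite e eqxx modnn.
have /(congr1 (fun s => nth x s 0)) := E.
by rewrite /= nth_rcons size_map -e (nth_map (0%N, false, false)) // -e.
Qed.

Lemma chain_first c x w y (i0 : 'I_(size w)) : val i0 = 0%N -> chain c x w y ->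
  (c (letter w i0).1).1 = x.
Proof. by move=> ->; case: w i0 => [[]|l w] //= _ []. Qed.

Variable w : gauss_code.
Hypothesis wf : well_formed w.
Local Notation "''P'" := 'I_(size w).

Definition position_coloring (f : 'P -> A) : Prop :=
  forall i, isover i -> f i + f (ordS i) = f (tw wf i) + f (ordS (tw wf i))
                     /\ S (f (ordS i) - f i).

Definition position_weight (f : 'P -> A) : A :=
  \sum_(i | isover i) (if positive (letter w i) then 1 else -1) *
    ((f (ordS i) - f i) * (f (ordS (tw wf i)) - f (tw wf i))).

Definition position_labels c (i : 'P) : A := (c (letter w i).1).1.

Lemma letter_keys (i : 'P) : isover i ->
  (letter w i).1 = (crossing_of (letter w i), true) /\
  (letter w (tw wf i)).1 = (crossing_of (letter w i), false).
Proof.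
rewrite /= letter_twin // /isover /other_passage /over /crossing_of.
by case: (letter w i) => [[a o] e] /= ->.
Qed.

Lemma position_labelsE c x (i : 'P) : chain c x w x ->
  c (letter w i).1 = (position_labels c i, position_labels c (ordS i)).
Proof. by move=> ch; rewrite /position_labels -(chain_ordS _ ch); case: (c _). Qed.

Lemma coloring_positions c x : coloring S c x w -> position_coloring (position_labels c).
Proof.
move=> [ch ok] i oi; have [e1 e2] := letter_keys oi.
have := ok _ (mem_crossings (letter_in (ltn_ord i))).
by rewrite -e1 -e2 !(position_labelsE _ ch).
Qed.

Lemma weight_positions c x : chain c x w x -> weight c w = position_weight (position_labels c).
Proof.
move=> ch; rewrite /weight (big_nth (0%N, false, false)) big_mkord.
apply: eq_bigr => i oi; have [e1 e2] := letter_keys oi.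
by rewrite -/(letter w i) /strands_weight -e1 -e2 !(position_labelsE _ ch).
Qed.

Lemma positions_coloring (f : 'P -> A) (i0 : 'P) : val i0 = 0%N ->
  position_coloring f ->
  exists2 c, coloring S c (f i0) w & forall i : 'P, c (letter w i).1 = (f i, f (ordS i)).
Proof.
move=> i0E fc.
(* The value [(0, 0)] at keys that do not occur in [w] is never read. *)
pose c k := if insub (index k [seq l.1 | l <- w]) is Some i then (f i, f (ordS i)) else (0, 0).
have cE (i : 'P) : c (letter w i).1 = (f i, f (ordS i)).
  rewrite /c (_ : index _ _ = i) ?valK //.
  rewrite -(nth_map _ (0%N, false)) // index_uniq ?size_map //.
  by case/andP: wf.
exists c => //; split.
  apply/chainE; apply: (@eq_from_nth _ 0); rewrite /= ?size_rcons !size_map //.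
  have lt0 : (0 < size w)%N := leq_ltn_trans (leq0n _) (ltn_ord i0).
  have l0 : nth (0%N, false, false) w 0 = letter w i0 by rewrite /letter i0E.
  case=> [_|k]; first by rewrite nth_rcons size_map lt0 (nth_map (0%N, false, false)) // l0 cE.
  rewrite ltnS => lt; rewrite [RHS]/= (nth_map (0%N, false, false)) // -/(letter w (Ordinal lt)) cE.
  rewrite nth_rcons size_map; case: ltnP => h.
    rewrite (nth_map (0%N, false, false)) // -/(letter w (Ordinal h)) cE.
    by congr f; apply: val_inj; rewrite /= modn_small.
  have e : k.+1 = size w by apply/eqP; rewrite eqn_leq lt h.
  rewrite e eqxx; congr f; apply: val_inj; rewrite /= i0E e modnn //.
move=> a /mapP[l lw ->].
suff [i oi <-] : exists2 i : 'P, isover i & crossing_of (letter w i) = crossing_of l.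
  have [e1 e2] := letter_keys oi; rewrite -e1 -e2 !cE; exact: fc.
have lt : (index l w < size w)%N by rewrite index_mem.
have el : letter w (Ordinal lt) = l by rewrite /letter /= nth_index.
case: (boolP (isover (Ordinal lt))) => h; first by exists (Ordinal lt); rewrite ?el.
by exists (tw wf (Ordinal lt)); rewrite ?isover_tw //= letter_twin // el.
Qed.

End ChainPositions.

(** * The weight modulo the square of [p] *)

Section CrossTerm.

Variables (w : gauss_code) (wf : well_formed w).
Hypothesis euler : size (faces w) = ((size w)./2 + 2)%N.
Local Notation "''P'" := 'I_(size w).
Local Notation tw := (tw wf).
Local Notation tl := (tl wf).

Lemma sum_over_under (F : zmodType) (g : 'P -> F) :
  \sum_i g i = \sum_(i | isover i) (g i + g (tw i)).
Proof.
rewrite big_split (bigID (@isover w)) /=; congr (_ + _).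
rewrite (reindex_inj (inv_inj (twK wf))); apply: eq_bigl => i.
by rewrite isover_tw negbK.
Qed.

(* Writing [d] as a sum of face values, the sum over the crossings becomes a sum of
   [h s * (g (tl s) - g s)] over the sides, and vanishes because [h] is constant on faces. *)
Lemma cross_term0 (F : fieldType) (f d : 'P -> F) :
  position_coloring (fun z => z = 0) wf f ->
  (forall i, isover i -> d i + d (ordS i) = d (tw i) + d (ordS (tw i))) ->
  \sum_(i | isover i) (if positive (letter w i) then 1 else -1) *
    ((d (ordS i) - d i) * (f (ordS (tw i)) - f (tw i))) = 0.
Proof.
move=> fc dk.
case: (posnP (size w)) => [e|lt].
  by rewrite big1 // => i; move: (ltn_ord i); rewrite [X in (_ < X)%N]e.
have [h inv dE] := potential_exists (i0 := Ordinal lt) erefl euler dk.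
(* [kap s] is the label of the edge on which the side [s] lies. *)
pose kap (s : side w) := if s.2 then f s.1 else f (ordS s.1).
pose G s := h s * (kap (tl s) - kap s).
have G0 : \sum_s G s = 0.
  rewrite /G; under eq_bigr do rewrite mulrBr -[in X in X - _]inv.
  by rewrite sumrB -(reindex_inj (@tl_inj _ wf) (P := xpredT) (F := fun s => h s * kap s)) subrr.
(* In every characteristic, the term of a crossing is [-2] times the sum of [G] over its four
   sides. *)
have {G0} : - (\sum_s G s) *+ 2 = 0 by rewrite G0 oppr0 mul0rn.
rewrite (eq_bigr (fun s => G (s.1, s.2))); last by case.
rewrite -(pair_bigA _ (fun i b => G (i, b))) /= sum_over_under -sumrN -sumrMnl => E; rewrite
  -[RHS]E.
apply: eq_bigr => i oi; rewrite !big_bool /=.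
have [E1 /eqP] := fc i oi; rewrite subr_eq0 => /eqP E2.
have E3 : f (ordS (tw i)) = f i + f i - f (tw i) by rewrite E2 in E1; rewrite E1; ring.
have rE : rightward w i = positive (letter w i).
  by move: oi; rewrite /isover /rightward => ->; case: positive.
have rt := rightward_tw wf i.
rewrite rE in rt; rewrite /G /kap /tl /= rE rt.
case: positive rE rt => rE rt /=; rewrite !twK !ord_predK !dE !ordSK E3 ?E2.
  have [L R B T] := tl_cases inv rE; rewrite L R B T; ring.
have rt' : rightward w (tw i) by rewrite rightward_tw rE.
have [L R B T] := tl_cases inv rt'; rewrite twK in L R B T; rewrite L R B T; ring.
Qed.

Lemma position_weightD (A : comNzRingType) (f d : 'P -> A) (t : A) :
  position_weight wf (fun i => f i + t * d i) =
  position_weight wf f +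
  t * \sum_(i | isover i) (if positive (letter w i) then 1 else -1) *
    ((f (ordS i) - f i) * (d (ordS (tw i)) - d (tw i))) +
  t * \sum_(i | isover i) (if positive (letter w i) then 1 else -1) *
    ((d (ordS i) - d i) * (f (ordS (tw i)) - f (tw i))) + t ^+ 2 * position_weight wf d.
Proof.
rewrite /position_weight !mulr_sumr -!big_split; apply: eq_bigr => i _ /=.
by case: positive; ring.
Qed.

Definition dvd_by (p : nat) (z : int) : Prop := exists k, z = p%:Z * k.

Lemma intr_Fp_eq0 p (z : int) : prime p -> (z%:~R == 0 :> 'F_p) = (p%:Z %| z)%Z.
Proof.
move=> pr; have ch := pchar_Fp pr.
have nat_case n : (n%:R == 0 :> 'F_p) = (p %| n)%N by rewrite (dvdn_pcharf ch).
case: z => n; rewrite ?NegzE ?rmorphN ?oppr_eq0 /= -?pmulrn nat_case dvdzE ?abszN //.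
Qed.

(** Write [g = f + p d] and expand. The cross term with the over-jumps of [f] has a factor [p] from
    them; the other one is divisible by [p] because [cross_term0] applies modulo [p]; the last term
    already carries the square of [p]. *)
Lemma position_weight_mod p (f g : 'P -> int) : prime p ->
  position_coloring (dvd_by p) wf f -> position_coloring (dvd_by p) wf g ->
  (forall i, exists k, g i = f i + p%:Z * k) ->
  exists k, position_weight wf g = position_weight wf f + p%:Z ^+ 2 * k.
Proof.
move=> pr fc gc fg.
pose d i := ((g i - f i) %/ p%:Z)%Z.
have p0 : p%:Z != 0 by case: p pr {fc gc fg d} => //.
have gE i : g i = f i + p%:Z * d i.
  have [k ek] := fg i; rewrite /d ek addrAC subrr add0r mulKz //.
have dk i : isover i -> d i + d (ordS i) = d (tw i) + d (ordS (tw i)).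
  move=> oi; have [e1 _] := fc i oi; have [e2 _] := gc i oi.
  apply: (mulfI p0); rewrite !gE in e2.
  have -> : p%:Z * (d i + d (ordS i)) =
    f i + p%:Z * d i + (f (ordS i) + p%:Z * d (ordS i)) - (f i + f (ordS i)) by ring.
  by rewrite e2 e1; ring.
have -> : position_weight wf g = position_weight wf (fun i => f i + p%:Z * d i).
  by rewrite /position_weight; apply: eq_bigr => i _; rewrite !gE.
rewrite position_weightD.
have [k1 ->] : exists k, \sum_(i | isover i) (if positive (letter w i) then 1 else -1) *
    ((f (ordS i) - f i) * (d (ordS (tw i)) - d (tw i))) = p%:Z * k.
  apply: (big_ind (fun s => exists k, s = p%:Z * k)); first by exists 0; rewrite mulr0.
    by move=> x y [k ->] [k' ->]; exists (k + k'); rewrite mulrDr.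
  move=> i oi; have [_ [k ->]] := fc i oi.
  by exists ((if positive (letter w i) then 1 else -1) * (k * (d (ordS (tw i)) - d (tw i)))); ring.
set X := \sum_(i | _) _.
have [k2 ->] : exists k, X = p%:Z * k.
  suff /dvdzP[k ->] : (p%:Z %| X)%Z by exists k; rewrite mulrC.
  rewrite -intr_Fp_eq0 // /X rmorph_sum /=.
  have := @cross_term0 'F_p (fun i => (f i)%:~R) (fun i => (d i)%:~R).
  move=> H; apply/eqP; rewrite -[RHS]H.
  - by apply: eq_bigr => i _; rewrite !rmorphM !rmorphB /=; case: positive.
  - move=> i oi; have [e [k ek]] := fc i oi; split; first by rewrite -!rmorphD e.
    apply/eqP; rewrite -rmorphB intr_Fp_eq0 // ek; apply/dvdzP; exists k; exact: mulrC.
  - by move=> i oi; rewrite -!rmorphD dk.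
by exists (k1 + k2 + position_weight wf d); ring.
Qed.

(** The face values are lifted instead of the labels: every function on the faces, also an integer
    one, satisfies the crossing equations exactly. *)
Lemma lift_coloring p (f : 'P -> 'F_p) : prime p ->
  position_coloring (fun z => z = 0) wf f ->
  exists2 g : 'P -> int, position_coloring (dvd_by p) wf g & forall i, (g i)%:~R = f i.
Proof.
move=> pr fc.
case: (posnP (size w)) => [e|lt].
  by exists (fun _ => 0) => i; move: (ltn_ord i); rewrite [X in (_ < X)%N]e.
have dk i : isover i -> f i + f (ordS i) = f (tw i) + f (ordS (tw i)) by case/fc.
have [h inv hE] := potential_exists (i0 := Ordinal lt) erefl euler dk.
pose H s := (val (h s))%:Z.
have HE s : (H s)%:~R = h s :> 'F_p by rewrite /H -pmulrn natr_Zp.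
have invH s : H (tl s) = H s by rewrite /H inv.
pose g i := H (i, true) + H (ord_pred i, false).
have gE i : (g i)%:~R = f i by rewrite /g rmorphD /= !HE hE.
exists g => // i oi; split.
  rewrite /g !ordSK.
  have tlc (k : 'P) : rightward w k -> [/\ H (k, true) = H (ordS (tw k), true),
      H (k, false) = H (ord_pred (tw k), false),
      H (tw k, true) = H (ord_pred k, false) & H (tw k, false) = H (ordS k, true)].
    by move=> rk; have [? ? ? ?] := tl_cases inv rk; rewrite /H; split; congr (Posz (val _)).
  case: (boolP (rightward w i)) => ri.
    by have [-> -> -> ->] := tlc _ ri; ring.
  have rt : rightward w (tw i) by rewrite rightward_tw.
  by have := tlc _ rt; rewrite twK => -[-> -> -> ->]; ring.
have /dvdzP[k ->] : (p%:Z %| g (ordS i) - g i)%Z; last by exists k; rewrite mulrC.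
by rewrite -intr_Fp_eq0 // rmorphB /= !gE; case: (fc i oi) => _ ->.
Qed.

End CrossTerm.

(** * Change of base point, renaming and transport along moves *)

Section Basics.

Variables (A : comNzRingType) (S : A -> Prop).
Implicit Types (c : nat * bool -> A * A) (w : gauss_code).

Lemma chain_end m c x z w y :
  chain c x w y -> labels_agree m c z w -> x *+ m = z *+ m -> y *+ m = z *+ m.
Proof.
elim: w x => [|l w IH] x /=; first by move->.
move=> [_ h] lab _; apply: (IH _ h) => [l' lw|]; first by apply: lab; rewrite inE lw orbT.
by case: (lab l (mem_head _ _)).
Qed.

Lemma chain_start m c x z w y :
  chain c x w y -> labels_agree m c z w -> y *+ m = z *+ m -> x *+ m = z *+ m.
Proof.
case: w => [|l w] /=; first by move->.
by move=> [<- _] lab _; case: (lab l (mem_head _ _)).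
Qed.

Lemma chain_det c c' x w y y' :
  same_labels c c' w -> chain c x w y -> chain c' x w y' -> y' = y.
Proof.
move=> sm /(chain_same sm); elim: w x {sm} => [|l w IH] x /=; first by move=> -> ->.
by move=> [_ h] [_ h']; apply: IH h h'.
Qed.

Lemma labels_agree_sub m c x w w' :
  {subset w' <= w} -> labels_agree m c x w -> labels_agree m c x w'.
Proof. by move=> sub lab l /sub/lab. Qed.

Lemma coloring_rot i c x w : coloring S c x w ->
  exists2 y, coloring S c y (rot i w) &
    forall m, labels_agree m c y (rot i w) -> labels_agree m c x w.
Proof.
case; rewrite -{1}(cat_take_drop i w) => /chain_cat[y h1 h2] ok; exists y.
  split; first by apply/chain_cat; exists x.
  move=> a; rewrite /crossings map_rot mem_rot; exact: ok.
move=> m lab.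
have xy : x *+ m = y *+ m.
  apply: chain_start h1 _ erefl; apply: labels_agree_sub lab => l.
  by rewrite mem_rot => /mem_take.
by move=> l lw; rewrite xy; apply: lab; rewrite mem_rot.
Qed.

Lemma weight_rot i c w : weight c (rot i w) = weight c w.
Proof. by apply: perm_big; rewrite perm_rot. Qed.

Lemma rename_crossings f w : crossings (rename f w) = [seq f a | a <- crossings w].
Proof. by rewrite /crossings /rename -!map_comp. Qed.

Lemma coloring_rename f c c' x w :
  {in crossings w, forall a b, c' (f a, b) = c (a, b)} ->
  [/\ coloring S c' x (rename f w) <-> coloring S c x w,
      weight c' (rename f w) = weight c w &
      forall m, labels_agree m c' x (rename f w) <-> labels_agree m c x w].
Proof.
move=> e.
have e' l : l \in w -> c' (f (crossing_of l), over l) = c l.1.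
  by move=> /mem_crossings/e; case: l => [[a o] s]; apply.
split.
- have ch y z : chain c' y (rename f w) z <-> chain c y w z.
    elim: w y e' {e} => //= l w IH y e'.
    rewrite e' ?mem_head //.
    by split=> -[-> /IH h]; split=> //; apply: h => l' lw; apply: e'; rewrite inE lw orbT.
  split=> -[/ch h ok]; split=> // a.
    by move=> aw; rewrite -!e //; apply: ok; rewrite rename_crossings map_f.
  by rewrite rename_crossings => /mapP[b bw ->]; rewrite !e //; apply: ok.
- rewrite /weight big_map big_seq_cond [RHS]big_seq_cond; apply: eq_bigr => l /andP[lw _].
  by rewrite /crossing_of /= !e ?mem_crossings.
- move=> m; split=> lab l.
    by move=> lw; rewrite -(e' _ lw); apply: (lab (f (crossing_of l), over l, positive l));
      apply/mapP; exists l.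
  by case/mapP => l' lw -> /=; rewrite e' //; apply: lab.
Qed.

Lemma rename_inverse f w : injective f ->
  exists g : nat -> nat, {in crossings w, forall a, g (f a) = a}.
Proof.
move=> fi; exists (fun b => nth 0%N (crossings w) (index b [seq f a | a <- crossings w])).
by move=> a aw; rewrite index_map // nth_index.
Qed.

Lemma coloring_renameR f c x w : injective f -> coloring S c x w ->
  exists2 c', coloring S c' x (rename f w) /\ weight c' (rename f w) = weight c w &
    forall m, labels_agree m c' x (rename f w) -> labels_agree m c x w.
Proof.
move=> fi col; have [g gf] := rename_inverse w fi.
have [|h1 h2 h3] := @coloring_rename f c (fun k => c (g k.1, k.2)) x w.
  by move=> a aw b /=; rewrite gf.
by exists (fun k => c (g k.1, k.2)); [split=> //; apply/h1|move=> m /h3].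
Qed.

Lemma coloring_renameL f c x w : coloring S c x (rename f w) ->
  exists2 c', coloring S c' x w /\ weight c' w = weight c (rename f w) &
    forall m, labels_agree m c' x w -> labels_agree m c x (rename f w).
Proof.
move=> col.
have [//|h1 h2 h3] := @coloring_rename f (fun k => c (f k.1, k.2)) c x w.
by exists (fun k => c (f k.1, k.2)); [split=> //; apply/h1|move=> m /h3].
Qed.

End Basics.

Lemma uniq_keys w : well_formed w -> uniq [seq l.1 | l <- w].
Proof. by case/andP. Qed.

Lemma fresh_crossing a (v : gauss_code) :
  (a, true) \notin [seq l.1 | l <- v] -> (a, false) \notin [seq l.1 | l <- v] ->
  a \notin crossings v.
Proof.
move=> h1 h2; apply/mapP => -[[[b o] e] lv /= E].
have : (b, o) \in [seq l.1 | l <- v] by apply/mapP; exists (b, o, e).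
by rewrite -[b]E; case: o {lv E}; apply/negP.
Qed.

Lemma fresh_R1 a o e w : well_formed [:: (a, o, e), (a, ~~ o, e) & w] -> a \notin crossings w.
Proof.
move=> /uniq_keys /=; rewrite inE negb_or => /andP[/andP[_ h1] /andP[h2 _]].
by case: o h1 h2 => h1 h2; apply: fresh_crossing.
Qed.

Lemma fresh_R2 a b e s w1 w2 :
  well_formed ([:: (a, true, e); (b, true, ~~ e)] ++ w1 ++
            in_order s (a, false, e) (b, false, ~~ e) ++ w2) ->
  [/\ a != b, a \notin crossings (w1 ++ w2) & b \notin crossings (w1 ++ w2)].
Proof.
move=> /uniq_keys.
set w := _ ++ _; have : perm_eq [seq l.1 | l <- w]
    ([:: (a, true); (b, true); (a, false); (b, false)] ++ [seq l.1 | l <- w1 ++ w2]).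
  apply/permP => P; rewrite /w !map_cat !count_cat.
  by case: s {w} => /=; lia.
move/perm_uniq->; rewrite cat_uniq => /and3P[/= U1 /hasPn U2 _].
have n k : k \in [:: (a, true); (b, true); (a, false); (b, false)] ->
    k \notin [seq l.1 | l <- w1 ++ w2].
  by move=> kin; apply/negP => /U2; rewrite kin.
split; last by apply: fresh_crossing; apply: n; rewrite !inE eqxx ?orbT.
  by apply: contraTneq U1 => ->; rewrite inE eqxx.
by apply: fresh_crossing; apply: n; rewrite !inE eqxx ?orbT.
Qed.

Lemma fresh_R3 q a b k ea eb ec sT sM sB w1 w2 w3 :
  well_formed (R3_word q a b k ea eb ec sT sM sB w1 w2 w3) ->
  uniq [:: a; b; k] /\ {in [:: a; b; k], forall d, d \notin crossings (w1 ++ w2 ++ w3)}.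
Proof.
move=> /uniq_keys; rewrite /R3_word.
set w := _ ++ _; pose K := [:: (a, true); (b, true); (a, false); (k, true); (b, false); (k, false)].
have : perm_eq [seq l.1 | l <- w] (K ++ [seq l.1 | l <- w1 ++ w2 ++ w3]).
  apply/permP => P; rewrite /w !map_cat !count_cat.
  by case: q {w}; case: sT; case: sM; case: sB => /=; lia.
move/perm_uniq->; rewrite cat_uniq => /and3P[U1 /hasPn U2 _].
have n d : d \in K -> d \notin [seq l.1 | l <- w1 ++ w2 ++ w3].
  by move=> kin; apply/negP => /U2; rewrite kin.
split.
  move: U1; rewrite /K /= !inE !xpair_eqE /= !andbF !andbT /=.
  by case: (a == b); case: (a == k); case: (b == k); rewrite ?orbT.
move=> d; rewrite !inE => /or3P[] /eqP->; apply: fresh_crossing; apply: n;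
  by rewrite !inE !eqxx ?orbT.
Qed.

(* The homology of the double branched cover is annihilated by [m]. *)
Definition annihilates (m : nat) (w : gauss_code) : Prop :=
  forall (A : comNzRingType) (c : nat * bool -> A * A) (x : A),
    coloring (fun z => z = 0) c x w -> labels_agree m c x w.

(** The new coloring controls the old one for all [m] at once, so annihilation passes from [w'] back
    to [w]. *)
Definition label_transfer (w w' : gauss_code) : Prop :=
  forall (A : comNzRingType) (c : nat * bool -> A * A) (x : A),
    coloring (fun z => z = 0) c x w ->
  exists (c' : nat * bool -> A * A) (x' : A), coloring (fun z => z = 0) c' x' w' /\
    forall m, labels_agree m c' x' w' -> labels_agree m c x w.

Lemma label_transfer_annihilates m w w' :
  label_transfer w w' -> annihilates m w' -> annihilates m w.
Proof. by move=> tr ann A c x /tr[c' [x' [col lab]]]; apply: lab; apply: ann. Qed.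

Lemma zero_sub (A : comNzRingType) (x y : A) : x = 0 -> y = 0 -> x - y = 0.
Proof. by move=> -> ->; rewrite subrr. Qed.

Lemma label_transfer_rot i w : label_transfer w (rot i w).
Proof. by move=> A c x /(coloring_rot i)[y col lab]; exists c, y. Qed.

Lemma label_transfer_R1_del a o e w : label_transfer [:: (a, o, e), (a, ~~ o, e) & w] w.
Proof.
move=> A c x col; have [col' _] := coloring_R1_del col.
exists c, x; split=> // m lab.
case: col => /=[[e1 [e2 ch]] ok].
have [E /eqP] := ok a (mem_head _ _); rewrite subr_eq0 => /eqP E2.
have ex : (c (a, ~~ o)).2 = x /\ (c (a, o)).2 = x.
  case: o e1 e2 {ch ok} => /= e1 e2; move: E; rewrite E2 e1 e2 ?E2 ?e1 => E.
    by split=> //; apply: (addrI x); rewrite -E.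
  have -> : (c (a, false)).2 = x by apply: (addIr (c (a, false)).2); rewrite -E.
  by [].
move=> l; rewrite !inE => /or3P[/eqP->|/eqP->|lw] /=; last exact: lab.
  by rewrite e1 (proj2 ex).
by rewrite e2 (proj1 ex) (proj2 ex).
Qed.

Lemma label_transfer_R1_add a o e w : a \notin crossings w ->
  label_transfer w [:: (a, o, e), (a, ~~ o, e) & w].
Proof.
move=> aw A c x col; have [c' [col' _] sm] := coloring_R1_add (S := fun z => z = 0) erefl o e aw
  col.
exists c', x; split=> // m lab l lw.
rewrite -(same_labels_at sm lw); apply: lab.
by rewrite !inE lw !orbT.
Qed.

Lemma label_transfer_R2_add a b e s w1 w2 :
  a != b -> a \notin crossings (w1 ++ w2) -> b \notin crossings (w1 ++ w2) ->
  label_transfer (w1 ++ w2) ([:: (a, true, e); (b, true, ~~ e)] ++ w1 ++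
            in_order s (a, false, e) (b, false, ~~ e) ++ w2).
Proof.
move=> ab aw bw A c x col.
have [c' [col' _] sm] := coloring_R2_add (S := fun z => z = 0) erefl e s ab aw bw col.
exists c', x; split=> // m lab l lw.
rewrite -(same_labels_at sm lw); apply: lab.
by move: lw; rewrite !mem_cat => /orP[]->; rewrite ?orbT.
Qed.

Lemma label_transfer_R2_del a b e s w1 w2 :
  label_transfer ([:: (a, true, e); (b, true, ~~ e)] ++ w1 ++
            in_order s (a, false, e) (b, false, ~~ e) ++ w2) (w1 ++ w2).
Proof.
move=> A c x col; have [ch' ok'] := coloring_R2_del (fun z h => h) col; exists c, x; split=> // m
  lab.
case: col => /=[[e1 [e2 /chain_cat[y ch1 /chain_cat[y' ch ch2]]]] ok].
have [Ea /eqP] : strands_ok (fun z => z = 0) (c (a, true)) (c (a, false)).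
  by apply: ok; rewrite /= mem_head.
rewrite subr_eq0 => /eqP Ta.
have [Eb /eqP] : strands_ok (fun z => z = 0) (c (b, true)) (c (b, false)).
  by apply: ok; rewrite /= !inE eqxx orbT.
rewrite subr_eq0 => /eqP Tb.
rewrite Tb e2 Ta e1 in Eb ch1; rewrite Ta e1 in Ea.
have labw v : {subset v <= w1 ++ w2} -> labels_agree m c x v.
  by move=> sv; apply: labels_agree_sub lab.
have Ly : y *+ m = x *+ m.
  by apply: (chain_end ch1) => //; apply: labw => l; rewrite mem_cat => ->.
have L1 u v : x + x = u + v -> u *+ m = x *+ m -> v *+ m = x *+ m.
  move=> E Lu; apply: (addrI (u *+ m)).
  by rewrite -mulrnDl -E mulrnDl Lu.
move=> l; rewrite 2!inE orbA => /orP[/orP[]/eqP->|].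
- by rewrite /= Ta e1.
- by rewrite /= Tb e2 Ta e1.
rewrite !mem_cat => /or3P[lw|lo|lw]; try by apply: lab; rewrite mem_cat lw ?orbT.
move: lo ch; rewrite /in_order; case: s {ok} => lo /= [f1 [f2 f3]].
  have La := L1 _ _ Ea; rewrite f1 in La; have {}La := La Ly.
  have Lb := L1 _ _ Eb; rewrite f2 in Lb; have {}Lb := Lb La.
  by move: lo; rewrite !inE => /orP[]/eqP-> /=; rewrite ?f1 ?f2.
have Lb := L1 _ _ Eb; rewrite f1 in Lb; have {}Lb := Lb Ly.
have La := L1 _ _ Ea; rewrite f2 in La; have {}La := La Lb.
by move: lo; rewrite !inE => /orP[]/eqP-> /=; rewrite ?f1 ?f2.
Qed.

Lemma label_transfer_R3 q a b k ea eb ec sT sM sB w1 w2 w3 :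
  (sM == ea) = (sB == eb) -> (sM == ec) = (sT == eb) ->
  well_formed (R3_word q a b k ea eb ec sT sM sB w1 w2 w3) ->
  label_transfer (R3_word q a b k ea eb ec sT sM sB w1 w2 w3)
    (R3_word q a b k ea eb ec (~~ sT) (~~ sM) (~~ sB) w1 w2 w3).
Proof.
move=> h1 h2 /fresh_R3[U fr] A c x col.
have [||c' [col' _] lab] := coloring_R3 _ _ h1 h2 U fr col => //; first exact: zero_sub.
by exists c', x; split=> // m; apply: lab.
Qed.

(** The inverse of an R3 move is again an R3 move, with the three orders reversed. *)
Lemma R3_word_rev q a b k ea eb ec sT sM sB w1 w2 w3 :
  R3_word q a b k ea eb ec (~~ ~~ sT) (~~ ~~ sM) (~~ ~~ sB) w1 w2 w3 =
  R3_word q a b k ea eb ec sT sM sB w1 w2 w3.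
Proof. by rewrite !negbK. Qed.

Lemma R3_orders_rev (s s' e e' : bool) : (s == e) = (s' == e') -> (~~ s == e) = (~~ s' == e').
Proof. by case: s; case: s'; case: e; case: e'. Qed.

Lemma label_transfer_move w w' :
  diagram_move w w' -> label_transfer w w' /\ label_transfer w' w.
Proof.
case=> /andP[wf _] /andP[wf' _] mv; case: mv wf wf' => {w w'}.
- move=> i w _ _; split; first exact: label_transfer_rot.
  rewrite -{2}(rotK i w); exact: label_transfer_rot.
- move=> f w fi _ _; split=> A c x col.
    by have [c' [col' _] lab] := coloring_renameR fi col; exists c', x.
  by have [c' [col' _] lab] := coloring_renameL col; exists c', x.
- move=> a o e w wf _; split; first exact: label_transfer_R1_del.
  by apply: label_transfer_R1_add; apply: fresh_R1 wf.
- move=> a b e s w1 w2 wf _; split; first exact: label_transfer_R2_del.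
  by have [ab aw bw] := fresh_R2 wf; apply: label_transfer_R2_add.
- move=> a b k ea eb ec sT sM sB w1 w2 w3 h1 h2 wf wf'; split.
    exact: (@label_transfer_R3 true).
  rewrite -[X in label_transfer _ X](R3_word_rev true).
  by apply: (@label_transfer_R3 true) => //; apply: R3_orders_rev.
- move=> a b k ea eb ec sT sM sB w1 w2 w3 h1 h2 wf wf'; split.
    exact: (@label_transfer_R3 false).
  rewrite -[X in label_transfer _ X](R3_word_rev false).
  by apply: (@label_transfer_R3 false) => //; apply: R3_orders_rev.
Qed.

Lemma isotopic_ind (P : gauss_code -> Prop) :
  (forall w w', diagram_move w w' -> P w <-> P w') ->
  forall w w', isotopic w w' -> P w <-> P w'.
Proof.
move=> h w w'; elim=> {w w'} [w w' /h|//|w w' _ IH|w w' w'' _ IH1 _ IH2] //.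
  exact: iff_sym.
exact: iff_trans IH1 IH2.
Qed.

Lemma annihilates_isotopic m w w' : isotopic w w' -> annihilates m w <-> annihilates m w'.
Proof.
apply: isotopic_ind => {}w {}w' /label_transfer_move[h1 h2].
by split; apply: label_transfer_annihilates.
Qed.


Section LinkingForm.

Variable p : nat.
Hypothesis pr : prime p.

(* [weight c w / p] modulo [p] is a value of the linking form on the p-torsion. *)
Definition linking_nonresidue (w : gauss_code) : Prop :=
  exists c x (r : int), [/\ coloring (dvd_by p) c x w, weight c w = p%:Z * r &
    forall t z : int, r <> t ^+ 2 + p%:Z * z].

(** The square of [p] appears because the weight is divided by [p] before it is read modulo [p]. *)
Definition linking_transfer (w w' : gauss_code) : Prop :=
  forall c x, coloring (dvd_by p) c x w ->
  exists c' x' k, coloring (dvd_by p) c' x' w' /\ weight c' w' = weight c w + p%:Z ^+ 2 * k.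

Lemma linking_transfer_nonresidue w w' :
  linking_transfer w w' -> linking_nonresidue w -> linking_nonresidue w'.
Proof.
move=> tr [c [x [r [col wt nr]]]]; have [c' [x' [k [col' wt']]]] := tr _ _ col.
exists c', x', (r + p%:Z * k); split=> //; first by rewrite wt' wt; ring.
by move=> t z E; apply: (nr t (z - k)); rewrite mulrBr addrA -E; ring.
Qed.

Lemma dvd_by0 : dvd_by p 0.
Proof. by exists 0; rewrite mulr0. Qed.

Lemma dvd_byB x y : dvd_by p x -> dvd_by p y -> dvd_by p (x - y).
Proof. by move=> [k ->] [k' ->]; exists (k - k'); rewrite mulrBr. Qed.

Lemma linking_transfer_R1_del a o e w : linking_transfer [:: (a, o, e), (a, ~~ o, e) & w] w.
Proof.
move=> c x /coloring_R1_del[col [d [k ->] [_ [E|E]]]].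
  by exists c, x, (- k ^+ 2); split=> //; rewrite E; ring.
by exists c, x, (k ^+ 2); split=> //; rewrite E; ring.
Qed.

Lemma linking_transfer_R1_add a o e w : a \notin crossings w ->
  linking_transfer w [:: (a, o, e), (a, ~~ o, e) & w].
Proof.
move=> aw c x col; have [c' [col' E] _] := coloring_R1_add dvd_by0 o e aw col.
by exists c', x, 0; split=> //; rewrite E mulr0 addr0.
Qed.

Lemma linking_transfer_R2_add a b e s w1 w2 :
  a != b -> a \notin crossings (w1 ++ w2) -> b \notin crossings (w1 ++ w2) ->
  linking_transfer (w1 ++ w2) ([:: (a, true, e); (b, true, ~~ e)] ++ w1 ++
            in_order s (a, false, e) (b, false, ~~ e) ++ w2).
Proof.
move=> ab aw bw c x col; have [c' [col' E] _] := coloring_R2_add dvd_by0 e s ab aw bw col.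
by exists c', x, 0; split=> //; rewrite E mulr0 addr0.
Qed.

Lemma linking_transfer_R3 q a b k ea eb ec sT sM sB w1 w2 w3 :
  (sM == ea) = (sB == eb) -> (sM == ec) = (sT == eb) ->
  well_formed (R3_word q a b k ea eb ec sT sM sB w1 w2 w3) ->
  linking_transfer (R3_word q a b k ea eb ec sT sM sB w1 w2 w3)
    (R3_word q a b k ea eb ec (~~ sT) (~~ sM) (~~ sB) w1 w2 w3).
Proof.
move=> h1 h2 /fresh_R3[U fr] c x col.
have [c' [col' E] _] := coloring_R3 dvd_by0 dvd_byB h1 h2 U fr col.
by exists c', x, 0; split=> //; rewrite E mulr0 addr0.
Qed.

Definition reduce_mod (c : nat * bool -> int * int) (k : nat * bool) : 'F_p * 'F_p :=
  ((c k).1%:~R, (c k).2%:~R).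

Lemma reduce_modP c x w : coloring (dvd_by p) c x w ->
  coloring (fun z => z = 0) (reduce_mod c) x%:~R w.
Proof.
move=> [ch ok]; split.
  suff G y z : chain c y w z -> chain (reduce_mod c) y%:~R w z%:~R by exact: G ch.
  elim: w y {ch ok} => /= [|l w IH] y; first by move->.
  by move=> [<- /IH].
move=> a /ok[E [k ek]]; split; first by rewrite /= -!rmorphD E.
rewrite /= -rmorphB ek; apply/eqP; rewrite intr_Fp_eq0 //; exact: dvdz_mulr.
Qed.

(** The over-labels in the bigon equal [x] and the inner under-label is a reflection, so the rest of
    a Fox coloring determines them. This identifies a coloring with the one obtained by deleting and
    restoring the bigon. *)
Lemma R2_labels_unique (F : comNzRingType) a b e s w1 w2 (c c' : nat * bool -> F * F) x :
  let w := [:: (a, true, e); (b, true, ~~ e)] ++ w1 ++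
            in_order s (a, false, e) (b, false, ~~ e) ++ w2 in
  coloring (fun z => z = 0) c x w -> coloring (fun z => z = 0) c' x w ->
  same_labels c c' (w1 ++ w2) -> {in w, forall l, c' l.1 = c l.1}.
Proof.
move=> w [ch ok] [ch' ok'] sm.
have det (z : nat * bool -> F * F) : coloring (fun z => z = 0) z x w ->
    exists y, [/\ z (a, true) = (x, x), z (b, true) = (x, x), chain z x w1 y &
      if s then z (a, false) = (y, x + x - y) /\ z (b, false) = (x + x - y, y)
      else z (b, false) = (y, x + x - y) /\ z (a, false) = (x + x - y, y)].
  move=> [/=[e1 [e2 /chain_cat[y h1 /chain_cat[y' h h2]]]] okz].
  have [|Ea /eqP] := okz a; first by rewrite mem_head.
  rewrite subr_eq0 => /eqP Ta.
  have [|Eb /eqP] := okz b; first by rewrite !inE eqxx orbT.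
  rewrite subr_eq0 => /eqP Tb.
  rewrite Tb e2 Ta e1 in Eb h1; rewrite Ta e1 in Ea.
  exists y; split=> //.
  - by rewrite [LHS]surjective_pairing Ta e1.
  - by rewrite [LHS]surjective_pairing Tb e2 Ta e1.
  have solve u v : x + x = u + v -> v = x + x - u by move->; ring.
  have {}Ea := solve _ _ Ea; have {}Eb := solve _ _ Eb.
  move: h; rewrite /in_order; case: (s) => /= -[f1 [f2 f3]]; split;
    by rewrite [LHS]surjective_pairing ?Ea ?Eb ?f1 ?f2 ?Ea ?Eb ?f1; congr pair; ring.
have [y [A1 A2 A3 A4]] := det c (conj ch ok).
have [y' [B1 B2 B3 B4]] := det c' (conj ch' ok').
have ey : y' = y.
  by apply: chain_det A3 B3 => d dw; apply: sm; rewrite crossings_cat mem_cat dw.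
rewrite ey in B4.
move=> l; rewrite /w 2!inE orbA !mem_cat => /orP[/orP[]/eqP->|/or3P[lw|lo|lw]] /=; rewrite ?A1 ?A2
  //.
- by apply: (same_labels_at sm); rewrite mem_cat lw.
- move: lo; rewrite /in_order; case: s A4 B4 {det ch ch' ok ok' w} => -[a1 a2] [h1 h2];
    by rewrite !inE => /orP[]/eqP-> /=; rewrite ?h1 ?h2 ?a1 ?a2.
- by apply: (same_labels_at sm); rewrite mem_cat lw orbT.
Qed.

Lemma same_labels_letters (T : comNzRingType) (c c' : nat * bool -> T * T) w :
  well_formed w -> {in w, forall l, c' l.1 = c l.1} -> same_labels c c' w.
Proof.
move=> /andP[_ /allP oth] h a /mapP[l lw ->] o.
have [<-|ne] := eqVneq (over l) o; first by move: (h l lw); case: (l) => -[].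
by have := h _ (oth _ lw); rewrite /other_passage /=; case: o (over l) ne => -[].
Qed.

Lemma planar_euler w : planar w -> (0 < size w)%N -> size (faces w) = ((size w)./2 + 2)%N.
Proof. by case/orP => [/eqP->|/eqP]. Qed.

(** [c] itself need not restrict to the smaller diagram. Its reduction modulo [p] does; the
    restriction is lifted to integers through face values of the smaller diagram, and the bigon is
    added again. The result agrees with [c] modulo [p], so by [position_weight_mod] on the larger
    diagram the weights agree modulo the square of [p]. *)
Lemma linking_transfer_R2_del a b e s w1 w2 :
  let w := [:: (a, true, e); (b, true, ~~ e)] ++ w1 ++
            in_order s (a, false, e) (b, false, ~~ e) ++ w2 in
  knot_diagram w -> knot_diagram (w1 ++ w2) -> linking_transfer w (w1 ++ w2).
Proof.
move=> w /andP[wf pl] /andP[wf2 pl2] c x col.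
have colF := reduce_modP col.
have colF2 := coloring_R2_del (fun z h => h) colF.
have [ab aw bw] := fresh_R2 wf.
have [c0 [x0 [col0 ex same0]]] : exists c0 x0, [/\ coloring (dvd_by p) c0 x0 (w1 ++ w2),
    x0%:~R = x%:~R :> 'F_p & {in w1 ++ w2, forall l, reduce_mod c0 l.1 = reduce_mod c l.1}].
  (* On the empty code there is no first position; there any labelling will do. *)
  case: (posnP (size (w1 ++ w2))) => [/size0nil E|lt].
    by exists c, x; rewrite E; split=> //; split.
  pose i0 := Ordinal lt.
  have [g gc gE] := lift_coloring (planar_euler pl2 lt) pr (coloring_positions wf2 colF2).
  have [c0 col0 c0E] := @positions_coloring _ _ _ wf2 g i0 erefl gc.
  exists c0, (g i0); split=> //.
    by rewrite gE /position_labels (chain_first (i0 := i0) erefl (proj1 colF2)).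
  move=> l lw; have li : (index l (w1 ++ w2) < size (w1 ++ w2))%N by rewrite index_mem.
  have -> : l = letter (w1 ++ w2) (Ordinal li) by rewrite /letter /= nth_index.
  by rewrite {1}/reduce_mod c0E /= !gE -(position_labelsE _ (proj1 colF2)).
have [c1 [col1 E1] sm1] := coloring_R2_add dvd_by0 e s ab aw bw col0.
have lt : (0 < size w)%N by [].
have same1 : {in w, forall l, reduce_mod c1 l.1 = reduce_mod c l.1}.
  have := reduce_modP col1; rewrite ex => colF1.
  apply: (R2_labels_unique colF colF1); apply: same_labels_letters => // l lw.
  by rewrite -same0 // /reduce_mod (same_labels_at sm1 lw).
have [|k ek] := position_weight_mod (planar_euler pl lt) pr (coloring_positions wf col1)
    (coloring_positions wf col).
  move=> i; have /(congr1 fst) /= E := same1 _ (letter_in (ltn_ord i)).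
  have /dvdzP[k ek] : (p%:Z %| (c (letter w i).1).1 - (c1 (letter w i).1).1)%Z.
    by rewrite -intr_Fp_eq0 // rmorphB /= E subrr.
  by exists k; rewrite mulrC -ek /position_labels addrC subrK.
exists c0, x0, (- k); split=> //.
rewrite -E1 (weight_positions wf (proj1 col)) (weight_positions wf (proj1 col1)) ek; ring.
Qed.

Lemma linking_transfer_move w w' :
  diagram_move w w' -> linking_transfer w w' /\ linking_transfer w' w.
Proof.
have eq_tr (u v : gauss_code) : (forall c x, coloring (dvd_by p) c x u ->
    exists c' x', coloring (dvd_by p) c' x' v /\ weight c' v = weight c u) -> linking_transfer u v.
  move=> h c x /h[c' [x' [col E]]]; exists c', x', 0; split=> //.
  by rewrite E mulr0 addr0.
have tr_rot i w0 : linking_transfer w0 (rot i w0).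
  apply: eq_tr => c x /(coloring_rot i)[y col _]; exists c, y; split=> //.
  exact: weight_rot.
case=> kd kd' mv; case: mv kd kd' => {w w'}.
- move=> i w _ _; split; first exact: tr_rot.
  rewrite -{2}(rotK i w); exact: tr_rot.
- move=> f w fi _ _; split; apply: eq_tr => c x col.
    by have [c' h _] := coloring_renameR fi col; exists c', x.
  by have [c' h _] := coloring_renameL col; exists c', x.
- move=> a o e w /andP[wf _] _; split; first exact: linking_transfer_R1_del.
  by apply: linking_transfer_R1_add; apply: fresh_R1 wf.
- move=> a b e s w1 w2 kd kd'; split; first exact: linking_transfer_R2_del.
  by case/andP: kd => /fresh_R2[ab aw bw] _; apply: linking_transfer_R2_add.
- move=> a b k ea eb ec sT sM sB w1 w2 w3 h1 h2 /andP[wf _] /andP[wf' _]; split.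
    exact: (@linking_transfer_R3 true).
  rewrite -[X in linking_transfer _ X](R3_word_rev true).
  by apply: (@linking_transfer_R3 true) => //; apply: R3_orders_rev.
- move=> a b k ea eb ec sT sM sB w1 w2 w3 h1 h2 /andP[wf _] /andP[wf' _]; split.
    exact: (@linking_transfer_R3 false).
  rewrite -[X in linking_transfer _ X](R3_word_rev false).
  by apply: (@linking_transfer_R3 false) => //; apply: R3_orders_rev.
Qed.

Lemma linking_nonresidue_isotopic w w' :
  isotopic w w' -> linking_nonresidue w <-> linking_nonresidue w'.
Proof.
apply: isotopic_ind => {}w {}w' /linking_transfer_move[h1 h2].
by split; apply: linking_transfer_nonresidue.
Qed.

End LinkingForm.

(** * One crossing change *)

Lemma intr_Zp_eq0 n (z : int) : (1 < n)%N -> (z%:~R == 0 :> 'Z_n) = (n%:Z %| z)%Z.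
Proof.
move=> n1.
have nat_case k : (k%:R == 0 :> 'Z_n) = (n %| k)%N.
  by rewrite -val_eqE /= val_Zp_nat.
by case: z => k; rewrite ?NegzE ?rmorphN ?oppr_eq0 /= -?pmulrn nat_case dvdzE ?abszN.
Qed.

Lemma chain_morph (A B : comNzRingType) (f : A -> B) c x w y :
  chain c x w y -> chain (fun k => (f (c k).1, f (c k).2)) (f x) w (f y).
Proof.
elim: w x => /= [|l w IH] x; first by move->.
by move=> [<- /IH].
Qed.

Lemma annihilates_int m w (N : int) c x : annihilates m w ->
  coloring (fun z => (N %| z)%Z) c x w ->
  {in w, forall l, (N %| ((c l.1).1 - x) * m%:Z)%Z}.
Proof.
move=> ann [ch ok] l lw.
(* ['Z_n] is the ring of integers modulo [n] only for [1 < n]. A unit [N] divides everything, and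
   for [N = 0] the coloring is taken in the integers. *)
have [N1|N1] := leqP `|N| 1.
  move: N1; rewrite leq_eqVlt ltnS leqn0 absz_eq0 => /orP[/eqP N1|/eqP N0].
    by rewrite dvdzE N1.
  have [] := ann _ c x _ l lw; last first.
    move=> e _; rewrite -[m%:Z]natz mulrBl !mulr_natr.
    by rewrite [X in (_ %| X)%Z](_ : _ = 0) ?dvdz0 //; apply/eqP; rewrite subr_eq0 e.
  split=> // a /ok[E]; rewrite N0 dvd0z => /eqP z0; by split.
pose n := `|N|%N.
have [] := ann 'Z_n (fun k => ((c k).1%:~R, (c k).2%:~R)) x%:~R _ l lw.
  split; first exact: (chain_morph (fun z : int => z%:~R : 'Z_n) ch).
  move=> a /ok[E S]; split; first by rewrite /= -!rmorphD E.
  by apply/eqP; rewrite /= -rmorphB intr_Zp_eq0 // dvdzE /= -dvdzE.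
move=> /= e _.
have : (((c l.1).1 - x) * m%:Z)%:~R == 0 :> 'Z_n.
  by rewrite rmorphM rmorphB /= -pmulrn mulrBl !mulr_natr subr_eq0 e.
by rewrite intr_Zp_eq0 // !dvdzE.
Qed.

(** The divisibility condition is primitivity in the form in which it is used. Reading the vector as
    the coefficients of a polynomial makes [v] the primitive part of that polynomial. *)
Lemma primitive_multiple m (u : 'rV[rat]_m) : u != 0 ->
  exists2 v : 'I_m -> int,
    forall N k : int, (forall i, (N %| k * v i)%Z) -> (N %| k)%Z &
    exists2 a : rat, a != 0 & forall i, u 0 i = a * (v i)%:~R.
Proof.
move=> u0; have [q [b b0 E]] := rat_poly_scale (rVpoly u).
have q0 : q != 0.
  apply: contraNneq u0 => q0; move: E; rewrite q0 rmorph0 scaler0 => /(congr1 (@poly_rV _ m)).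
  by rewrite rVpolyK linear0 => ->.
have c0 : zcontents q != 0 by rewrite zcontents_eq0.
pose v (i : 'I_m) := (zprimitive q)`_i.
have uE i : (rVpoly u)`_i = (b%:~R^-1 * (zcontents q)%:~R) * ((zprimitive q)`_i)%:~R.
  by rewrite E coefZ coef_map /= {1}(zpolyEprim q) coefZ rmorphM /= mulrA.
exists v; last first.
  exists (b%:~R^-1 * (zcontents q)%:~R); last by move=> i; rewrite -uE coef_rVpoly_ord.
  by rewrite mulf_neq0 ?invr_neq0 ?intr_eq0.
move=> N k h.
have : (N %| zcontents (k *: zprimitive q))%Z.
  rewrite dvdz_contents; apply/polyOverP => i; rewrite coefZ.
  case: (ltnP i m) => [lt|ge]; first exact: (h (Ordinal lt)).
  have := uE i; rewrite coef_rVpoly; case: insubP => [j|_].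
    by rewrite ltnNge ge.
  move/esym/eqP; rewrite !mulf_eq0 invr_eq0 !intr_eq0 (negPf b0) (negPf c0) /= => /eqP->.
  by rewrite mulr0; apply: dvdz0.
by rewrite zcontentsZ zcontents_primitive q0 mulr1.
Qed.

Section OneChange.

Variables (w : gauss_code) (X : nat).
Hypotheses (wf : well_formed w) (euler : size (faces w) = ((size w)./2 + 2)%N).
Hypothesis Xw : X \in crossings w.
Local Notation "''P'" := 'I_(size w).
Local Notation tw := (tw wf).

Lemma crossing_position : exists2 i : 'P, isover i & crossing_of (letter w i) = X.
Proof.
case/mapP: Xw => l lw ->.
have lt : (index l w < size w)%N by rewrite index_mem.
have el : letter w (Ordinal lt) = l by rewrite /letter /= nth_index.
case: (boolP (isover (Ordinal lt))) => h; first by exists (Ordinal lt); rewrite ?el.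
by exists (tw (Ordinal lt)); rewrite ?isover_tw //= letter_twin // el.
Qed.

Lemma over_position_unique (i j : 'P) : isover i -> isover j ->
  crossing_of (letter w i) = crossing_of (letter w j) -> i = j.
Proof.
move=> oi oj e; apply: val_inj.
have [k1 _] := letter_keys wf oi; have [k2 _] := letter_keys wf oj.
have /eqP := uniq_keys wf; move/eqP => U.
have : nth (0%N, false) [seq l.1 | l <- w] i = nth (0%N, false) [seq l.1 | l <- w] j.
  by rewrite !(nth_map (0%N, false, false)) // -/(letter w i) -/(letter w j) k1 k2 e.
by move/eqP; rewrite nth_uniq ?size_map // => /eqP.
Qed.

(** With [n] crossings there are [2n] labels. The crossing equations have rank at most [n - 1] by
    planarity, and so do the equations for over-jumps, because the one at [X] is omitted. The
    solutions thus have dimension at least 2, and a nonzero one remains after normalizing at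
    [i0]. *)
Lemma exceptional_solution (i0 : 'P) : val i0 = 0%N ->
  exists v : 'P -> int, [/\ v i0 = 0,
    forall N k : int, (forall i, (N %| k * v i)%Z) -> (N %| k)%Z,
    forall i, isover i -> v i + v (ordS i) = v (tw i) + v (ordS (tw i)) &
    forall i, isover i -> crossing_of (letter w i) != X -> v (ordS i) = v i].
Proof.
move=> i0E.
pose no := #|[pred i : 'P | isover i]|.
pose K := kirchhoff_mx wf rat.
pose pos := @over_position w.
pose D : 'M[rat]_(size w, no) := \matrix_(k, j)
  (if crossing_of (letter w (pos j)) == X then 0
   else (k == ordS (pos j))%:R - (k == pos j)%:R).
have rK : (\rank K < no)%N by apply: rank_kirchhoff_planar i0E euler.
have rD : (\rank D < no)%N.
  have [iX oX eX] := crossing_position.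
  have [jX ejX] := over_position_onto oX.
  have : (0 < \rank (kermx D^T))%N.
    rewrite lt0n mxrank_eq0; apply/negP => /eqP k0.
    have : ((delta_mx 0 jX : 'rV[rat]_no) <= kermx D^T)%MS.
      apply/sub_kermxP; rewrite -rowE; apply/rowP => k.
      by rewrite !mxE /pos -ejX eX eqxx.
    rewrite k0 submx0 => /eqP/matrixP/(_ 0 jX); rewrite !mxE !eqxx => /eqP.
    by rewrite oner_eq0.
  by rewrite mxrank_ker mxrank_tr subn_gt0.
pose M := row_mx K D.
have rM : (\rank M + 2 <= size w)%N.
  have : (\rank M <= \rank K + \rank D)%N.
    rewrite -mxrank_tr tr_row_mx -addsmxE -(mxrank_tr K) -(mxrank_tr D).
    exact: (mxrank_adds_leqif _ _).1.
  have aux (a b d n m : nat) : (a <= b + d -> b < n -> d < n -> n.*2 = m -> a + 2 <= m)%N by lia.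
  by move=> h; apply: aux h rK rD (double_card_isover wf).
pose z : 'cV[rat]_(size w) := delta_mx i0 0.
pose U := (kermx M :&: kermx z)%MS.
have : U != 0.
  rewrite -mxrank_eq0 -lt0n.
  have := mxrank_mul_ker (kermx M) z; rewrite mxrank_ker -/U.
  have := rank_leq_col (kermx M *m z).
  by move: rM; lia.
rewrite -nz_row_eq0; set u := nz_row U => u0.
have : (u <= U)%MS by apply: nz_row_sub.
rewrite sub_capmx => /andP[/sub_kermxP uM /sub_kermxP uz].
have [v vN [a a0 uE]] := primitive_multiple u0.
have cancel (t : int) : a * t%:~R = 0 -> t = 0.
  by move/eqP; rewrite mulf_eq0 (negPf a0) intr_eq0 => /eqP.
move: uM; rewrite mul_mx_row => uM.
have [uK uD] : u *m K = 0 /\ u *m D = 0.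
  by have := uM; rewrite -row_mx0 => /eq_row_mx.
exists v; split=> //.
- apply: cancel; rewrite -uE.
  have /matrixP/(_ 0 0) := uz; rewrite [RHS]mxE => <-.
  rewrite mxE (bigD1 i0) //= mxE !eqxx mulr1 big1 ?addr0 // => j /negPf nj.
  by rewrite mxE nj mulr0.
- move=> i oi; have [j ej] := over_position_onto oi.
  apply/eqP; rewrite -subr_eq0; apply/eqP; apply: cancel.
  have /rowP/(_ j) := uK; rewrite kirchhoffE -ej [RHS]mxE !uE => e.
  rewrite -[RHS]e rmorphB !rmorphD /=; ring.
- move=> i oi nX; have [j ej] := over_position_onto oi.
  apply/eqP; rewrite -subr_eq0; apply/eqP; apply: cancel.
  have /rowP/(_ j) := uD; rewrite [RHS]mxE => e; rewrite -[RHS]e mxE.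
  under eq_bigr => k _ do rewrite mxE /pos -ej (negPf nX) mulrBr.
  by rewrite sumrB !sum_delta !uE rmorphB mulrBr.
Qed.

End OneChange.

(** A crossing change keeps the labels of the edges and exchanges the two passages at [X]. *)
Definition swap_crossing (T : Type) (X : nat) (c : nat * bool -> T) (k : nat * bool) : T :=
  if k.1 == X then c (X, ~~ k.2) else c k.

Lemma swap_crossing_chain (A : comNzRingType) X (c : nat * bool -> A * A) x w y :
  chain c x w y -> chain (swap_crossing X c) x (change_crossing X w) y.
Proof.
elim: w x => [|l w IH] x //= [<- /IH h].
have -> : swap_crossing X c (if crossing_of l == X then (X, ~~ over l, ~~ positive l) else l).1
    = c l.1.
  rewrite /swap_crossing; case: l {h} => [[a o] e]; rewrite /crossing_of /over /=.
  by case: (eqVneq a X) => [->|/negPf ne] /=; rewrite ?eqxx ?negbK ?ne.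
by split.
Qed.

Lemma change_crossings X w : crossings (change_crossing X w) = crossings w.
Proof.
rewrite /crossings /change_crossing -map_comp; apply: eq_map => l /=.
by case: eqP => // <-.
Qed.

Lemma swap_crossing_coloring (A : comNzRingType) (S S' : A -> Prop) X c x w :
  coloring S c x w -> (forall a, a \in crossings w -> a != X -> S' ((c (a, true)).2 - (c (a,
    true)).1)) ->
  S' ((c (X, false)).2 - (c (X, false)).1) ->
  coloring S' (swap_crossing X c) x (change_crossing X w).
Proof.
move=> [ch ok] h hX; split; first exact: swap_crossing_chain.
move=> a; rewrite change_crossings => aw; have [E _] := ok _ aw.
rewrite /swap_crossing /=; case: (eqVneq a X) => [e|ne]; last by split=> //; apply: h.
by rewrite -e; split; [rewrite -E|rewrite e].
Qed.

Lemma chain_linear (A : comNzRingType) (c c' : nat * bool -> A * A) (t : A) x x' w y y' :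
  chain c x w y -> chain c' x' w y' ->
  chain (fun k => ((c k).1 - t * (c' k).1, (c k).2 - t * (c' k).2)) (x - t * x') w (y - t * y').
Proof.
elim: w x x' => /= [|l w IH] x x'; first by move=> -> ->.
by move=> [<- h] [<- h']; split=> //; apply: IH.
Qed.

Lemma change_crossing_mem X l w : l \in w ->
  exists2 l', l' \in change_crossing X w & forall T (c : nat * bool -> T), swap_crossing X c l'.1
    = c l.1.
Proof.
move=> lw; exists (if crossing_of l == X then (X, ~~ over l, ~~ positive l) else l).
  exact: (map_f (fun l => if crossing_of l == X then (X, ~~ over l, ~~ positive l) else l)).
move=> T c; rewrite /swap_crossing; case: l {lw} => [[a o] e]; rewrite /crossing_of /over /=.
by case: (eqVneq a X) => [->|/negPf ne] /=; rewrite ?eqxx ?negbK ?ne.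
Qed.

(* Let [v] solve all coloring equations except the one at [X], and let [D] and [y] be its
   jumps on the over- and the under-strand of [X].  Since the changed diagram has trivial
   first homology of the double cover, [y = +-1]; since [p] annihilates that of [w],
   [D] divides [p].  Modulo [p] every coloring is a multiple [t v] up to a constant, of
   weight [+- t^2 D y]. *)
Lemma no_one_change (p : nat) (w : gauss_code) (X : nat) :
  prime p -> (exists s k : int, s ^+ 2 + 1 = p%:Z * k) ->
  knot_diagram w -> X \in crossings w ->
  annihilates p w -> annihilates 1 (change_crossing X w) -> ~ linking_nonresidue p w.
Proof.
move=> pr [s [ks es]] /andP[wf pl] Xw annp ann1 [c [x [r [col wt nr]]]].
have lt : (0 < size w)%N by case: (w) Xw.
have euler := planar_euler pl lt.
pose i0 := Ordinal lt.
have [v [v0 vN vk vD]] := exceptional_solution wf euler Xw (i0 := i0) erefl.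
have [iX oX eX] := crossing_position wf Xw.
have [kX kX'] := letter_keys wf oX; rewrite eX in kX kX'.
pose y := v (ordS (tw wf iX)) - v (tw wf iX).
pose D := v (ordS iX) - v iX.
have [cv colv cvE] : exists2 cv, coloring (fun=> True) cv (v i0) w &
    forall i : 'I_(size w), cv (letter w i).1 = (v i, v (ordS i)).
  by apply: positions_coloring => // i oi; split=> //; apply: vk.
rewrite v0 in colv.
have cvX : cv (X, true) = (v iX, v (ordS iX)) by rewrite -kX cvE.
have cvX' : cv (X, false) = (v (tw wf iX), v (ordS (tw wf iX))) by rewrite -kX' cvE.
have cv_other a : a \in crossings w -> a != X -> (cv (a, true)).2 - (cv (a, true)).1 = 0.
  move=> aw aX; have [i oi ei] := crossing_position wf aw.
  have [k1 _] := letter_keys wf oi; rewrite -ei -k1 cvE /= vD ?subrr //.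
  by rewrite ei.
have at_pos (cc : nat * bool -> int * int) (P : int -> int -> Prop) :
    {in change_crossing X w, forall l, P (swap_crossing X cc l.1).1 (swap_crossing X cv l.1).1} ->
    forall i : 'I_(size w), P (cc (letter w i).1).1 (v i).
  move=> h i; have [l lw E] := change_crossing_mem X (letter_in (ltn_ord i)).
  by have := h l lw; rewrite !E cvE.
(* In the changed diagram [y] is the only possibly nonzero over-jump, so modulo [y] the labels [v]
   form a Fox coloring of it. Such a coloring is constant, hence 0 by the normalization, and
   primitivity of [v] gives that [y] divides 1. *)
have y1 : `|y|%N = 1%N.
  suff : (y %| 1)%Z by rewrite dvdz1 => /eqP.
  apply: vN => i; rewrite mul1r.
  apply: (at_pos cv (fun _ z => (y %| z)%Z)) => l lw.
  have colw : coloring (fun z => (y %| z)%Z) (swap_crossing X cv) 0 (change_crossing X w).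
    apply: (swap_crossing_coloring colv); last by rewrite cvX'.
    by move=> a aw aX; rewrite cv_other // dvdz0.
  by have := annihilates_int ann1 colw lw; rewrite mulr1 subr0.
have yy : y * y = 1.
  by move: y1; case: (y) => [[|[|n]]|[|n]].
(* The same argument for [w] itself: modulo [D] the labels [v] form a Fox coloring, which [p]
   kills. *)
have Dp : (D %| p%:Z)%Z.
  apply: vN => i.
  have colw : coloring (fun z => (D %| z)%Z) cv 0 w.
    case: colv => ch ok; split=> // a aw; have [E _] := ok a aw; split=> //.
    case: (eqVneq a X) => [->|aX]; first by rewrite cvX.
    by rewrite cv_other // dvdz0.
  by have := annihilates_int annp colw (letter_in (ltn_ord i)); rewrite cvE subr0 mulrC.
(* Since [y * y = 1], subtracting [t] times [v] removes the under-jump of [c] at [X]. Modulo [p] the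
   difference is then a Fox coloring of the changed diagram, hence constant. *)
pose t := y * ((c (X, false)).2 - (c (X, false)).1).
pose d (k : nat * bool) := ((c k).1 - t * (cv k).1, (c k).2 - t * (cv k).2).
have cvt (i : 'I_(size w)) : (p%:Z %| (c (letter w i).1).1 - t * v i - x)%Z.
  have cold : coloring (fun=> True) d x w.
    split; first by have := chain_linear t (proj1 col) (proj1 colv); rewrite mulr0 subr0.
    move=> a aw; have [E _] := proj2 col a aw; have [Ev _] := proj2 colv a aw.
    split=> //; rewrite /d /=.
    have -> : (c (a, true)).1 - t * (cv (a, true)).1 + ((c (a, true)).2 - t * (cv (a, true)).2) =
      (c (a, true)).1 + (c (a, true)).2 - t * ((cv (a, true)).1 + (cv (a, true)).2) by ring.
    by rewrite E Ev; ring.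
  have colw : coloring (fun z => (p%:Z %| z)%Z) (swap_crossing X d) x (change_crossing X w).
    apply: (swap_crossing_coloring cold).
      move=> a aw aX; rewrite /d /=.
      have -> : (c (a, true)).2 - t * (cv (a, true)).2 - ((c (a, true)).1 - t * (cv (a, true)).1) =
        ((c (a, true)).2 - (c (a, true)).1) - t * ((cv (a, true)).2 - (cv (a, true)).1) by ring.
      rewrite cv_other // mulr0 subr0.
      by have [_ [k ->]] := proj2 col a aw; apply: dvdz_mulr.
    rewrite /d /= cvX' /= -/y /t.
    set e := (c (X, false)).2; set e' := (c (X, false)).1.
    have -> : e - y * (e - e') * v (ordS (tw wf iX)) - (e' - y * (e - e') * v (tw wf iX)) =
      (e - e') * (1 - y * y) by rewrite /y; ring.
    by rewrite yy subrr mulr0 dvdz0.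
  move: i; apply: (at_pos c (fun a b => (p%:Z %| a - t * b - x)%Z)) => l lw.
  have := annihilates_int ann1 colw lw; rewrite mulr1.
  by rewrite /swap_crossing /d; case: ifP.
(* [g] agrees with the labels of [c] modulo [p], so it has the same weight modulo the square of [p];
   only the crossing [X] contributes to it. *)
pose g (i : 'I_(size w)) := t * v i + x.
have fc := coloring_positions wf col.
have fg (i : 'I_(size w)) : exists k, position_labels c i = g i + p%:Z * k.
  have /dvdzP[k ek] := cvt i; exists k; rewrite mulrC -ek /g /position_labels; ring.
have gc : position_coloring (dvd_by p) wf g.
  move=> i oi; split.
    by rewrite /g; have := vk i oi => e; rewrite addrACA -mulrDr e mulrDr addrACA.
  have [k ek] := fg i; have [k' ek'] := fg (ordS i); have [_ [k'' ek'']] := fc i oi.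
  exists (k'' - k' + k); rewrite ek ek' in ek''.
  by rewrite mulrDr mulrBr -ek''; ring.
have [k Ek] := position_weight_mod euler pr gc fc fg.
have gw : position_weight wf g = (if positive (letter w iX) then 1 else -1) * (t ^+ 2 * (D * y)).
  rewrite /position_weight (bigD1 iX) //= big1 ?addr0.
    by congr (_ * _); rewrite /g /D /y; ring.
  move=> i /andP[oi ne]; rewrite /g (vD i) //; last first.
    by apply: contraNneq ne => e; apply/eqP; apply: (over_position_unique wf) => //; rewrite e eX.
  by rewrite subrr mul0r mulr0.
have ptD : (p%:Z %| t * D)%Z.
  have [_ [k' ek]] := gc iX oX; apply/dvdzP; exists k'; rewrite [RHS]mulrC -ek /g /D; ring.
have p0 : p%:Z != 0 by case: (p) pr.
have rE : p%:Z * r = (if positive (letter w iX) then 1 else -1) * (t ^+ 2 * (D * y)) + p%:Z ^+ 2 *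
  k.
  by rewrite -wt (weight_positions wf (proj1 col)) Ek gw.
have sgn (u : int) : `|u|%N = 1%N -> u = 1 \/ u = -1.
  by case: u => [[|[|n]]|[|n]] // _; [left|right].
have eps : (if positive (letter w iX) then 1 else -1) = 1 :> int \/
    (if positive (letter w iX) then 1 else -1) = -1 :> int.
  by case: positive; [left|right].
(* A sign [-1] is absorbed by the square root [s] of [-1] modulo [p]. *)
have sq1 (sg : int) : sg = 1 \/ sg = -1 -> r = sg * t ^+ 2 + p%:Z * k -> False.
  move=> [-> E|-> E]; first by apply: (nr t k); rewrite E; ring.
  apply: (nr (s * t) (k - ks * t ^+ 2)); rewrite E.
  have -> : (s * t) ^+ 2 + p%:Z * (k - ks * t ^+ 2) = s ^+ 2 * t ^+ 2 + p%:Z * k - (p%:Z * ks) * t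
    ^+ 2 by ring.
  by rewrite -es; ring.
have /orP[/eqP D1|/eqP D1] : (`|D|%N == 1%N) || (`|D|%N == p).
  by apply: (primeP pr).2; move: Dp; rewrite dvdzE.
  (* If [D] is a unit, then [p] divides [t], and [r] is congruent to the square 0. *)
  have DD : D * D = 1 by have [->|->] := sgn _ D1.
  have /dvdzP[t' et] : (p%:Z %| t)%Z by rewrite -[t]mulr1 -DD mulrA dvdz_mulr.
  apply: (nr 0 ((if positive (letter w iX) then 1 else -1) * (t' ^+ 2 * (D * y)) + k)).
  by apply: (mulfI p0); rewrite rE et; ring.
(* If [D] is [p] up to sign, dividing the weight by [p] leaves [r] congruent to [t ^+ 2] up to
   sign. *)
have [d' [sd ed]] : exists d', (d' = 1 \/ d' = -1) /\ D = d' * p%:Z.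
  have [e|e] : D = p%:Z \/ D = - p%:Z.
    by move: D1; case: (D) => n /= <-; [left|right; rewrite NegzE].
    by exists 1; split; [left|rewrite e mul1r].
  by exists (-1); split; [right|rewrite e mulN1r].
apply: (sq1 ((if positive (letter w iX) then 1 else -1) * (d' * y))).
  by case: eps => ->; case: sd => ->; case: (sgn _ y1) => ->;
    [left|right|right|left|right|left|left|right].
by apply: (mulfI p0); rewrite rE ed; ring.
Qed.

Lemma unknotting_ge2 (p : nat) (w : gauss_code) :
  prime p -> (exists s k : int, s ^+ 2 + 1 = p%:Z * k) ->
  annihilates p w -> linking_nonresidue p w -> forall m, unknots_with m w -> (2 <= m)%N.
Proof.
move=> pr sq ann lk m um; case: um ann lk => {m w} [w iso|[|k] w w1 w2 iso [kd [X Xw ->]] un] ann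
  lk //.
  have [c [x [r [_ wt nr]]]] := (linking_nonresidue_isotopic pr iso).1 lk.
  (* On the empty code every weight vanishes, so [r = 0], which is a square. *)
  exfalso; apply: (nr 0 0); apply/eqP; rewrite expr0n mulr0 addr0.
  have p0 : p%:Z != 0 by case: (p) pr.
  by rewrite -(mulrI_eq0 _ (mulfI p0)) -wt weight_nil.
exfalso; apply: (no_one_change pr sq kd Xw).
- exact: (annihilates_isotopic p iso).1.
- have iso2 : isotopic (change_crossing X w1) unknot by inversion un.
  by apply: (annihilates_isotopic 1 iso2).2.
- exact: (linking_nonresidue_isotopic pr iso).1.
Qed.

(** * Lower bounds for 5_1 and 8_2 *)

Section Relations.

Variable A : comNzRingType.
Implicit Types (c : nat * bool -> A * A) (u v l r : A).

Lemma eq_by u v l r : l = r -> u - v = l - r -> u = v.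
Proof. by move=> -> /eqP; rewrite subrr subr_eq0 => /eqP. Qed.

Lemma eq_by_opp u v l r : l = r -> u - v = r - l -> u = v.
Proof. by move=> -> /eqP; rewrite subrr subr_eq0 => /eqP. Qed.

Lemma eq_by_mul u v l (k : int) : l = 0 -> u - v = l *~ k -> u = v.
Proof. by move=> -> /eqP; rewrite mul0rz subr_eq0 => /eqP. Qed.

Lemma labels_agree_all m c x w :
  foldr (fun (l : passage) P => ((c l.1).1 *+ m = x *+ m /\ (c l.1).2 *+ m = x *+ m) /\ P) True w ->
  labels_agree m c x w.
Proof.
elim: w => [|l w IH] //= [h /IH hw] l'; rewrite inE => /predU1P[->|] //; exact: hw.
Qed.

Lemma coloring_relations c w :
  {in crossings w, forall a, strands_ok (fun z => z = 0) (c (a, true)) (c (a, false))} ->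
  foldr (fun a P => ((c (a, true)).1 + (c (a, true)).2 = (c (a, false)).1 + (c (a, false)).2 /\
                     (c (a, true)).2 - (c (a, true)).1 = 0) /\ P) True (crossings w).
Proof.
elim: w => //= l w IH ok; split; first by apply: ok; rewrite mem_head.
by apply: IH => a aw; apply: ok; rewrite inE aw orbT.
Qed.

End Relations.

Ltac solve_relation H := by first [apply: (eq_by H); ring | apply: (eq_by_opp H); ring].

Ltac solve_label H v e := (have {}H : v = e by solve_relation H); subst v.

(** Elimination writes every label as [x + k (b3 - x)]; the last relation is [5 (b3 - x) = 0], with
    the determinant 5. The values [k] tried at the end are these coefficients. The three lemmas that
    follow have the same form. *)
Lemma annihilates_5_1 : annihilates 5 knot_5_1.
Proof.
move=> A c x [ch ok]; apply: labels_agree_all; move: (coloring_relations ok) ch.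
rewrite /=.
move: (c (1%N, true)) (c (2%N, false)) (c (3%N, true)) (c (4%N, false)) (c (5%N, true)) (c (1%N,
  false)) (c (2%N, true)) (c (3%N, false)) (c (4%N, true)) (c (5%N, false)) =>
  [a0 b0] [a1 b1] [a2 b2] [a3 b3] [a4 b4] [a5 b5] [a6 b6] [a7 b7] [a8 b8] [a9 b9] /=.
move=> [[s1 t1] [[s2 t2] [[s3 t3] [[s4 t4] [[s5 t5] [_ [_ [_ [_ [_ _]]]]]]]]]].
move=> [f0 [f1 [f2 [f3 [f4 [f5 [f6 [f7 [f8 [f9 f10]]]]]]]]]].
subst a0 a1 a2 a3 a4 a5 a6 a7 a8 a9 b9.
solve_label t1 b0 (x).
solve_label t5 b4 (b3).
solve_label s1 b5 (x *~ 2 + b3 *~ (-1)).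
solve_label t2 b6 (x *~ 2 + b3 *~ (-1)).
solve_label s5 b8 (x *~ (-1) + b3 *~ 2).
solve_label s2 b1 (x *~ 3 + b3 *~ (-2)).
solve_label t3 b2 (x *~ 3 + b3 *~ (-2)).
solve_label s4 b7 (x *~ 4 + b3 *~ (-3)).
have {}t4 : (b3 - x) *+ 5 = 0 by solve_relation t4.
do !split; by first [done | apply: (eq_by_mul (k := -3) t4); ring | apply: (eq_by_mul (k := -2)
  t4); ring | apply: (eq_by_mul (k := -1) t4); ring | apply: (eq_by_mul (k := 0) t4); ring |
  apply: (eq_by_mul (k := 1) t4); ring | apply: (eq_by_mul (k := 2) t4); ring].
Qed.

Lemma annihilates_mirror_5_1 : annihilates 5 (mirror knot_5_1).
Proof.
move=> A c x [ch ok]; apply: labels_agree_all; move: (coloring_relations ok) ch.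
rewrite /=.
move: (c (1%N, false)) (c (2%N, true)) (c (3%N, false)) (c (4%N, true)) (c (5%N, false)) (c (1%N,
  true)) (c (2%N, false)) (c (3%N, true)) (c (4%N, false)) (c (5%N, true)) =>
  [a0 b0] [a1 b1] [a2 b2] [a3 b3] [a4 b4] [a5 b5] [a6 b6] [a7 b7] [a8 b8] [a9 b9] /=.
move=> [[s1 t1] [[s2 t2] [[s3 t3] [[s4 t4] [[s5 t5] [_ [_ [_ [_ [_ _]]]]]]]]]].
move=> [f0 [f1 [f2 [f3 [f4 [f5 [f6 [f7 [f8 [f9 f10]]]]]]]]]].
subst a0 a1 a2 a3 a4 a5 a6 a7 a8 a9 b9.
solve_label t4 b3 (b2).
solve_label t5 b8 (x).
solve_label s4 b7 (x *~ (-1) + b2 *~ 2).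
solve_label s5 b4 (x *~ 2 + b2 *~ (-1)).
solve_label t1 b5 (x *~ 2 + b2 *~ (-1)).
solve_label t3 b6 (x *~ (-1) + b2 *~ 2).
solve_label s1 b0 (x *~ 3 + b2 *~ (-2)).
solve_label s2 b1 (x *~ (-2) + b2 *~ 3).
have {}t2 : (b2 - x) *+ 5 = 0 by solve_relation t2.
do !split; by first [done | apply: (eq_by_mul (k := -2) t2); ring | apply: (eq_by_mul (k := -1)
  t2); ring | apply: (eq_by_mul (k := 0) t2); ring | apply: (eq_by_mul (k := 1) t2); ring | apply:
  (eq_by_mul (k := 2) t2); ring | apply: (eq_by_mul (k := 3) t2); ring].
Qed.

Lemma annihilates_8_2 : annihilates 17 knot_8_2.
Proof.
move=> A c x [ch ok]; apply: labels_agree_all; move: (coloring_relations ok) ch.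
rewrite /=.
move: (c (1%N, false)) (c (2%N, true)) (c (3%N, false)) (c (4%N, true)) (c (5%N, false)) (c (7%N,
  true)) (c (8%N, false)) (c (1%N, true)) (c (2%N, false)) (c (3%N, true)) (c (4%N, false)) (c
  (5%N, true)) (c (6%N, false)) (c (8%N, true)) (c (7%N, false)) (c (6%N, true)) =>
  [a0 b0] [a1 b1] [a2 b2] [a3 b3] [a4 b4] [a5 b5] [a6 b6] [a7 b7] [a8 b8] [a9 b9] [a10 b10] [a11
    b11] [a12 b12] [a13 b13] [a14 b14] [a15 b15] /=.
move=> [[s1 t1] [[s2 t2] [[s3 t3] [[s4 t4] [[s5 t5] [[s7 t7] [[s8 t8] [_ [_ [_ [_ [_ [[s6 t6] [_
  [_ [_ _]]]]]]]]]]]]]]]].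
move=> [f0 [f1 [f2 [f3 [f4 [f5 [f6 [f7 [f8 [f9 [f10 [f11 [f12 [f13 [f14 [f15 f16]]]]]]]]]]]]]]]].
subst a0 a1 a2 a3 a4 a5 a6 a7 a8 a9 a10 a11 a12 a13 a14 a15 b15.
solve_label t6 b14 (x).
solve_label t7 b5 (b4).
solve_label s7 b13 (x *~ (-1) + b4 *~ 2).
solve_label t8 b12 (x *~ (-1) + b4 *~ 2).
solve_label s6 b11 (x *~ 3 + b4 *~ (-2)).
solve_label s8 b6 (x *~ (-2) + b4 *~ 3).
solve_label t1 b7 (x *~ (-2) + b4 *~ 3).
solve_label t5 b10 (x *~ 3 + b4 *~ (-2)).
solve_label s1 b0 (x *~ (-5) + b4 *~ 6).
solve_label t2 b1 (x *~ (-5) + b4 *~ 6).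
solve_label s5 b3 (x *~ 6 + b4 *~ (-5)).
solve_label s2 b8 (x *~ (-8) + b4 *~ 9).
solve_label t3 b9 (x *~ (-8) + b4 *~ 9).
solve_label s4 b2 (x *~ (-11) + b4 *~ 12).
have {}t4 : (b4 - x) *+ 17 = 0 by solve_relation t4.
do !split; by first [done | apply: (eq_by_mul (k := -5) t4); ring | apply: (eq_by_mul (k := -2)
  t4); ring | apply: (eq_by_mul (k := 0) t4); ring | apply: (eq_by_mul (k := 1) t4); ring | apply:
  (eq_by_mul (k := 2) t4); ring | apply: (eq_by_mul (k := 3) t4); ring | apply: (eq_by_mul (k :=
  6) t4); ring | apply: (eq_by_mul (k := 9) t4); ring | apply: (eq_by_mul (k := 12) t4); ring].
Qed.

Lemma annihilates_mirror_8_2 : annihilates 17 (mirror knot_8_2).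
Proof.
move=> A c x [ch ok]; apply: labels_agree_all; move: (coloring_relations ok) ch.
rewrite /=.
move: (c (1%N, true)) (c (2%N, false)) (c (3%N, true)) (c (4%N, false)) (c (5%N, true)) (c (7%N,
  false)) (c (8%N, true)) (c (1%N, false)) (c (2%N, true)) (c (3%N, false)) (c (4%N, true)) (c
  (5%N, false)) (c (6%N, true)) (c (8%N, false)) (c (7%N, true)) (c (6%N, false)) =>
  [a0 b0] [a1 b1] [a2 b2] [a3 b3] [a4 b4] [a5 b5] [a6 b6] [a7 b7] [a8 b8] [a9 b9] [a10 b10] [a11
    b11] [a12 b12] [a13 b13] [a14 b14] [a15 b15] /=.
move=> [[s1 t1] [[s2 t2] [[s3 t3] [[s4 t4] [[s5 t5] [[s7 t7] [[s8 t8] [_ [_ [_ [_ [_ [[s6 t6] [_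
  [_ [_ _]]]]]]]]]]]]]]]].
move=> [f0 [f1 [f2 [f3 [f4 [f5 [f6 [f7 [f8 [f9 [f10 [f11 [f12 [f13 [f14 [f15 f16]]]]]]]]]]]]]]]].
subst a0 a1 a2 a3 a4 a5 a6 a7 a8 a9 a10 a11 a12 a13 a14 a15 b15.
solve_label t1 b0 (x).
solve_label t8 b6 (b5).
solve_label s1 b7 (x *~ 2 + b5 *~ (-1)).
solve_label t2 b8 (x *~ 2 + b5 *~ (-1)).
solve_label s2 b1 (x *~ 3 + b5 *~ (-2)).
solve_label t3 b2 (x *~ 3 + b5 *~ (-2)).
solve_label s3 b9 (x *~ 4 + b5 *~ (-3)).
solve_label t4 b10 (x *~ 4 + b5 *~ (-3)).
solve_label s4 b3 (x *~ 5 + b5 *~ (-4)).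
solve_label t5 b4 (x *~ 5 + b5 *~ (-4)).
solve_label s5 b11 (x *~ 6 + b5 *~ (-5)).
solve_label t6 b12 (x *~ 6 + b5 *~ (-5)).
solve_label s8 b13 (x *~ (-6) + b5 *~ 7).
solve_label s6 b14 (x *~ 11 + b5 *~ (-10)).
have {}t7 : (b5 - x) *+ 17 = 0 by solve_relation t7.
do !split; by first [done | apply: (eq_by_mul (k := -10) t7); ring | apply: (eq_by_mul (k := -5)
  t7); ring | apply: (eq_by_mul (k := -4) t7); ring | apply: (eq_by_mul (k := -3) t7); ring |
  apply: (eq_by_mul (k := -2) t7); ring | apply: (eq_by_mul (k := -1) t7); ring | apply:
  (eq_by_mul (k := 0) t7); ring | apply: (eq_by_mul (k := 1) t7); ring | apply: (eq_by_mul (k :=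
  7) t7); ring].
Qed.

Section Certificates.

Fixpoint chainb (c : nat * bool -> int * int) (x : int) (w : gauss_code) (y : int) : bool :=
  if w is l :: w' then ((c l.1).1 == x) && chainb c (c l.1).2 w' y else x == y.

Lemma chainP c x w y : chainb c x w y -> chain c x w y.
Proof. by elim: w x => [|l w IH] x /=; [move/eqP|case/andP => /eqP-> /IH]. Qed.

Lemma weight_foldr (A : comNzRingType) (c : nat * bool -> A * A) w :
  weight c w = foldr (fun l s => (if over l then strands_weight (positive l)
    (c (crossing_of l, true)) (c (crossing_of l, false)) else 0) + s) 0 w.
Proof. by elim: w => [|l w IH]; rewrite ?weight_nil // weight_cons IH. Qed.

Lemma nonresidueP (p : nat) (r : int) : (0 < p)%N ->
  all (fun s : nat => ~~ (p%:Z %| r - s%:Z ^+ 2)%Z) (iota 0 p) ->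
  forall t z : int, r <> t ^+ 2 + p%:Z * z.
Proof.
move=> p0 /allP h t z E.
have p0' : p%:Z != 0 by case: (p) p0.
have m0 := modz_ge0 t p0'; have mp := ltz_pmod t (p0 : 0 < p%:Z).
have lt : `|(t %% p%:Z)%Z|%N \in iota 0 p by rewrite mem_iota /= add0n -ltz_nat gez0_abs.
apply: (negP (h _ lt)); rewrite gez0_abs // E {1}(divz_eq t p%:Z).
set q := (t %/ p%:Z)%Z; set u := (t %% p%:Z)%Z.
have -> : (q * p%:Z + u) ^+ 2 + p%:Z * z - u ^+ 2 = p%:Z * (q * q * p%:Z + q * u + q * u + z) by
  ring.
exact: dvdz_mulr.
Qed.

(* The i-th entry of [L] labels the edge that arrives at the i-th passage. *)
Definition edge_labels (w : gauss_code) (L : seq int) (k : nat * bool) : int * int :=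
  let i := index k [seq l.1 | l <- w] in (nth 0 L i, nth 0 L (i.+1 %% size L)).

Lemma linking_nonresidueP p w L (r : int) :
  (0 < p)%N -> let c := edge_labels w L in
  [&& chainb c (head 0 L) w (head 0 L),
      all (fun a => ((c (a, true)).1 + (c (a, true)).2 == (c (a, false)).1 + (c (a, false)).2) &&
        (p%:Z %| (c (a, true)).2 - (c (a, true)).1)%Z) (crossings w),
      foldr (fun l s => (if over l then strands_weight (positive l)
        (c (crossing_of l, true)) (c (crossing_of l, false)) else 0) + s) 0 w == p%:Z * r &
      all (fun s : nat => ~~ (p%:Z %| r - s%:Z ^+ 2)%Z) (iota 0 p)] ->
  linking_nonresidue p w.
Proof.
move=> p0 c /and4P[/chainP ch /allP ok /eqP wt nr].
exists c, (head 0 L), r; split; [split=> // a aw|by rewrite weight_foldr|exact: nonresidueP].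
have /andP[/eqP E /dvdzP[k ek]] := ok a aw.
by split=> //; exists k; rewrite mulrC.
Qed.

(** The values [-3] here and [-2] for the mirror image are congruent to 2 and 3, the nonresidues
    modulo 5. *)
Lemma linking_5_1 : linking_nonresidue 5 knot_5_1.
Proof. by apply: (@linking_nonresidueP _ _ [:: 4; 4; 3; 3; 2; 7; 1; 6; 0; 5] (-3)%Z); vm_compute.
  Qed.

Lemma linking_mirror_5_1 : linking_nonresidue 5 (mirror knot_5_1).
Proof. by apply: (@linking_nonresidueP _ _ [:: 0; 4; 4; 3; 3; 2; 2; 6; 1; 5] (-2)%Z); vm_compute.
  Qed.

(** The values [-7] here and [-10] for the mirror image are congruent to 10 and 7, nonresidues
    modulo 17. *)
Lemma linking_8_2 : linking_nonresidue 17 knot_8_2.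
Proof. by apply: (@linking_nonresidueP _ _ [:: 0; 20; 3; 23; 6; 26; 9; 10; 10; 13; 13; 16; 16; 1;
  18; 17] (-7)%Z); vm_compute. Qed.

Lemma linking_mirror_8_2 : linking_nonresidue 17 (mirror knot_8_2).
Proof. by apply: (@linking_nonresidueP _ _ [:: 2; 19; 5; 22; 8; 8; 26; 9; 12; 12; 15; 15; 1; 18;
  17; 17] (-10)%Z); vm_compute. Qed.

End Certificates.

Lemma sum_two_squares5 : exists s k : int, s ^+ 2 + 1 = 5%:Z * k.
Proof. by exists 2, 1. Qed.

Lemma sum_two_squares17 : exists s k : int, s ^+ 2 + 1 = 17%:Z * k.
Proof. by exists 4, 1. Qed.

Lemma unknotting_5_1_ge2 (b : bool) m :
  unknots_with m (if b then mirror knot_5_1 else knot_5_1) -> (2 <= m)%N.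
Proof.
apply: (@unknotting_ge2 5) => //; first exact: sum_two_squares5.
  by case: b; [apply: annihilates_mirror_5_1|apply: annihilates_5_1].
by case: b; [apply: linking_mirror_5_1|apply: linking_5_1].
Qed.

Lemma unknotting_8_2_ge2 (b : bool) m :
  unknots_with m (if b then mirror knot_8_2 else knot_8_2) -> (2 <= m)%N.
Proof.
apply: (@unknotting_ge2 17) => //; first exact: sum_two_squares17.
  by case: b; [apply: annihilates_mirror_8_2|apply: annihilates_8_2].
by case: b; [apply: linking_mirror_8_2|apply: linking_8_2].
Qed.

Local Close Scope ring_scope.

(** * Checking sequences of moves *)

Section FaceLabels.

Variables (w : gauss_code) (phi : nat * bool -> nat).
Hypothesis wf : well_formed w.
Hypothesis inv : {in sides w, forall x, phi (turn_left w x) = phi x}.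

Lemma face_label x : x \in sides w -> phi (face_of w x) = phi x.
Proof.
case/side_valP => s ->; have [s' -> /iter_findex <-] := face_of_rep wf s.
elim: (findex _ _ _) => //= k IH.
by rewrite -turn_left_val inv ?side_val_in.
Qed.

(** Distinct labels bound the number of faces from below, and [euler_bound] bounds it from above. So
    a labelling with enough values proves planarity. *)
Lemma labels_le_faces : size (undup [seq phi x | x <- sides w]) <= size (faces w).
Proof.
rewrite -(size_map phi (faces w)); apply: uniq_leq_size; first exact: undup_uniq.
move=> y; rewrite mem_undup => /mapP[x xs ->]; rewrite -(face_label xs).
by apply: map_f; case/side_valP: xs => s ->; apply: face_of_in.
Qed.

End FaceLabels.

(** The rank of a side in the list [sides]. *)
Definition side_index (x : nat * bool) : nat := x.1.*2 + ~~ x.2.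

Fixpoint label_orbit (fuel : nat) (next lab : seq nat) (k s : nat) : seq nat :=
  if fuel is fuel'.+1 then
    if nth 0 lab s == 0 then label_orbit fuel' next (set_nth 0 lab s k) k (nth 0 next s)
    else lab
  else lab.

Fixpoint label_orbits (todo next lab : seq nat) (k : nat) : seq nat :=
  if todo is s :: todo' then
    if nth 0 lab s == 0 then
      label_orbits todo' next (label_orbit (size next) next lab k s) k.+1
    else label_orbits todo' next lab k
  else lab.

(** Label 0 marks a side not yet visited, so labels start from 1. Each orbit is traversed once,
    whereas [faces] retraces it for every side. No correctness proof is given: [planar_check] tests
    what is used. *)
Definition face_labels (w : gauss_code) : seq nat :=
  let next := [seq side_index (turn_left w x) | x <- sides w] in
  label_orbits (iota 0 (size next)) next [::] 1.

Definition planar_check (w : gauss_code) : bool :=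
  let lab := face_labels w in
  ([seq nth 0 lab (side_index (turn_left w x)) | x <- sides w] ==
   [seq nth 0 lab (side_index x) | x <- sides w]) &&
  ((size w)./2 + 2 <= size (undup [seq nth 0 lab (side_index x) | x <- sides w])).

Lemma planar_checkP w : well_formed w -> planar_check w -> planar w.
Proof.
move=> wf /andP[/eqP/eq_in_map inv le].
case: (posnP (size w)) => [/size0nil->//|lt].
apply/orP; right; rewrite eqn_leq (@euler_bound _ wf rat (Ordinal lt) erefl) /=.
exact: leq_trans le (labels_le_faces wf inv).
Qed.

Definition diagram_check (w : gauss_code) : bool :=
  well_formed w && ((w == [::]) || planar_check w).

Lemma diagram_checkP w : diagram_check w -> knot_diagram w.
Proof.
by case/andP=> wf /orP[/eqP->//|pc]; apply/andP; split=> //; apply: planar_checkP.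
Qed.

(** Every step acts at the base point. The last numbers locate the other strands: after the first
    two passages in [R2del], in the old word in [R2add], and in the whole word in [R3], where the
    top strand comes first. *)
Inductive step : Type :=
| Rename of seq nat
| R1del
| R1add of nat & bool & bool
| R2del of nat
| R2add of nat & nat & bool & bool & nat
| R3 of nat & nat.

(** The default value [a] makes this the identity beyond the list. *)
Definition renaming (l : seq nat) (a : nat) : nat := nth a l a.

Definition some_if (T : Type) (b : bool) (x : T) : option T := if b then Some x else None.

Definition no_passage : passage := (0, false, false).

(** For [R3] the strands are guessed from the word, the middle one being the pair with an
    over-passage, and the comparison with [word] certifies the guess. That new crossings are fresh
    is left to [diagram_check] in [run]. *)
Definition apply_step (s : step) (w : gauss_code) : option gauss_code :=
  match s with
  | Rename l => some_if (perm_eq l (iota 0 (size l))) (rename (renaming l) w)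
  | R1del =>
    if w is l1 :: l2 :: w' then some_if (l2 == other_passage l1) w' else None
  | R1add a o e => Some [:: (a, o, e), (a, ~~ o, e) & w]
  | R2del q =>
    if w is l1 :: l2 :: w' then
      let a := crossing_of l1 in let b := crossing_of l2 in let e := positive l1 in
      let w1 := take q w' in let w2 := drop q.+2 w' in
      let s := crossing_of (nth no_passage w' q) == a in
      some_if (w == [:: (a, true, e); (b, true, ~~ e)] ++ w1 ++
                    in_order s (a, false, e) (b, false, ~~ e) ++ w2) (w1 ++ w2)
    else None
  | R2add a b e s q =>
    Some ([:: (a, true, e); (b, true, ~~ e)] ++ take q w ++
          in_order s (a, false, e) (b, false, ~~ e) ++ drop q w)
  | R3 p q =>
    let l i := nth no_passage w i in
    let mid := over (l p) || over (l p.+1) in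
    let m := if mid then p else q in
    let n := if mid then q else p in
    let sM := ~~ over (l m) in
    let la := if sM then l m else l m.+1 in
    let lk := if sM then l m.+1 else l m in
    let sT := crossing_of (l 0) == crossing_of la in
    let lb := if sT then l 1 else l 0 in
    let sB := crossing_of (l n) == crossing_of lb in
    let ea := positive la in let eb := positive lb in let ec := positive lk in
    let word sT sM sB := R3_word mid (crossing_of la) (crossing_of lb) (crossing_of lk)
      ea eb ec sT sM sB (drop 2 (take p w)) (drop p.+2 (take q w)) (drop q.+2 w) in
    some_if [&& (sM == ea) == (sB == eb), (sM == ec) == (sT == eb) & w == word sT sM sB]
      (word (~~ sT) (~~ sM) (~~ sB))
  end.

Lemma renaming_inj l : perm_eq l (iota 0 (size l)) -> injective (renaming l).
Proof.
move=> pl; have u : uniq l by rewrite (perm_uniq pl) iota_uniq.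
have inl a : (a \in l) = (a < size l) by rewrite (perm_mem pl) mem_iota.
have lt a : a < size l -> renaming l a < size l by move=> h; rewrite -inl mem_nth.
have ge a : size l <= a -> renaming l a = a by move=> h; rewrite /renaming nth_default.
move=> a b; case: (ltnP a (size l)) => ha; case: (ltnP b (size l)) => hb.
- by rewrite /renaming (set_nth_default 0) // [RHS](set_nth_default 0) // => /eqP; rewrite
  nth_uniq // => /eqP.
- by rewrite (ge b) // => e; have := lt a ha; rewrite e ltnNge hb.
- by rewrite (ge a) // => e; have := lt b hb; rewrite -e ltnNge ha.
- by rewrite !ge.
Qed.

Lemma some_ifP (T : Type) b (x y : T) : some_if b x = Some y -> b /\ y = x.
Proof. by case: b => // -[->]. Qed.

Lemma apply_stepP s w w' : apply_step s w = Some w' -> move w w' \/ move w' w.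
Proof.
case: s => [l||a o e|q|a b e s q|p q] /=.
- move=> h; have [pl ->] := some_ifP h; left.
  by apply: move_rename; apply: renaming_inj.
- case: w => [|[[a o] e] [|l w]] // h; have [/eqP-> ->] := some_ifP h; left; exact: move_R1.
- by case=> <-; right; apply: move_R1.
- case: w => [|l1 [|l2 w]] // h; have [/eqP-> ->] := some_ifP h; left; exact: move_R2.
- case=> <-; right; have := move_R2 a b e s (take q w) (drop q w).
  by rewrite cat_take_drop.
- move=> h; have [/and3P[/eqP h1 /eqP h2 /eqP E] ->] := some_ifP h; left.
  rewrite {1}E /R3_word; case: ifP h1 h2 {E h} => _ h1 h2.
    exact: move_R3_top_middle_bottom.
  exact: move_R3_top_bottom_middle.
Qed.

(* Each step is applied after moving the base point by the given number of passages. *)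
Fixpoint run (steps : seq (nat * step)) (w : gauss_code) : option gauss_code :=
  if steps is (i, s) :: steps' then
    if apply_step s (rot i w) is Some w' then
      if diagram_check (rot i w) && diagram_check w' then run steps' w' else None
    else None
  else Some w.

Lemma isotopic_trans w1 w2 w3 : isotopic w1 w2 -> isotopic w2 w3 -> isotopic w1 w3.
Proof. exact: rst_trans. Qed.

Lemma runP steps w w' : knot_diagram w -> run steps w = Some w' ->
  isotopic w w' /\ knot_diagram w'.
Proof.
elim: steps w => [|[i s] steps IH] w kd /=; first by case=> <-; split=> //; apply: rst_refl.
case E: apply_step => [v|] //; case: ifP => // /andP[/diagram_checkP kr /diagram_checkP kv].
case/(IH _ kv) => iso kd'; split=> //; apply: isotopic_trans iso.
apply: (@isotopic_trans _ (rot i w)); first by apply: rst_step; split=> //; apply: move_base_point.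
by case: (apply_stepP E) => mv; [|apply: rst_sym]; apply: rst_step.
Qed.

Fixpoint unknots_check (changes : seq (seq (nat * step) * nat)) (last : seq (nat * step))
    (w : gauss_code) : bool :=
  if changes is (steps, a) :: changes' then
    if run steps w is Some w1 then
      let w2 := change_crossing a w1 in
      [&& a \in crossings w1, diagram_check w2 & unknots_check changes' last w2]
    else false
  else run last w == Some unknot.

Lemma unknots_checkP changes last w :
  knot_diagram w -> unknots_check changes last w -> unknots_with (size changes) w.
Proof.
elim: changes w => [|[steps a] changes IH] w kd /=.
  by move/eqP => /(runP kd)[iso _]; apply: unknots_with0.
case E: run => [w1|] // /and3P[aw /diagram_checkP kd2 uc].
have [iso kd1] := runP kd E.
apply: unknots_withS iso _ (IH _ kd2 uc); split=> //.
by exists a.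
Qed.

(** * Explicit unknottings *)

Lemma unknots_5_1 : unknots_with 2 (knot_5_1).
Proof.
by apply: (@unknots_checkP [:: ([::], 1); ([::], 2)]
  [:: (1, R2del 3); (1, R2del 1); (0, R1del)]); first apply: diagram_checkP; vm_compute.
Qed.

Lemma unknots_mirror_5_1 : unknots_with 2 (mirror knot_5_1).
Proof.
by apply: (@unknots_checkP [:: ([::], 1); ([::], 2)]
  [:: (6, R2del 3); (1, R2del 1); (0, R1del)]); first apply: diagram_checkP; vm_compute.
Qed.

Lemma unknots_8_2 : unknots_with 2 (knot_8_2).
Proof.
by apply: (@unknots_checkP [:: ([::], 1); ([::], 6)]
  [:: (0, R2del 5); (7, R3 3 7); (1, R2del 5); (4, R2del 3); (1, R1del); (0, R1del)]); first
    apply: diagram_checkP; vm_compute.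
Qed.

Lemma unknots_mirror_8_2 : unknots_with 2 (mirror knot_8_2).
Proof.
by apply: (@unknots_checkP [:: ([::], 1); ([::], 6)]
  [:: (7, R2del 7); (5, R3 4 9); (5, R2del 3); (2, R1del); (0, R2del 1); (0, R1del)]); first
    apply: diagram_checkP; vm_compute.
Qed.

(* The j-th entry of [slides_i] leads from [sum_diagram false i j] to
   [sum_diagram false i j.+1]; it moves an arc of 8_2 across the summand 5_1. *)
Definition slides_0 : seq (seq (nat * step)) := [::
  [:: (17, R2add 0 1 true false 14); (1, R3 14 21); (0, R3 13 20); (0, R3 12 19); (0, R3 11 18);
    (0, R3 10 17); (29, R2del 15);
    (10, Rename [:: 0; 3; 2; 1; 4; 5; 6; 7; 8; 9; 10; 11; 12; 13; 14; 15; 16; 17])];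
  [:: (4, R2add 0 1 false true 13); (1, R3 6 15); (5, R3 9 23); (22, R3 7 17); (6, R3 11 23);
    (22, R3 6 20); (7, R2del 10);
    (20, Rename [:: 5; 1; 2; 3; 4; 0; 6; 7; 8; 9; 10; 11; 12; 13; 14; 15; 16; 17])];
  [:: (17, R2add 0 1 true false 14); (1, R3 14 21); (0, R3 13 20); (0, R3 12 19); (0, R3 11 18);
    (0, R3 10 17); (29, R2del 15);
    (10, Rename [:: 0; 7; 2; 3; 4; 5; 6; 1; 8; 9; 10; 11; 12; 13; 14; 15; 16; 17])];
  [:: (4, R2add 0 1 false true 13); (1, R3 6 15); (5, R3 9 23); (22, R3 7 17); (6, R3 11 23);
    (22, R3 6 20); (7, R2del 10);
    (20, Rename [:: 9; 1; 2; 3; 4; 5; 6; 7; 8; 0; 10; 11; 12; 13; 14; 15; 16; 17])];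
  [:: (17, R2add 0 1 true false 14); (1, R3 14 21); (0, R3 13 20); (0, R3 12 19); (0, R3 11 18);
    (0, R3 10 17); (29, R2del 15);
    (10, Rename [:: 0; 11; 2; 3; 4; 5; 6; 7; 8; 9; 10; 1; 12; 13; 14; 15; 16; 17])];
  [:: (4, R2add 0 1 true false 16); (1, R3 6 16); (5, R3 12 23); (22, R3 7 20); (6, R3 14 23);
    (22, R3 6 21); (7, R2del 13);
    (20, Rename [:: 15; 1; 2; 3; 4; 5; 6; 7; 8; 9; 10; 11; 12; 13; 14; 0; 16; 17])];
  [:: (17, R2add 0 1 true true 13); (1, R3 15 21); (29, R3 14 21); (0, R3 13 20); (0, R3 12 19);
    (0, R3 11 18); (1, R2del 14);
    (9, Rename [:: 17; 1; 2; 3; 4; 5; 6; 7; 8; 9; 10; 11; 12; 13; 14; 15; 16; 0])];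
  [:: (4, R2add 0 1 false true 15); (1, R3 6 17); (5, R3 11 23); (22, R3 7 19); (6, R3 13 23);
    (22, R3 6 22); (7, R2del 12);
    (20, Rename [:: 3; 1; 2; 0; 4; 5; 6; 7; 8; 9; 10; 11; 12; 13; 14; 15; 16; 17])];
  [:: (19, R2add 0 1 true false 12); (1, R3 12 19); (0, R3 11 18); (0, R3 10 17); (0, R3 9 16);
    (0, R3 8 15); (29, R2del 13);
    (8, Rename [:: 0; 5; 2; 3; 4; 1; 6; 7; 8; 9; 10; 11; 12; 13; 14; 15; 16; 17])];
  [:: (4, R2add 0 1 false true 15); (1, R3 6 17); (5, R3 11 23); (22, R3 7 19); (6, R3 13 23);
    (22, R3 6 22); (7, R2del 12);
    (20, Rename [:: 7; 1; 2; 3; 4; 5; 6; 0; 8; 9; 10; 11; 12; 13; 14; 15; 16; 17])];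
  [:: (19, R2add 0 1 true false 12); (1, R3 12 19); (0, R3 11 18); (0, R3 10 17); (0, R3 9 16);
    (0, R3 8 15); (29, R2del 13);
    (8, Rename [:: 0; 9; 2; 3; 4; 5; 6; 7; 8; 1; 10; 11; 12; 13; 14; 15; 16; 17])];
  [:: (4, R2add 0 1 false true 15); (1, R3 6 17); (5, R3 11 23); (22, R3 7 19); (6, R3 13 23);
    (22, R3 6 22); (7, R2del 12);
    (20, Rename [:: 11; 1; 2; 3; 4; 5; 6; 7; 8; 9; 10; 0; 12; 13; 14; 15; 16; 17])];
  [:: (13, R2add 0 1 true false 18); (1, R3 18 25); (0, R3 17 24); (0, R3 16 23); (0, R3 15 22);
    (0, R3 14 21); (29, R2del 19);
    (14, Rename [:: 0; 13; 2; 3; 4; 5; 6; 7; 8; 9; 10; 11; 12; 1; 14; 15; 16; 17])];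
  [:: (4, R2add 0 1 true false 16); (1, R3 6 16); (5, R3 12 23); (22, R3 7 20); (6, R3 14 23);
    (22, R3 6 21); (7, R2del 13);
    (20, Rename [:: 17; 1; 2; 3; 4; 5; 6; 7; 8; 9; 10; 11; 12; 13; 14; 15; 16; 0])];
  [:: (17, R2add 0 1 true true 13); (1, R3 15 21); (29, R3 14 21); (0, R3 13 20); (0, R3 12 19);
    (0, R3 11 18); (1, R2del 14);
    (9, Rename [:: 15; 1; 2; 3; 4; 5; 6; 7; 8; 9; 10; 11; 12; 13; 14; 0; 16; 17])]].

Definition slides_1 : seq (seq (nat * step)) := [::
  [:: (17, R2add 0 1 false true 13); (1, R3 15 21); (29, R3 14 21); (0, R3 13 20); (0, R3 12 19);
    (0, R3 11 18); (1, R2del 14);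
    (9, Rename [:: 3; 1; 2; 0; 4; 5; 6; 7; 8; 9; 10; 11; 12; 13; 14; 15; 16; 17])];
  [:: (4, R2add 0 1 false false 14); (7, R3 8 24); (22, R3 7 17); (6, R3 11 23); (22, R3 7 19);
    (5, R3 13 24); (1, R2del 11);
    (20, Rename [:: 5; 1; 2; 3; 4; 0; 6; 7; 8; 9; 10; 11; 12; 13; 14; 15; 16; 17])];
  [:: (17, R2add 0 1 false true 13); (1, R3 15 21); (29, R3 14 21); (0, R3 13 20); (0, R3 12 19);
    (0, R3 11 18); (1, R2del 14);
    (9, Rename [:: 7; 1; 2; 3; 4; 5; 6; 0; 8; 9; 10; 11; 12; 13; 14; 15; 16; 17])];
  [:: (4, R2add 0 1 false false 14); (7, R3 8 24); (22, R3 7 17); (6, R3 11 23); (22, R3 7 19);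
    (5, R3 13 24); (1, R2del 11);
    (20, Rename [:: 9; 1; 2; 3; 4; 5; 6; 7; 8; 0; 10; 11; 12; 13; 14; 15; 16; 17])];
  [:: (17, R2add 0 1 false true 13); (1, R3 15 21); (29, R3 14 21); (0, R3 13 20); (0, R3 12 19);
    (0, R3 11 18); (1, R2del 14);
    (9, Rename [:: 11; 1; 2; 3; 4; 5; 6; 7; 8; 9; 10; 0; 12; 13; 14; 15; 16; 17])];
  [:: (4, R2add 0 1 true true 15); (7, R3 11 24); (22, R3 7 18); (6, R3 12 23); (22, R3 7 20);
    (5, R3 16 24); (1, R2del 12);
    (20, Rename [:: 15; 1; 2; 3; 4; 5; 6; 7; 8; 9; 10; 11; 12; 13; 14; 0; 16; 17])];
  [:: (17, R2add 0 1 false false 14); (1, R3 14 21); (0, R3 13 20); (0, R3 12 19); (0, R3 11 18);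
    (0, R3 10 17); (29, R2del 15);
    (10, Rename [:: 0; 17; 2; 3; 4; 5; 6; 7; 8; 9; 10; 11; 12; 13; 14; 15; 16; 1])];
  [:: (4, R2add 0 1 false false 16); (7, R3 10 24); (22, R3 7 19); (6, R3 13 23); (22, R3 7 21);
    (5, R3 15 24); (1, R2del 13);
    (20, Rename [:: 3; 1; 2; 0; 4; 5; 6; 7; 8; 9; 10; 11; 12; 13; 14; 15; 16; 17])];
  [:: (19, R2add 0 1 false true 11); (1, R3 13 19); (29, R3 12 19); (0, R3 11 18); (0, R3 10 17);
    (0, R3 9 16); (1, R2del 12);
    (7, Rename [:: 5; 1; 2; 3; 4; 0; 6; 7; 8; 9; 10; 11; 12; 13; 14; 15; 16; 17])];
  [:: (4, R2add 0 1 false false 16); (7, R3 10 24); (22, R3 7 19); (6, R3 13 23); (22, R3 7 21);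
    (5, R3 15 24); (1, R2del 13);
    (20, Rename [:: 7; 1; 2; 3; 4; 5; 6; 0; 8; 9; 10; 11; 12; 13; 14; 15; 16; 17])];
  [:: (19, R2add 0 1 false true 11); (1, R3 13 19); (29, R3 12 19); (0, R3 11 18); (0, R3 10 17);
    (0, R3 9 16); (1, R2del 12);
    (7, Rename [:: 9; 1; 2; 3; 4; 5; 6; 7; 8; 0; 10; 11; 12; 13; 14; 15; 16; 17])];
  [:: (4, R2add 0 1 false false 16); (7, R3 10 24); (22, R3 7 19); (6, R3 13 23); (22, R3 7 21);
    (5, R3 15 24); (1, R2del 13);
    (20, Rename [:: 11; 1; 2; 3; 4; 5; 6; 7; 8; 9; 10; 0; 12; 13; 14; 15; 16; 17])];
  [:: (13, R2add 0 1 false true 17); (1, R3 19 25); (29, R3 18 25); (0, R3 17 24); (0, R3 16 23);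
    (0, R3 15 22); (1, R2del 18);
    (13, Rename [:: 13; 1; 2; 3; 4; 5; 6; 7; 8; 9; 10; 11; 12; 0; 14; 15; 16; 17])];
  [:: (4, R2add 0 1 true true 15); (7, R3 11 24); (22, R3 7 18); (6, R3 12 23); (22, R3 7 20);
    (5, R3 16 24); (1, R2del 12);
    (20, Rename [:: 17; 1; 2; 3; 4; 5; 6; 7; 8; 9; 10; 11; 12; 13; 14; 15; 16; 0])];
  [:: (17, R2add 0 1 false false 14); (1, R3 14 21); (0, R3 13 20); (0, R3 12 19); (0, R3 11 18);
    (0, R3 10 17); (29, R2del 15);
    (10, Rename [:: 0; 15; 2; 3; 4; 5; 6; 7; 8; 9; 10; 11; 12; 13; 14; 1; 16; 17])]].

(** Leads from [sum_diagram false 0 0] to [sum_diagram false 1 0]. This links the even and the odd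
    base points of 5_1, which [turn_5_1] does not mix. *)
Definition slide_summand : seq (nat * step) :=
  [:: (10, R2add 0 1 true false 22); (9, R2add 12 14 true false 16); (1, R3 16 25); (26, R3 9 24);
    (10, R3 14 25); (26, R3 9 22); (10, R3 12 25); (5, R3 6 30); (21, R3 12 20); (10, R3 9 25);
    (1, R2del 7); (21, R2del 13);
    (9, Rename [:: 2; 1; 0; 3; 4; 5; 6; 7; 8; 9; 10; 11; 12; 13; 14; 15; 16; 17])].

(** Three changes instead of the 2 + 2 of the separate summands. The first is made at a crossing
    created by an R2 move, the second at one created by an R1 move. The third, 10, is crossing 5 of
    5_1, whose names [connected_sum] doubles. *)
Definition sum_changes : seq (seq (nat * step) * nat) := [::
  ([:: (22, R2add 0 1 true false 10); (5, R3 6 26)], 0);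
  ([:: (19, R2add 12 14 true false 18); (33, R3 13 22); (12, R3 9 24); (33, R2del 7);
    (21, R1add 1 true false); (3, R3 14 21); (28, R3 2 12); (13, R3 20 30); (31, R1del);
    (6, R2add 2 13 false false 16); (13, R3 4 22); (23, R3 14 24); (1, R3 12 25); (33, R2del 23);
    (27, R3 6 18)], 1);
  ([::], 10)].

Definition sum_unknotting : seq (nat * step) :=
  [:: (26, R3 7 18); (0, R3 6 17); (20, R3 9 26); (8, R2del 15); (9, R3 18 22); (25, R3 8 24);
    (25, R1del); (8, R3 15 22); (23, R1del); (0, R3 8 15); (1, R2del 13); (11, R3 5 12);
    (4, R2del 5); (10, R3 3 8); (1, R2del 4); (9, R1del); (3, R2del 2); (1, R1del); (0, R1del)].

Definition mirror_slides_0 : seq (seq (nat * step)) := [::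
  [:: (4, R2add 0 1 true false 14); (7, R3 8 24); (22, R3 7 17); (6, R3 11 23); (22, R3 7 19);
    (5, R3 13 24); (1, R2del 11);
    (20, Rename [:: 3; 1; 2; 0; 4; 5; 6; 7; 8; 9; 10; 11; 12; 13; 14; 15; 16; 17])];
  [:: (17, R2add 0 1 true true 13); (1, R3 15 21); (29, R3 14 21); (0, R3 13 20); (0, R3 12 19);
    (0, R3 11 18); (1, R2del 14);
    (9, Rename [:: 5; 1; 2; 3; 4; 0; 6; 7; 8; 9; 10; 11; 12; 13; 14; 15; 16; 17])];
  [:: (4, R2add 0 1 true false 14); (7, R3 8 24); (22, R3 7 17); (6, R3 11 23); (22, R3 7 19);
    (5, R3 13 24); (1, R2del 11);
    (20, Rename [:: 7; 1; 2; 3; 4; 5; 6; 0; 8; 9; 10; 11; 12; 13; 14; 15; 16; 17])];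
  [:: (17, R2add 0 1 true true 13); (1, R3 15 21); (29, R3 14 21); (0, R3 13 20); (0, R3 12 19);
    (0, R3 11 18); (1, R2del 14);
    (9, Rename [:: 9; 1; 2; 3; 4; 5; 6; 7; 8; 0; 10; 11; 12; 13; 14; 15; 16; 17])];
  [:: (4, R2add 0 1 true false 14); (7, R3 8 24); (22, R3 7 17); (6, R3 11 23); (22, R3 7 19);
    (5, R3 13 24); (1, R2del 11);
    (20, Rename [:: 11; 1; 2; 3; 4; 5; 6; 7; 8; 9; 10; 0; 12; 13; 14; 15; 16; 17])];
  [:: (19, R2add 0 1 true false 12); (1, R3 12 19); (0, R3 11 18); (0, R3 10 17); (0, R3 9 16);
    (0, R3 8 15); (29, R2del 13);
    (8, Rename [:: 0; 15; 2; 3; 4; 5; 6; 7; 8; 9; 10; 11; 12; 13; 14; 1; 16; 17])];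
  [:: (4, R2add 0 1 false true 13); (7, R3 9 24); (22, R3 7 16); (6, R3 10 23); (22, R3 7 18);
    (5, R3 14 24); (1, R2del 10);
    (20, Rename [:: 17; 1; 2; 3; 4; 5; 6; 7; 8; 9; 10; 11; 12; 13; 14; 15; 16; 0])];
  [:: (19, R2add 0 1 true true 11); (1, R3 13 19); (29, R3 12 19); (0, R3 11 18); (0, R3 10 17);
    (0, R3 9 16); (1, R2del 12);
    (7, Rename [:: 3; 1; 2; 0; 4; 5; 6; 7; 8; 9; 10; 11; 12; 13; 14; 15; 16; 17])];
  [:: (4, R2add 0 1 true false 16); (7, R3 10 24); (22, R3 7 19); (6, R3 13 23); (22, R3 7 21);
    (5, R3 15 24); (1, R2del 13);
    (20, Rename [:: 5; 1; 2; 3; 4; 0; 6; 7; 8; 9; 10; 11; 12; 13; 14; 15; 16; 17])];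
  [:: (19, R2add 0 1 true true 11); (1, R3 13 19); (29, R3 12 19); (0, R3 11 18); (0, R3 10 17);
    (0, R3 9 16); (1, R2del 12);
    (7, Rename [:: 7; 1; 2; 3; 4; 5; 6; 0; 8; 9; 10; 11; 12; 13; 14; 15; 16; 17])];
  [:: (4, R2add 0 1 true false 16); (7, R3 10 24); (22, R3 7 19); (6, R3 13 23); (22, R3 7 21);
    (5, R3 15 24); (1, R2del 13);
    (20, Rename [:: 9; 1; 2; 3; 4; 5; 6; 7; 8; 0; 10; 11; 12; 13; 14; 15; 16; 17])];
  [:: (19, R2add 0 1 true true 11); (1, R3 13 19); (29, R3 12 19); (0, R3 11 18); (0, R3 10 17);
    (0, R3 9 16); (1, R2del 12);
    (7, Rename [:: 11; 1; 2; 3; 4; 5; 6; 7; 8; 9; 10; 0; 12; 13; 14; 15; 16; 17])];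
  [:: (4, R2add 0 1 true false 10); (7, R3 4 24); (22, R3 7 13); (6, R3 7 23); (22, R3 7 15);
    (5, R3 9 24); (1, R2del 7);
    (20, Rename [:: 13; 1; 2; 3; 4; 5; 6; 7; 8; 9; 10; 11; 12; 0; 14; 15; 16; 17])];
  [:: (19, R2add 0 1 true false 12); (1, R3 12 19); (0, R3 11 18); (0, R3 10 17); (0, R3 9 16);
    (0, R3 8 15); (29, R2del 13);
    (8, Rename [:: 0; 17; 2; 3; 4; 5; 6; 7; 8; 9; 10; 11; 12; 13; 14; 15; 16; 1])];
  [:: (4, R2add 0 1 false true 13); (7, R3 9 24); (22, R3 7 16); (6, R3 10 23); (22, R3 7 18);
    (5, R3 14 24); (1, R2del 10);
    (20, Rename [:: 15; 1; 2; 3; 4; 5; 6; 7; 8; 9; 10; 11; 12; 13; 14; 0; 16; 17])]].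

Definition mirror_slides_1 : seq (seq (nat * step)) := [::
  [:: (4, R2add 0 1 true true 13); (1, R3 6 15); (5, R3 9 23); (22, R3 7 17); (6, R3 11 23);
    (22, R3 6 20); (7, R2del 10);
    (20, Rename [:: 3; 1; 2; 0; 4; 5; 6; 7; 8; 9; 10; 11; 12; 13; 14; 15; 16; 17])];
  [:: (17, R2add 0 1 false false 14); (1, R3 14 21); (0, R3 13 20); (0, R3 12 19); (0, R3 11 18);
    (0, R3 10 17); (29, R2del 15);
    (10, Rename [:: 0; 5; 2; 3; 4; 1; 6; 7; 8; 9; 10; 11; 12; 13; 14; 15; 16; 17])];
  [:: (4, R2add 0 1 true true 13); (1, R3 6 15); (5, R3 9 23); (22, R3 7 17); (6, R3 11 23);
    (22, R3 6 20); (7, R2del 10);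
    (20, Rename [:: 7; 1; 2; 3; 4; 5; 6; 0; 8; 9; 10; 11; 12; 13; 14; 15; 16; 17])];
  [:: (17, R2add 0 1 false false 14); (1, R3 14 21); (0, R3 13 20); (0, R3 12 19); (0, R3 11 18);
    (0, R3 10 17); (29, R2del 15);
    (10, Rename [:: 0; 9; 2; 3; 4; 5; 6; 7; 8; 1; 10; 11; 12; 13; 14; 15; 16; 17])];
  [:: (4, R2add 0 1 true true 13); (1, R3 6 15); (5, R3 9 23); (22, R3 7 17); (6, R3 11 23);
    (22, R3 6 20); (7, R2del 10);
    (20, Rename [:: 11; 1; 2; 3; 4; 5; 6; 7; 8; 9; 10; 0; 12; 13; 14; 15; 16; 17])];
  [:: (19, R2add 0 1 false true 11); (1, R3 13 19); (29, R3 12 19); (0, R3 11 18); (0, R3 10 17);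
    (0, R3 9 16); (1, R2del 12);
    (7, Rename [:: 15; 1; 2; 3; 4; 5; 6; 7; 8; 9; 10; 11; 12; 13; 14; 0; 16; 17])];
  [:: (4, R2add 0 1 false false 14); (1, R3 6 14); (5, R3 10 23); (22, R3 7 18); (6, R3 12 23);
    (22, R3 6 19); (7, R2del 11);
    (20, Rename [:: 17; 1; 2; 3; 4; 5; 6; 7; 8; 9; 10; 11; 12; 13; 14; 15; 16; 0])];
  [:: (19, R2add 0 1 false false 12); (1, R3 12 19); (0, R3 11 18); (0, R3 10 17); (0, R3 9 16);
    (0, R3 8 15); (29, R2del 13);
    (8, Rename [:: 0; 3; 2; 1; 4; 5; 6; 7; 8; 9; 10; 11; 12; 13; 14; 15; 16; 17])];
  [:: (4, R2add 0 1 true true 15); (1, R3 6 17); (5, R3 11 23); (22, R3 7 19); (6, R3 13 23);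
    (22, R3 6 22); (7, R2del 12);
    (20, Rename [:: 5; 1; 2; 3; 4; 0; 6; 7; 8; 9; 10; 11; 12; 13; 14; 15; 16; 17])];
  [:: (19, R2add 0 1 false false 12); (1, R3 12 19); (0, R3 11 18); (0, R3 10 17); (0, R3 9 16);
    (0, R3 8 15); (29, R2del 13);
    (8, Rename [:: 0; 7; 2; 3; 4; 5; 6; 1; 8; 9; 10; 11; 12; 13; 14; 15; 16; 17])];
  [:: (4, R2add 0 1 true true 15); (1, R3 6 17); (5, R3 11 23); (22, R3 7 19); (6, R3 13 23);
    (22, R3 6 22); (7, R2del 12);
    (20, Rename [:: 9; 1; 2; 3; 4; 5; 6; 7; 8; 0; 10; 11; 12; 13; 14; 15; 16; 17])];
  [:: (19, R2add 0 1 false false 12); (1, R3 12 19); (0, R3 11 18); (0, R3 10 17); (0, R3 9 16);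
    (0, R3 8 15); (29, R2del 13);
    (8, Rename [:: 0; 11; 2; 3; 4; 5; 6; 7; 8; 9; 10; 1; 12; 13; 14; 15; 16; 17])];
  [:: (4, R2add 0 1 true true 9); (1, R3 6 11); (5, R3 5 23); (22, R3 7 13); (6, R3 7 23);
    (22, R3 6 16); (7, R2del 6);
    (20, Rename [:: 13; 1; 2; 3; 4; 5; 6; 7; 8; 9; 10; 11; 12; 0; 14; 15; 16; 17])];
  [:: (19, R2add 0 1 false true 11); (1, R3 13 19); (29, R3 12 19); (0, R3 11 18); (0, R3 10 17);
    (0, R3 9 16); (1, R2del 12);
    (7, Rename [:: 17; 1; 2; 3; 4; 5; 6; 7; 8; 9; 10; 11; 12; 13; 14; 15; 16; 0])];
  [:: (4, R2add 0 1 false false 14); (1, R3 6 14); (5, R3 10 23); (22, R3 7 18); (6, R3 12 23);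
    (22, R3 6 19); (7, R2del 11);
    (20, Rename [:: 15; 1; 2; 3; 4; 5; 6; 7; 8; 9; 10; 11; 12; 13; 14; 0; 16; 17])]].

Definition mirror_slide_summand : seq (nat * step) :=
  [:: (5, R2add 0 1 true false 12); (1, R2add 12 14 true false 22); (1, R3 13 22); (1, R3 20 25);
    (32, R3 13 25); (1, R2del 23); (29, R3 10 19); (0, R3 9 18); (0, R3 8 17); (0, R3 7 16);
    (0, R3 6 15); (29, R2del 13);
    (22, Rename [:: 0; 2; 1; 3; 4; 5; 6; 7; 8; 9; 10; 11; 12; 13; 14; 15; 16; 17])].

Definition mirror_sum_changes : seq (seq (nat * step) * nat) := [::
  ([:: (6, R2add 0 1 true false 16); (29, R3 20 24)], 1);
  ([:: (1, R2add 12 14 true false 12); (1, R3 12 25); (33, R3 15 25); (33, R2del 23);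
    (14, R1add 0 false true); (24, R3 11 25); (9, R3 10 30); (9, R3 2 22); (1, R1del);
    (22, R2add 2 13 false false 14); (33, R3 18 30); (9, R3 10 24); (23, R3 13 22); (12, R2del 7);
    (10, R3 12 24)], 0);
  ([::], 10)].

Definition mirror_sum_unknotting : seq (nat * step) :=
  [:: (8, R3 12 19); (18, R3 11 24); (10, R3 4 13); (29, R2del 11); (16, R3 4 22); (1, R3 2 10);
    (1, R1del); (6, R3 2 17); (1, R1del); (8, R3 7 14); (8, R2del 5); (10, R3 6 11);
    (17, R2del 9); (8, R3 5 11); (4, R2del 6); (5, R1del); (7, R2del 2); (1, R1del); (0, R1del)].

(** The rotation of 5_1 by two passages, which sends its crossing [k] to [k + 2] modulo 5; in the
    sum the names of 5_1 are doubled. It serves both mirror images. *)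
Definition turn_5_1 : seq (nat * step) := [:: (0, Rename [:: 0; 1; 6; 3; 8; 5; 10; 7; 2; 9; 4; 11;
  12; 13; 14; 15; 16; 17])].

Definition sum_diagram (b : bool) (i j : nat) : gauss_code :=
  connected_sum (rot i (if b then mirror knot_5_1 else knot_5_1))
                (rot j (if b then mirror knot_8_2 else knot_8_2)).

Lemma unknots_with_isotopic k w w' : isotopic w w' -> unknots_with k w -> unknots_with k w'.
Proof.
move=> + u; case: k w / u => [w|k w w1 w2] iso1 => [|cc u] iso.
  by apply: unknots_with0; apply: isotopic_trans iso1; apply: rst_sym.
by apply: unknots_withS cc u; apply: isotopic_trans iso1; apply: rst_sym.
Qed.

Lemma unknots_with_run k steps w w' : diagram_check w -> run steps w == Some w' ->
  unknots_with k w -> unknots_with k w'.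
Proof.
by move=> /diagram_checkP kd /eqP h; apply: unknots_with_isotopic; have [] := runP kd h.
Qed.

Lemma sum_diagram_check b : all (fun i => all (fun j => diagram_check (sum_diagram b i j))
  (iota 0 16)) (iota 0 10).
Proof. by case: b; vm_compute. Qed.

Lemma turn_5_1_check b : all (fun i => all (fun j =>
    run turn_5_1 (sum_diagram b i j) == Some (sum_diagram b i.+2 j)) (iota 0 16)) (iota 0 8).
Proof. by case: b; vm_compute. Qed.

Definition all_slides (b : bool) (i : nat) : seq (seq (nat * step)) :=
  if b then if i == 0 then mirror_slides_0 else mirror_slides_1
  else if i == 0 then slides_0 else slides_1.

Lemma slides_check b : all (fun i => all (fun j =>
    run (nth [::] (all_slides b i) j) (sum_diagram b i j) == Some (sum_diagram b i j.+1))
  (iota 0 15)) (iota 0 2).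
Proof. by case: b; vm_compute. Qed.

Lemma all_iotaP (p : pred nat) n : reflect (forall i, i < n -> p i) (all p (iota 0 n)).
Proof.
apply: (iffP allP) => h i; first by move=> lt; apply: h; rewrite mem_iota.
by rewrite mem_iota => lt; apply: h.
Qed.

Lemma sum_diagram_checkP b i j : i < 10 -> j < 16 -> diagram_check (sum_diagram b i j).
Proof. by move=> hi hj; have /all_iotaP/(_ i hi)/all_iotaP/(_ j hj) := sum_diagram_check b. Qed.

Lemma unknots_sum_0_0 b : unknots_with 3 (sum_diagram b 0 0).
Proof.
have kd := diagram_checkP (sum_diagram_checkP b (isT : 0 < 10) (isT : 0 < 16)).
case: b kd => kd.
  by apply: (@unknots_checkP mirror_sum_changes mirror_sum_unknotting) kd _; vm_compute.
by apply: (@unknots_checkP sum_changes sum_unknotting) kd _; vm_compute.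
Qed.

Lemma unknots_sum_1_0 b : unknots_with 3 (sum_diagram b 1 0).
Proof.
apply: (@unknots_with_run _ (if b then mirror_slide_summand else slide_summand)
  _ _ _ _ (unknots_sum_0_0 b)); first exact: sum_diagram_checkP.
by case: b; vm_compute.
Qed.

(** Leaves 10 times 16 pairs of base points to be checked, as an oversized rotation is the
    identity. *)
Lemma rot_reduce (T : Type) (s : seq T) i : rot i s = rot (if i < size s then i else 0) s.
Proof. by case: ltnP => // le; rewrite rot0 rot_oversize. Qed.

Lemma unknots_sum_small b i j : i < 2 -> j < 16 -> unknots_with 3 (sum_diagram b i j).
Proof.
move=> lt; elim: j => [|j IH] hj.
  by case: i lt => [|[|]] // _; [apply: unknots_sum_0_0|apply: unknots_sum_1_0].
have /all_iotaP/(_ i lt)/all_iotaP/(_ j hj) h := slides_check b.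
apply: unknots_with_run h (IH (ltnW hj)); apply: sum_diagram_checkP; last exact: ltnW.
exact: leq_trans lt _.
Qed.

Lemma unknots_sum b i j : unknots_with 3 (sum_diagram b i j).
Proof.
rewrite /sum_diagram rot_reduce [rot j _]rot_reduce -/(sum_diagram b _ _).
rewrite (_ : size _ = 10); last by case: b.
rewrite (_ : size _ = 16); last by case: b.
set i' := if i < 10 then i else 0; set j' := if j < 16 then j else 0.
have hi : i' < 10 by rewrite /i'; case: ifP.
have hj : j' < 16 by rewrite /j'; case: ifP.
(* The symmetry of 5_1 lowers the base point by two until it is 0 or 1. *)
elim/ltn_ind: i' hi => {}i IH hi.
have [lt|ge] := ltnP i 2; first exact: unknots_sum_small.
case: i ge hi IH => [|[|i]] // _ hi IH.
have /all_iotaP/(_ i hi)/all_iotaP/(_ j' hj) h := turn_5_1_check b.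
have lti := ltnW (ltnW hi).
by apply: unknots_with_run h (IH _ _ lti); [apply: sum_diagram_checkP|apply: ltnW].
Qed.

Local Open Scope ring_scope.

(** * Signatures *)

Section Sylvester.

Variable n : nat.
Implicit Types (S P : 'M[rat]_n) (s : int).

Lemma has_signatureN S s : has_signature S s -> has_signature (- S) (- s).
Proof.
case=> P [d [Pu PS ->]]; exists P, (- d); split=> //.
  by rewrite mulmxN mulNmx PS; apply/matrixP=> i j; rewrite !mxE mulNrn.
by rewrite -sumrN; apply: eq_bigr => i _; rewrite mxE sgzN.
Qed.

Lemma diag_form (y d : 'rV[rat]_n) :
  (y *m diag_mx d *m y^T) 0 0 = \sum_i d 0 i * y 0 i ^+ 2.
Proof.
rewrite mxE; apply: eq_bigr => i _; rewrite mul_mx_diag !mxE; ring.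
Qed.

(** If fewer than [k] diagonal entries were positive, some nonzero vector of the subspace would have
    zero coordinates at all of them, and its form would be nonpositive. So at least [k] entries,
    more than half, are positive. *)
Lemma signature_positive_subspace S s k (Q : 'M[rat]_(k, n)) :
  has_signature S s -> (n < k.*2)%N ->
  (forall u : 'rV[rat]_k, u != 0 -> 0 < (u *m Q *m S *m (u *m Q)^T) 0 0) -> 0 < s.
Proof.
case=> P [d [Pu PS ->]] lt pos.
pose p := [pred i | 0 < d 0 i].
have kp : (k <= #|p|)%N.
  rewrite leqNgt; apply/negP => ltp.
  pose Y := Q *m invmx P; pose Z := colsub (@enum_val _ p) Y.
  have : kermx Z != 0.
    rewrite -mxrank_eq0 mxrank_ker -lt0n subn_gt0.
    exact: leq_ltn_trans (rank_leq_col _) ltp.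
  case/rowV0Pn => u /sub_kermxP uZ u0.
  have := pos u u0; rewrite ltNge => /negP; apply.
  have -> : u *m Q = u *m Y *m P by rewrite mulmxA mulmxKV.
  set y := u *m Y.
  have -> : y *m P *m S *m (y *m P)^T = y *m diag_mx d *m y^T.
    by rewrite trmx_mul -PS !mulmxA.
  rewrite diag_form; apply: sumr_le0 => i _.
  have [di|di] := ltP 0 (d 0 i); last by rewrite mulr_le0_ge0 ?sqr_ge0.
  have ip : i \in p by [].
  have /rowP/(_ (enum_rank_in ip i)) := uZ.
  rewrite mulmx_colsub !mxE enum_rankK_in // => y0.
  by rewrite y0 expr0n mulr0.
have card_p : (#|p|%:Z = \sum_(i < n) (i \in p : nat)%:Z).
  by rewrite -sum1_card big_mkcond /= (big_morph Posz PoszD (erefl _)).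
have card_n : n%:Z = \sum_(i < n) 1 by rewrite sumr_const card_ord; lia.
have : #|p|%:Z *+ 2 - n%:Z <= \sum_(i < n) sgz (d 0 i).
  rewrite card_p card_n -sumrMnl -sumrB; apply: ler_sum => i _.
  by rewrite inE; case: sgzP.
by apply: lt_le_trans; lia.
Qed.

End Sylvester.

Section SeifertForm.

Variables (w : gauss_code) (X : nat * bool -> rat).
Hypothesis wf : well_formed w.

Definition crossing_sign (i : nat) : rat := if positive (letter w i) then 1 else -1.

Definition top_face (i : nat) := face_of w (next_position w i, true).
Definition bottom_face (i : nat) := face_of w (twin w i, true).
Definition left_face (i : nat) := face_of w (i, true).

Lemma adjacent_faces i : (i < size w)%N ->
  [/\ top_face i \in faces w, bottom_face i \in faces w & left_face i \in faces w].
Proof.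
move=> lt; rewrite /top_face /bottom_face /left_face.
have in_faces j : (j < size w)%N -> face_of w (j, true) \in faces w.
  by move=> ltj; apply: (face_of_in wf (Ordinal ltj, true)).
by split; apply: in_faces; rewrite ?twin_lt // ltn_mod; apply: leq_ltn_trans lt.
Qed.

Lemma sum_at_face f : f \in faces w ->
  \sum_(a < size (faces w)) X (nth (0%N, true) (faces w) a) * (f == nth (0%N, true) (faces w)
    a)%:R = X f.
Proof.
move=> fw; have lt : (index f (faces w) < size (faces w))%N by rewrite index_mem.
rewrite (bigD1 (Ordinal lt)) //= nth_index // eqxx mulr1 big1 ?addr0 // => a ne.
case: eqP => [e|]; last by rewrite mulr0.
by case/eqP: ne; apply: val_inj; rewrite /= e index_uniq // uniq_faces.
Qed.

Lemma sum_at_faces f g : f \in faces w -> g \in faces w ->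
  \sum_(a < size (faces w)) \sum_(b < size (faces w))
    X (nth (0%N, true) (faces w) a) * X (nth (0%N, true) (faces w) b) *
    ((f == nth (0%N, true) (faces w) a) && (g == nth (0%N, true) (faces w) b))%:R = X f * X g.
Proof.
move=> fw gw; rewrite -(sum_at_face fw) -(sum_at_face gw) mulr_suml.
apply: eq_bigr => a _; rewrite mulr_sumr; apply: eq_bigr => b _.
by rewrite -mulnb natrM; ring.
Qed.

Definition face_row : 'rV[rat]_(size (faces w)) := \row_a X (nth (0%N, true) (faces w) a).

(** On the diagonal of the bilinear form the entries at (T,B) and (B,T) add up to the sign of the
    crossing, which completes the square of the difference of the top and the bottom value. *)
Lemma seifert_form :
  (face_row *m seifert_matrix w *m face_row^T) 0 0 =
  \sum_(0 <= i < size w | rightward w i)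
    (- (crossing_sign i / 2) * (X (top_face i) - X (bottom_face i)) ^+ 2
     - (X (top_face i) - X (bottom_face i)) * X (left_face i)).
Proof.
rewrite -mulmxA mxE.
under eq_bigr => a _.
  rewrite [face_row 0 a]mxE mxE mulr_sumr.
  under eq_bigr => b _.
    rewrite !mxE /seifert_pairing mulr_suml mulr_sumr.
  over.
over.
rewrite /=; under eq_bigr => a _ do rewrite exchange_big /=.
rewrite exchange_big /= big_nat_cond [RHS]big_nat_cond.
apply: eq_bigr => i /andP[/andP[_ lti] _].
have [Tw Bw Lw] := adjacent_faces lti.
rewrite -/(crossing_sign i) -/(top_face i) -/(bottom_face i) -/(left_face i).
move: (crossing_sign i) (top_face i) (bottom_face i) (left_face i) Tw Bw Lw => e T B L Tw Bw Lw.
transitivity (- (e / 2) * (X T * X T) - e / 2 * (X B * X B) + (e + 1) / 2 * (X T * X B)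
  + (e - 1) / 2 * (X B * X T) - X T * X L + X B * X L); last by field.
rewrite -(sum_at_faces Tw Tw) -(sum_at_faces Bw Bw) -(sum_at_faces Tw Bw) -(sum_at_faces Bw Tw).
rewrite -(sum_at_faces Tw Lw) -(sum_at_faces Bw Lw).
rewrite !mulr_sumr -!sumrN -!big_split /=; apply: eq_bigr => a _.
rewrite !mulr_sumr -!sumrN -!big_split /=; apply: eq_bigr => b _.
ring.
Qed.

End SeifertForm.

Lemma symmetrized_form n (M : 'M[rat]_n) (x : 'rV[rat]_n) :
  (x *m (M + M^T) *m x^T) 0 0 = (x *m M *m x^T) 0 0 *+ 2.
Proof.
rewrite mulmxDr mulmxDl mxE mulr2n; congr (_ + _).
have -> : x *m M^T *m x^T = (x *m M *m x^T)^T by rewrite !trmx_mul trmxK mulmxA.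
by rewrite mxE.
Qed.


(** * Certified positivity of integral quadratic forms *)

Local Arguments BinInt.Z.add : simpl never.
Local Arguments BinInt.Z.mul : simpl never.
Local Arguments BinInt.Z.opp : simpl never.

(** Binary integers let the elimination be run by computation. *)
Definition rat_of_Z (z : BinNums.Z) : rat := (int_of_Z z)%:~R.

Lemma rat_of_ZD a b : rat_of_Z (BinInt.Z.add a b) = rat_of_Z a + rat_of_Z b.
Proof. by rewrite /rat_of_Z (_ : BinInt.Z.add a b = a + b) // !rmorphD. Qed.

Lemma rat_of_ZM a b : rat_of_Z (BinInt.Z.mul a b) = rat_of_Z a * rat_of_Z b.
Proof. by rewrite /rat_of_Z (_ : BinInt.Z.mul a b = a * b) // !rmorphM. Qed.

Lemma rat_of_ZN a : rat_of_Z (BinInt.Z.opp a) = - rat_of_Z a.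
Proof. by rewrite /rat_of_Z (_ : BinInt.Z.opp a = - a) // !rmorphN. Qed.

Lemma rat_of_Z_gt0 a : BinInt.Z.ltb BinNums.Z0 a -> 0 < rat_of_Z a.
Proof. by case: a => // p _; rewrite ltr0z; lia. Qed.

(* A symmetric matrix, as the list of its diagonal entries, each with the list
   of the entries on its right. *)
Definition symmetric_table : Type := seq (BinNums.Z * seq BinNums.Z).

Definition shift (u : nat -> rat) (k : nat) : rat := u k.+1.

Fixpoint dot (v : seq BinNums.Z) (u : nat -> rat) : rat :=
  if v is a :: v' then rat_of_Z a * u 0%N + dot v' (shift u) else 0.

Fixpoint form (G : symmetric_table) (u : nat -> rat) : rat :=
  if G is (a, v) :: G' then
    rat_of_Z a * u 0%N ^+ 2 + 2 * u 0%N * dot v (shift u) + form G' (shift u)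
  else 0.

Lemma dot_eq0 v u : (forall k, u k = 0) -> dot v u = 0.
Proof. by elim: v u => //= a v IH u u0; rewrite IH ?u0 ?mulr0 ?addr0 // => k; apply: u0. Qed.

Lemma form_eq0 G u : (forall k, u k = 0) -> form G u = 0.
Proof.
elim: G u => //= [[a v] G] IH u u0.
by rewrite IH ?u0 ?expr0n ?mulr0 ?mul0r ?addr0 // => k; apply: u0.
Qed.

Fixpoint add_entry (c : BinNums.Z) (k : nat) (v : seq BinNums.Z) : seq BinNums.Z :=
  if k is k'.+1 then head BinNums.Z0 v :: add_entry c k' (behead v)
  else BinInt.Z.add (head BinNums.Z0 v) c :: behead v.

Lemma rat_of_Z0 : rat_of_Z BinNums.Z0 = 0. Proof. by []. Qed.

Lemma dot_add_entry c k v u : dot (add_entry c k v) u = dot v u + rat_of_Z c * u k.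
Proof.
elim: k v u => [|k IH] [|a v] u /=; rewrite ?IH ?rat_of_ZD ?rat_of_Z0 /shift /=; ring.
Qed.

Fixpoint add_product (c : BinNums.Z) (k l : nat) (G : symmetric_table) : symmetric_table :=
  let: (a, v) := head (BinNums.Z0, [::]) G in
  match k, l with
  | 0%N, 0%N => (BinInt.Z.add a (BinInt.Z.add c c), v) :: behead G
  | 0%N, l'.+1 => (a, add_entry c l' v) :: behead G
  | k'.+1, 0%N => (a, add_entry c k' v) :: behead G
  | k'.+1, l'.+1 => (a, v) :: add_product c k' l' (behead G)
  end.

Lemma form_add_product c k l G u :
  form (add_product c k l G) u = form G u + 2 * rat_of_Z c * u k * u l.
Proof.
elim: k l G u => [|k IH] [|l] [|[a v] G] u /=;
  rewrite ?IH ?dot_add_entry ?rat_of_ZD ?rat_of_Z0 /= /shift; ring.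
Qed.

Fixpoint linear_combination (a c : BinNums.Z) (v v' : seq BinNums.Z) : seq BinNums.Z :=
  match v, v' with
  | x :: v1, x' :: v1' =>
    BinInt.Z.add (BinInt.Z.mul a x) (BinInt.Z.mul c x') :: linear_combination a c v1 v1'
  | _, [::] => [seq BinInt.Z.mul a x | x <- v]
  | [::], _ => [seq BinInt.Z.mul c x | x <- v']
  end.

Lemma dot_scale c v u : dot [seq BinInt.Z.mul c x | x <- v] u = rat_of_Z c * dot v u.
Proof. by elim: v u => [|x v IH] u /=; rewrite ?IH ?rat_of_ZM; ring. Qed.

Lemma dot_linear_combination a c v v' u :
  dot (linear_combination a c v v') u = rat_of_Z a * dot v u + rat_of_Z c * dot v' u.
Proof.
elim: v v' u => [|x v IH] [|x' v'] u /=; rewrite ?IH ?dot_scale ?rat_of_ZD ?rat_of_ZM; ring.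
Qed.

Local Arguments linear_combination : simpl never.

(** Fraction-free: the table of [a] times the remaining form minus the square of [dot v]. Missing
    entries count as zero, and [n] bounds the length of the result. *)
Fixpoint schur_complement (n : nat) (a : BinNums.Z) (v : seq BinNums.Z) (G : symmetric_table) :
    symmetric_table :=
  if n is n'.+1 then
    let: (a', v') := head (BinNums.Z0, [::]) G in
    let c := head BinNums.Z0 v in
    (BinInt.Z.add (BinInt.Z.mul a a') (BinInt.Z.opp (BinInt.Z.mul c c)),
     linear_combination a (BinInt.Z.opp c) v' (behead v)) ::
    schur_complement n' a (behead v) (behead G)
  else [::].

Lemma form_schur_complement n a v G u : (size v <= n)%N -> (size G <= n)%N ->
  form (schur_complement n a v G) u = rat_of_Z a * form G u - dot v u ^+ 2.
Proof.
elim: n v G u => [|n IH] [|c v] [|[a' v'] G] u //=; rewrite ?ltnS => hv hG; first ring;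
  rewrite IH // ?dot_linear_combination ?rat_of_ZD ?rat_of_ZN ?rat_of_ZM ?rat_of_Z0 /=; ring.
Qed.

Definition divisible_by (g x : BinNums.Z) : bool :=
  BinInt.Z.eqb (BinInt.Z.mul g (BinInt.Z.div x g)) x.

Lemma divisible_byE g x : divisible_by g x -> rat_of_Z x = rat_of_Z g * rat_of_Z (BinInt.Z.div x g).
Proof. by move=> h; rewrite -rat_of_ZM; congr rat_of_Z; move: h; rewrite /divisible_by; lia. Qed.

Definition divide_table (g : BinNums.Z) (G : symmetric_table) : symmetric_table :=
  [seq (BinInt.Z.div r.1 g, [seq BinInt.Z.div x g | x <- r.2]) | r <- G].

Definition table_divisible (g : BinNums.Z) (G : symmetric_table) : bool :=
  all (fun r => divisible_by g r.1 && all (divisible_by g) r.2) G.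

Lemma dot_divide g v u : all (divisible_by g) v ->
  dot v u = rat_of_Z g * dot [seq BinInt.Z.div x g | x <- v] u.
Proof.
elim: v u => [|x v IH] u /=; first by rewrite mulr0.
by case/andP=> /divisible_byE-> /IH->; ring.
Qed.

Lemma form_divide g G u : table_divisible g G -> form G u = rat_of_Z g * form (divide_table g G) u.
Proof.
elim: G u => [|[a v] G IH] u /=; first by rewrite mulr0.
by case/andP=> /andP[/divisible_byE-> /dot_divide->] /IH->; ring.
Qed.

(* Gaussian elimination that skips the coordinates with a nonpositive pivot.
   As in Bareiss' algorithm, each Schur complement is divisible by the previous
   pivot [g]; this is checked rather than proved. *)
Fixpoint positive_coordinates (n : nat) (g : BinNums.Z) (G : symmetric_table) : bitseq :=
  if n is n'.+1 then
    if G is (a, v) :: G' then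
      let H := schur_complement (maxn (size v) (size G')) a v G' in
      if [&& BinInt.Z.ltb BinNums.Z0 a, BinInt.Z.ltb BinNums.Z0 g & table_divisible g H] then
        true :: positive_coordinates n' a (divide_table g H)
      else false :: positive_coordinates n' g G'
    else [::]
  else [::].

(** For a pivot [a], completing the square writes [a] times the form as a square plus [g] times the
    form of the divided Schur complement. A rejected pivot only sets its coordinate to zero, so
    skipping never harms correctness. *)
Lemma form_positive n g G u :
  (forall k, ~~ nth false (positive_coordinates n g G) k -> u k = 0) ->
  0 <= form G u /\ (form G u = 0 -> forall k, u k = 0).
Proof.
elim: n g G u => [|n IH] g [|[a v] G] u; try by move=> h;
  have u0 k : u k = 0 by [apply: h; rewrite /= nth_nil]; rewrite form_eq0.
rewrite /=; case: ifP => [/and3P[/rat_of_Z_gt0 a0 /rat_of_Z_gt0 g0 div]|_] h.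
  have [ge eq0] := IH _ _ (shift u) (fun k => h k.+1).
  have E := form_divide (shift u) div.
  rewrite form_schur_complement ?leq_maxl ?leq_maxr // in E.
  set q := form _ (shift u) in ge eq0 E.
  set f := _ + form G (shift u).
  have F : rat_of_Z a * f = (rat_of_Z a * u 0%N + dot v (shift u)) ^+ 2 + rat_of_Z g * q.
    by rewrite -E /f; ring.
  have f0 : 0 <= f by rewrite -(pmulr_rge0 _ a0) F addr_ge0 ?sqr_ge0 // mulr_ge0 // ltW.
  split=> // fE; move: F; rewrite fE mulr0 => /esym/eqP.
  rewrite paddr_eq0 ?sqr_ge0 //; last by rewrite mulr_ge0 // ltW.
  rewrite sqrf_eq0 mulf_eq0 (gt_eqF g0) /= => /andP[/eqP s0 /eqP q0].
  have us := eq0 q0; case=> [|k]; last exact: us.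
  by move: s0; rewrite dot_eq0 // addr0 => /eqP; rewrite mulf_eq0 (gt_eqF a0) /= => /eqP.
have u0 : u 0%N = 0 by apply: h.
have [ge eq0] := IH _ _ (shift u) (fun k => h k.+1).
rewrite u0 expr0n !mulr0 mul0r !add0r; split=> // /eq0 us [|k] //; exact: us.
Qed.

(** * Definiteness of the Seifert form on a large subspace *)

Section SeifertTable.

Variables (neg : bool) (w : gauss_code) (phi : nat * bool -> nat).

Let unit (b : bool) : BinNums.Z := if b then BinNums.Zpos BinNums.xH else BinNums.Zneg BinNums.xH.
Let double (z : BinNums.Z) : BinNums.Z := BinInt.Z.add z z.

(* Four times the contribution of the crossing to the Seifert form, negated if [neg]. *)
Definition add_crossing (i : nat) (G : symmetric_table) : symmetric_table :=
  let T := phi (next_position w i, true) in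
  let B := phi (twin w i, true) in
  let L := phi (i, true) in
  let e := unit (positive (letter w i) (+) neg) in
  add_product (BinInt.Z.opp e) T T (add_product (BinInt.Z.opp e) B B
    (add_product (double e) T B (add_product (double (unit neg)) T L
      (add_product (double (unit (~~ neg))) B L G)))).

Definition seifert_table : symmetric_table :=
  foldr add_crossing [::] [seq i <- iota 0 (size w) | rightward w i].

Hypothesis wf : well_formed w.
Hypothesis inv : {in sides w, forall x, phi (turn_left w x) = phi x}.

Lemma form_seifert_table (psi : nat -> rat) :
  let x := face_row w (psi \o phi) in
  form seifert_table psi =
  (-1) ^+ neg * 4 * (x *m seifert_matrix w *m x^T) 0 0.
Proof.
rewrite /= seifert_form // mulr_sumr /seifert_table.
rewrite -[X in iota 0 X]subn0 -/(index_iota 0 (size w)) -[RHS]big_filter.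
have : {subset [seq i <- index_iota 0 (size w) | rightward w i] <= index_iota 0 (size w)}.
  exact: mem_subseq (filter_subseq _ _).
elim: [seq _ <- _ | _] => [|i r IH] sub; first by rewrite big_nil.
rewrite big_cons -IH /=; last by move=> j jr; apply: sub; rewrite inE jr orbT.
have lti : (i < size w)%N by have := sub i (mem_head _ _); rewrite mem_index_iota.
have side j : (j < size w)%N -> phi (face_of w (j, true)) = phi (j, true).
  by move=> ltj; apply: face_label => //; rewrite mem_sides.
rewrite /top_face /bottom_face /left_face !side ?twin_lt //; last first.
  by rewrite ltn_mod; apply: leq_ltn_trans lti.
rewrite !form_add_product /double !rat_of_ZN !rat_of_ZD /crossing_sign.
have u1 : rat_of_Z (BinNums.Zpos BinNums.xH) = 1 by [].
have um1 : rat_of_Z (BinNums.Zneg BinNums.xH) = -1 by [].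
by case: (positive _); case: neg; rewrite /unit /= ?u1 ?um1; field.
Qed.

Lemma signature_neq0 s :
  let pc := positive_coordinates (size seifert_table) (BinNums.Zpos BinNums.xH) seifert_table in
  knot_signature w s -> (size (faces w) < (count id pc).*2)%N -> s != 0.
Proof.
set pc := positive_coordinates _ _ _ => /= sig.
pose c := [seq l <- iota 0 (size pc) | nth false pc l].
have -> : count id pc = size c.
  by rewrite size_filter -[in LHS](mkseq_nth false pc) count_map; apply: eq_count.
(* Row [t] is the indicator of the faces whose label is the [t]-th selected coordinate. Positivity
   of the form makes the rows independent. *)
pose Q : 'M[rat]_(size c, size (faces w)) :=
  \matrix_(t, a) (phi (nth (0%N, true) (faces w) a) == nth 0%N c t)%:R.
pose psi (u : 'rV[rat]_(size c)) l := \sum_t u 0 t * (l == nth 0%N c t)%:R.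
have uQ u : u *m Q = face_row w (psi u \o phi).
  by apply/rowP=> a; rewrite !mxE; apply: eq_bigr => t _; rewrite mxE.
have pos (u : 'rV[rat]_(size c)) : u != 0 -> 0 < form seifert_table (psi u).
  move=> u0; have [|ge eq0] := @form_positive (size seifert_table) (BinNums.Zpos BinNums.xH)
    seifert_table (psi u).
    move=> l; rewrite -/pc => npl; rewrite /psi big1 // => t _.
    case: eqP => [e|]; last by rewrite mulr0.
    have : l \in c by rewrite e mem_nth.
    by rewrite mem_filter (negPf npl).
  rewrite lt_neqAle ge andbT eq_sym; apply: contraNneq u0 => /eq0 psi0.
  apply/eqP/rowP => t; rewrite mxE -(psi0 (nth 0%N c t)) /psi (bigD1 t) //= eqxx mulr1 big1 ?addr0
    //.
  move=> t' ne; rewrite nth_uniq ?filter_uniq ?iota_uniq // eq_sym.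
  by rewrite (_ : (t' == t :> nat) = false) ?mulr0 //; apply/negbTE.
have form_neg u : form seifert_table (psi u) = 2 * ((-1) ^+ neg *
    (u *m Q *m (seifert_matrix w + (seifert_matrix w)^T) *m (u *m Q)^T) 0 0).
  by rewrite form_seifert_table uQ symmetrized_form; ring.
have {}pos (u : 'rV[rat]_(size c)) : u != 0 -> 0 < (-1) ^+ neg *
    (u *m Q *m (seifert_matrix w + (seifert_matrix w)^T) *m (u *m Q)^T) 0 0.
  by move=> /pos; rewrite form_neg pmulr_rgt0.
case: neg pos {form_neg} => pos lt.
  have /(signature_positive_subspace (Q := Q))/(_ lt) := has_signatureN sig.
  rewrite oppr_gt0 => h; apply: ltr0_neq0; apply: h => u u0.
  by have := pos u u0; rewrite expr1 mulN1r mulmxN mulNmx [in X in _ -> X]mxE.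
apply: lt0r_neq0; apply: (signature_positive_subspace (Q := Q)) sig lt _ => u u0.
by have := pos u u0; rewrite expr0 mul1r.
Qed.

End SeifertTable.

(** The threshold [(size w)./2 + 2] is the number of faces. Coordinate 0 belongs to no face, since
    the labels start from 1; its pivot is 0, so it is skipped. *)
Definition definite_check (neg : bool) (w : gauss_code) : bool :=
  let lab := face_labels w in
  let G := seifert_table neg w (fun x => nth 0%N lab (side_index x)) in
  ((size w)./2 + 2 < (count id (positive_coordinates (size G) (BinNums.Zpos BinNums.xH) G)).*2)%N.

Lemma definite_checkP neg w s : well_formed w -> planar_check w -> definite_check neg w ->
  knot_signature w s -> s != 0.
Proof.
move=> wf pc def sig; have /andP[/eqP/eq_in_map inv _] := pc.
apply: (signature_neq0 (neg := neg) wf inv sig); move: def; rewrite /definite_check.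
have /orP[/eqP w0|/eqP->//] := planar_checkP wf pc.
by rewrite w0.
Qed.

(** For opposite mirror flags the signatures of the summands have equal signs, both positive for
    [b = true] and both negative otherwise; hence the argument [~~ b]. *)
Lemma opposite_sum_check b : all (fun i => all (fun j =>
    let w := connected_sum (rot i (if b then mirror knot_5_1 else knot_5_1))
                           (rot j (if b then knot_8_2 else mirror knot_8_2)) in
    [&& well_formed w, planar_check w & definite_check (~~ b) w]) (iota 0 16)) (iota 0 10).
Proof. by case: b; vm_compute. Qed.

Lemma opposite_sum_signature b i j :
  ~ knot_signature (connected_sum (rot i (if b then mirror knot_5_1 else knot_5_1))
                                  (rot j (if b then knot_8_2 else mirror knot_8_2))) 0.
Proof.
rewrite rot_reduce [rot j _]rot_reduce.
rewrite (_ : size _ = 10%N); last by case: b.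
rewrite (_ : size _ = 16%N); last by case: b.
set i' := if (i < 10)%N then i else 0%N; set j' := if (j < 16)%N then j else 0%N.
have hi : (i' < 10)%N by rewrite /i'; case: ifP.
have hj : (j' < 16)%N by rewrite /j'; case: ifP.
have /all_iotaP/(_ i' hi)/all_iotaP/(_ j' hj) /and3P[wf pc def] := opposite_sum_check b.
by move=> sig; have := definite_checkP wf pc def sig.
Qed.

Local Close Scope ring_scope.

(** * The unknotting numbers *)

Lemma unknotting_number_5_1 b : unknotting_number (if b then mirror knot_5_1 else knot_5_1) 2.
Proof.
split; last exact: unknotting_5_1_ge2.
by case: b; [apply: unknots_mirror_5_1|apply: unknots_5_1].
Qed.

Lemma unknotting_number_8_2 b : unknotting_number (if b then mirror knot_8_2 else knot_8_2) 2.
Proof.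
split; last exact: unknotting_8_2_ge2.
by case: b; [apply: unknots_mirror_8_2|apply: unknots_8_2].
Qed.

(** The existence of a least number of changes is obtained by excluded middle, since no decision
    procedure for [unknots_with] is at hand. *)
Lemma unknotting_number_le n w : unknots_with n w -> exists2 k, unknotting_number w k & k <= n.
Proof.
elim/ltn_ind: n => n IH u; case: (classic (exists2 m, unknots_with m w & m < n)) => [[m um
  lt]|none].
  by have [k uk le] := IH m lt um; exists k => //; apply: leq_trans le (ltnW lt).
exists n => //; split=> // m um; rewrite leqNgt; apply/negP => lt.
by apply: none; exists m.
Qed.

Theorem theorem1p2 (m1 m2 : bool) (i j : nat) :
  let K1 := if m1 then mirror knot_5_1 else knot_5_1 in
  let K2 := if m2 then mirror knot_8_2 else knot_8_2 in
  let K5 := connected_sum (rot i K1) (rot j K2) in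
  knot_signature K5 0%R ->
  [/\ unknotting_number K1 2,
      unknotting_number K2 2
    & exists2 k, unknotting_number K5 k & k <= 3].
Proof.
move=> K1 K2 K5 sig; split; [exact: unknotting_number_5_1|exact: unknotting_number_8_2|].
(* The codes [knot_5_1] and [knot_8_2] have signatures of opposite sign, so signature 0 leaves equal
   mirror flags. *)
have m12 : m1 = m2.
  case: m1 m2 @K1 @K2 @K5 sig => -[] //= sig.
    by case: (@opposite_sum_signature true i j sig).
  by case: (@opposite_sum_signature false i j sig).
apply: unknotting_number_le; rewrite /K5 /K1 /K2 m12; exact: unknots_sum.
Qed.
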